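(* There exists a two-dimensional classical reversible Turing machine that is physically universal (in both the moving head model and the moving tape model).
   Context: Fix the dimension $d=2$. Intervals $[a,b]$ are integer intervals; $\mathbb N=\{0,1,2,\dots\}$. **Configurations and patterns.** For a finite nonempty set $Q$ and a symbol $\#\notin Q$, $X_Q\subset (Q\cup\{\#\})^{\mathbb Z^d}$ is the set of configurations in which at most one coordinate carries an element of $Q$. For $q\in Q$, $\vec v\in\mathbb Z^d$, $q[\vec v]\in X_Q$ is the unique configuration with value $q$ at $\vec v$. For a finite alphabet $\Sigma$ and $D\subset\mathbb Z^d$, $\mathcal P_{Q,\Sigma}(D)$ is the set of restrictions to $D$ of elements of $X_Q\times\Sigma^{\mathbb Z^d}$, and $\mathcal P^*_{Q,\Sigma}(D)$ is the subset of those in which an element of $Q$ (the head) occurs. Write $\mathcal P_{Q,\Sigma}(m)$, $\mathcal P^*_{Q,\Sigma}(m)$ when $D=[0,m-1]^d$. The symbol $\sqcup$ denotes the union of partial configurations with disjoint domains; an element of $\Sigma^E$ is regarded as having $\#$ at every coordinate of $E$ when joined with a pattern having a $Q$-layer. Translation: $\tau_{\vec v}(x)_{\vec w}=x_{\vec w+\vec v}$. **Turing machines.** A $d$-dimensional Turing machine is $M=(Q,\Sigma,N,\delta)$ with $Q$ a finite nonempty state set, $\Sigma$ a finite alphabet (with a distinguished symbol $0\in\Sigma$), $N\subset\mathbb Z^d$ finite, and $\delta:Q\times\Sigma^N\to Q\times\Sigma^N\times N$. Moving head model: $M$ acts on $X_Q\times\Sigma^{\mathbb Z^d}$ by $M(\#^{\mathbb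 Z^d},x)=(\#^{\mathbb Z^d},x)$ and $M(q[\vec v],x)=(p[\vec v+\vec w],y)$, where $\delta(q,\tau_{\vec v}(x)|_N)=(p,P,\vec w)$ and $y$ is obtained from $x$ by replacing the contents of $N+\vec v$ with $P$. Moving tape model: $M$ acts on $Q\times\Sigma^{\mathbb Z^d}$ by $M(q,x)=(p,\tau_{\vec w}(z))$, where $\delta(q,x|_N)=(p,P,\vec w)$ and $z$ is obtained from $x$ by replacing the contents of $N$ with $P$. $M$ is reversible if these maps are bijective. **Classical reversible Turing machines.** A reversible Turing machine is classical if each step consists of first applying a fixed permutation $\pi\in\mathrm{Sym}(Q\times\Sigma)$ to the pair (current state, tape symbol under the head), and then moving the head by one step in a cardinal direction or leaving it in place, the choice of move being a function of the (new) current state only. **Disjoint $0$-orbits.** A tuple $(P_0,\dots,P_{k-1})\in\mathcal P^*_{Q,\Sigma}(m)^k$ has disjoint $0$-orbits if the (moving head) $M$-orbits of $P_i\sqcup 0^{\mathbb Z^d\setminus[0,m-1]^d}$ are pairwise disjoint for distinct indices. A tuple $((q_0,P_0),\dots,(q_{k-1},P_{k-1}))\in(Q\times\Sigma^{[0,m-1]^d})^k$ has disjoint $0$-orbits if the (moving tape) $M$-orbits of $(q_j,P_j\sqcup 0^{\mathbb Z^d\setminus[0,m-1]^d})$ are pairwise disjoint for distinct indices. **Physical transformability.** In the moving head model, $P=(P_j)_{j<k}\in\mathcal P^*_{Q,\Sigma}(m)^k$ is physically transformable to $R=(R_j)_{j<k}\in\mathcal P_{Q,\Sigma}(m)^k$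 if for some $t\in\mathbb N$ there is a partial configuration $x\in\mathcal P_{Q,\Sigma}(\mathbb Z^d\setminus[0,m-1]^d)$ (necessarily headless if $k\geq 1$, so that $P_j\sqcup x\in X_Q\times\Sigma^{\mathbb Z^d}$) such that $M^t(P_j\sqcup x)|_{[0,m-1]^d}=R_j$ for all $j$. In the moving tape model, $((q_j,P_j))_{j<k}$ is physically transformable to $((p_j,R_j))_{j<k}$ (both in $(Q\times\Sigma^{[0,m-1]^d})^k$) if for some $t\in\mathbb N$ there is $x\in\Sigma^{\mathbb Z^d\setminus[0,m-1]^d}$ such that for all $j$, $M^t(q_j,P_j\sqcup x)=(p_j,x_j)$ with $x_j|_{[0,m-1]^d}=R_j$. **Physical universality.** $M$ is physically universal in the moving head model if for all $k,m\in\mathbb N$ and all $P,R\in\mathcal P^*_{Q,\Sigma}(m)^k$ such that $P$ has disjoint $0$-orbits, $P$ is physically transformable to $R$. Physical universality in the moving tape model is defined in exactly the same way, with $P,R\in(Q\times\Sigma^{[0,m-1]^d})^k$ and the moving tape notions of disjoint $0$-orbits and transformability. *)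

(* Defs.v *)
From HB Require Import structures.
From mathcomp Require Import all_boot all_order all_fingroup all_algebra finmap.
From mathcomp Require Import boolp classical_sets functions.

Set Implicit Arguments.
Unset Strict Implicit.
Unset Printing Implicit Defensive.

Import Order.TTheory GRing.Theory Num.Theory.
Local Open Scope classical_set_scope.
Local Open Scope ring_scope.

Notation Z2 := (int * int)%type.

Definition partial (D : pred Z2) (T : Type) : Type := {v : Z2 | D v} -> T.

Definition restr (T : Type) (D : pred Z2) (x : Z2 -> T) : partial D T :=
  fun u => x (sval u).
Arguments restr {T} D x.

Definition join (T : Type) (D : pred Z2)
    (p : partial D T) (x : partial (predC D) T) : Z2 -> T :=
  fun v => match pselect (D v) with
           | left h => p (exist _ v h)
           | right h => x (exist _ v (introN idP h))
           end.

Definition box (m : nat) : pred Z2 :=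
  fun v => (0 <= v.1 < m%:Z) && (0 <= v.2 < m%:Z).

Definition shift (T : Type) (v : Z2) (x : Z2 -> T) : Z2 -> T :=
  fun w => x (w + v).

Definition write (T : Type) (N : {fset Z2}) (v : Z2) (P : {ffun N -> T})
    (x : Z2 -> T) : Z2 -> T :=
  fun w => if insub (w - v) is Some u then P u else x w.

Definition write1 (T : Type) (v : Z2) (a : T) (x : Z2 -> T) : Z2 -> T :=
  fun w => if w == v then a else x w.

(* [None] is the symbol #. *)
Definition XQ (Q : Type) : set (Z2 -> option Q) :=
  [set h | forall v w, h v <> None -> h w <> None -> v = w].

(* q[v] *)
Definition head_at (Q : Type) (q : Q) (v : Z2) : Z2 -> option Q :=
  fun w => if w == v then Some q else None.

Definition conf (Q Sigma : Type) : Type :=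
  ((Z2 -> option Q) * (Z2 -> Sigma))%type.

Definition confs (Q Sigma : Type) : set (conf Q Sigma) := [set c | XQ c.1].

Definition pattern (Q Sigma : Type) (D : pred Z2) : Type :=
  (partial D (option Q) * partial D Sigma)%type.

Definition crestr (Q Sigma : Type) (D : pred Z2) (c : conf Q Sigma) :
  pattern Q Sigma D := (restr D c.1, restr D c.2).
Arguments crestr {Q Sigma} D c.

Definition cjoin (Q Sigma : Type) (D : pred Z2)
    (p : pattern Q Sigma D) (x : pattern Q Sigma (predC D)) : conf Q Sigma :=
  (join p.1 x.1, join p.2 x.2).

Definition headless (Q Sigma : Type) (D : pred Z2) (x : partial D Sigma) :
  pattern Q Sigma D := (fun=> None, x).
Arguments headless Q {Sigma D} x.

Definition patterns (Q Sigma : Type) (D : pred Z2) : set (pattern Q Sigma D) :=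
  [set p | exists2 c : conf Q Sigma, confs c & crestr D c = p].

Definition patterns_head (Q Sigma : Type) (D : pred Z2) :
    set (pattern Q Sigma D) :=
  [set p | patterns p /\ exists u, p.1 u <> None].

Record turing_machine : Type := TuringMachine {
  state : finType;
  symb : finType;
  nbhd : {fset Z2};
  delta : state * {ffun nbhd -> symb} -> state * {ffun nbhd -> symb} * nbhd;
  blank : symb;
  state_gt0 : (0 < #|state|)%N
}.

Section Actions.
Variable M : turing_machine.
Local Notation Q := (state M).
Local Notation Sigma := (symb M).
Local Notation N := (nbhd M).

Definition local_view (x : Z2 -> Sigma) : {ffun N -> Sigma} :=
  [ffun u : N => x (val u)].

(* M(q[v], x) *)
Definition head_act (q : Q) (v : Z2) (x : Z2 -> Sigma) : conf Q Sigma :=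
  let: (p, P, w) := delta (q, local_view (shift v x)) in
  (head_at p (v + val w), write v P x).

(* Configurations outside [confs], on which the machine is not defined, are
   fixed just like the headless ones. *)
Definition head_step (c : conf Q Sigma) : conf Q Sigma :=
  match pselect (exists qv : Q * Z2, c.1 = head_at qv.1 qv.2) with
  | left h => let qv := sval (cid h) in head_act qv.1 qv.2 c.2
  | right _ => c
  end.

Definition tape_step (c : Q * (Z2 -> Sigma)) : Q * (Z2 -> Sigma) :=
  let: (p, P, w) := delta (c.1, local_view c.2) in
  (p, shift (val w) (write 0 P c.2)).

Definition reversible : Prop :=
  set_bij (@confs Q Sigma) (@confs Q Sigma) head_step /\ bijective tape_step.

Definition unit_moves : seq Z2 :=
  [:: (0, 0); (1, 0); (- 1, 0); (0, 1); (0, - 1)].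

Definition classical : Prop :=
  exists (pi : {perm Q * Sigma}) (move : Q -> Z2),
    [/\ forall q, move q \in unit_moves,
        forall q v x,
          head_step (head_at q v, x) =
          let: (p, a) := pi (q, x v) in
          (head_at p (v + move p), write1 v a x)
      & forall q x,
          tape_step (q, x) =
          let: (p, a) := pi (q, x 0) in (p, shift (move p) (write1 0 a x))].

(* The two-sided orbit: for bijective [f] this is {f^n(x) | n in Z}. *)
Definition zorbit (T : Type) (f : T -> T) (x : T) : set T :=
  [set y | exists n : nat, y = iter n f x \/ x = iter n f y].

Definition blanks (D : pred Z2) : partial D Sigma := fun=> blank M.

Definition head_disjoint0 (m k : nat) (P : 'I_k -> pattern Q Sigma (box m)) :
    Prop :=
  let c j := cjoin (P j) (headless Q (@blanks (predC (box m)))) in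
  forall i j, i != j ->
    zorbit head_step (c i) `&` zorbit head_step (c j) = set0.

Definition tape_disjoint0 (m k : nat) (P : 'I_k -> Q * partial (box m) Sigma) :
    Prop :=
  let c j := ((P j).1, join (P j).2 (@blanks (predC (box m)))) in
  forall i j, i != j ->
    zorbit tape_step (c i) `&` zorbit tape_step (c j) = set0.

Definition head_transformable (m k : nat)
    (P R : 'I_k -> pattern Q Sigma (box m)) : Prop :=
  exists (t : nat) (x : pattern Q Sigma (predC (box m))),
    patterns x /\
    forall j, confs (cjoin (P j) x) /\
              crestr (box m) (iter t head_step (cjoin (P j) x)) = R j.

Definition tape_transformable (m k : nat)
    (P R : 'I_k -> Q * partial (box m) Sigma) : Prop :=
  exists (t : nat) (x : partial (predC (box m)) Sigma),
    forall j, let y := iter t tape_step ((P j).1, join (P j).2 x) in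
              y.1 = (R j).1 /\ restr (box m) y.2 = (R j).2.

Definition head_physically_universal : Prop :=
  forall (k m : nat) (P R : 'I_k -> pattern Q Sigma (box m)),
    (forall j, patterns_head (P j)) -> (forall j, patterns_head (R j)) ->
    head_disjoint0 P -> head_transformable P R.

Definition tape_physically_universal : Prop :=
  forall (k m : nat) (P R : 'I_k -> Q * partial (box m) Sigma),
    tape_disjoint0 P -> tape_transformable P R.

End Actions.

(* Main.v *)
From HB Require Import structures.
From Stdlib Require Import ZArith Lia List FinFun.
Require Import Defs.
From mathcomp Require Import all_boot all_fingroup all_algebra finmap ssrZ zify.
From mathcomp Require Import boolp classical_sets functions.

(* The machine is a head flying straight over blank cells.  When it meets a
   particle (a cell [true]) it picks it up, carries it in the direction [push]
   to the first free cell, drops it there and leaves flying to its left.  East-,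
   North- and West-going heads push particles ahead of them, South-going ones
   push them East.  Since only North-going heads move particles vertically, the
   head leaves every finite configuration, forwards and backwards in time.

   All [k] universes are kept outside a growing box, their heads flying away
   along rays while common particles are added farther out to turn them one ray
   at a time.  To read and rewrite the contents, a head is sent down a column
   onto a "port" particle, which turns it East along a row, where it moves the
   first particle to the next hole and leaves North along the column of that
   hole.  Repeating this empties the rows from the top; in the topmost row in
   which two universes of the same ray differ, the particles eventually land in
   different columns, so the rays separate.  Once all rays are distinct, the same
   visits, with more ports, write into each universe the contents from which a
   head entering from the South along a reserved column evolves to its goal.
   The heads are finally sent in along these columns, runs of particles
   of variable length adjusting the arrival times. *)

Set Implicit Arguments.
Unset Strict Implicit.
Unset Printing Implicit Defensive.

Local Open Scope Z_scope.
Arguments Z.mul : simpl never.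
Arguments Z.add : simpl never.
Arguments Z.sub : simpl never.

(** The state [Pause] is what makes universality possible: without it every step would move the head
    by one cell, and the parity of x + y + time would be conserved. With it, getting past a run of
    [n] particles costs [2 * n + 1] steps, so that delays of either parity can be arranged.

    The environment is one tape, fixed in advance and common to all universes, so the argument is
    written backwards: [wins] asks for an environment beyond the current box, for arbitrary times
    already elapsed, and each lemma places a few particles and reduces to a later family of rays.
    Times are settled only at the very end.

    Three obstacles shape the invariants. Particles put down for one ray must stay off the other
    rays and off the columns reserved for the final entries ([others], [prot]). Every visit leaves
    debris above the visited contents, which later heads may hit ([gstate]). And two universes on
    one ray must never acquire equal tapes: disjointness of orbits excludes this at the start, and
    later a visit that leads both out through one column is injective on contents ([probe_inj]). *)

(** * The machine on integer coordinates *)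

Inductive dir := East | North | West | South.

Definition left d :=
  match d with East => North | North => West | West => South | South => East end.

Definition push d :=
  match d with East => East | North => North | West => West | South => East end.

Definition dirx d := match d with East => 1 | West => -1 | _ => 0 end.
Definition diry d := match d with North => 1 | South => -1 | _ => 0 end.

Inductive mode := Fly of dir | Pause of dir | Carry of dir.

Definition trans (q : mode) (s : bool) : mode * bool :=
  match q, s with
  | Fly d, false => (Fly d, false)
  | Fly d, true => (Pause d, false)
  | Pause d, _ => (Carry d, s)
  | Carry d, true => (Pause d, true)
  | Carry d, false => (Fly (left d), true)
  end.

Definition movex q :=
  match q with Fly d => dirx d | Pause _ => 0 | Carry d => dirx (push d) end.
Definition movey q :=
  match q with Fly d => diry d | Pause _ => 0 | Carry d => diry (push d) end.

Definition tape := Z -> Z -> bool.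

Definition upd (X : tape) x y b : tape :=
  fun x' y' => if (x' =? x) && (y' =? y) then b else X x' y'.

Record hconf := HConf { hst : mode; hx : Z; hy : Z; htp : tape }.

Definition step c :=
  let q := (trans (hst c) (htp c (hx c) (hy c))).1 in
  let s := (trans (hst c) (htp c (hx c) (hy c))).2 in
  HConf q (hx c + movex q) (hy c + movey q) (upd (htp c) (hx c) (hy c) s).

Lemma updE X x y b x' y' :
  upd X x y b x' y' = if (x' =? x) && (y' =? y) then b else X x' y'.
Proof. by []. Qed.

Lemma tape_ext (X Y : tape) : (forall x y, X x y = Y x y) -> X = Y.
Proof. by move=> e; apply: funext => x; apply: funext. Qed.

Ltac zcase :=
  repeat match goal with
  | |- context [?a =? ?b] => destruct (Z.eqb_spec a b); simpl
  | H : context [?a =? ?b] |- _ => destruct (Z.eqb_spec a b); simpl in H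
  end.

Lemma upd_id X x y b : X x y = b -> upd X x y b = X.
Proof. by move=> e; apply: tape_ext => x' y'; rewrite updE; zcase; subst. Qed.

Lemma step_fly0 d x y X : X x y = false ->
  step (HConf (Fly d) x y X) = HConf (Fly d) (x + dirx d) (y + diry d) X.
Proof. by move=> e; rewrite /step /= e /= upd_id. Qed.

Lemma step_fly1 d x y X : X x y = true ->
  step (HConf (Fly d) x y X) = HConf (Pause d) x y (upd X x y false).
Proof. by move=> e; rewrite /step /= e /= !Z.add_0_r. Qed.

Lemma step_pause d x y X :
  step (HConf (Pause d) x y X)
    = HConf (Carry d) (x + dirx (push d)) (y + diry (push d)) X.
Proof. by rewrite /step /=; case e: (X x y); rewrite /= upd_id. Qed.

Lemma step_carry1 d x y X : X x y = true ->
  step (HConf (Carry d) x y X) = HConf (Pause d) x y X.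
Proof. by move=> e; rewrite /step /= e /= !Z.add_0_r upd_id. Qed.

Lemma step_carry0 d x y X : X x y = false ->
  step (HConf (Carry d) x y X)
    = HConf (Fly (left d)) (x + dirx (left d)) (y + diry (left d))
            (upd X x y true).
Proof. by move=> e; rewrite /step /= e. Qed.

(** * Runs confined to a square box *)

Definition inbox L x y := -L <= x <= L /\ -L <= y <= L.

(** Only the positions from which a step is made are confined; the last one may lie outside, which
    lets a run end on a ray just off the box. *)
Inductive run L : nat -> hconf -> hconf -> Prop :=
| run0 c : run L 0 c c
| runS n c c' : inbox L (hx c) (hy c) -> run L n (step c) c' ->
    run L n.+1 c c'.

Lemma run_iter L n c c' : run L n c c' -> iter n step c = c'.
Proof. by elim=> // {}n {}c {}c' _ _; rewrite -iterSr. Qed.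

Lemma run_trans L n m c c' c'' :
  run L n c c' -> run L m c' c'' -> run L (addn n m) c c''.
Proof. by elim=> // {}n {}c {}c' b _ IH h; apply: runS => //; apply: IH. Qed.

Lemma run_mono L L' n c c' : L <= L' -> run L n c c' -> run L' n c c'.
Proof.
move=> le; elim=> [*|{}n {}c {}c' b _ IH]; first exact: run0.
by apply: runS => //; move: b; rewrite /inbox; lia.
Qed.

(** A step reads and writes only the cell under the head. This form serves contents that agree with
    a prepared tape inside the box but carry debris outside it. *)
Lemma run_local L n c c' X : run L n c c' ->
  (forall x y, inbox L x y -> X x y = htp c x y) ->
  exists2 X', run L n (HConf (hst c) (hx c) (hy c) X)
                      (HConf (hst c') (hx c') (hy c') X')
    & forall x y, (inbox L x y -> X' x y = htp c' x y) /\
                  (~ inbox L x y -> X' x y = X x y).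
Proof.
move=> r; elim: r X => [{}c|{}n {}c {}c' b _ IH] X e.
  by exists X; [apply: run0|move=> x y; split=> // /e].
have exy := e _ _ b.
pose X1 := upd X (hx c) (hy c) (trans (hst c) (htp c (hx c) (hy c))).2.
have [|X' r' e'] := IH X1.
  by move=> x y /e; rewrite /X1 /= !updE; zcase; rewrite ?andbF.
exists X'.
  apply: runS => //=; move: r'; rewrite /step /= exy //.
move=> x y; have [e1 e2] := e' x y; split=> // o; rewrite e2 // /X1 updE.
by zcase => //; subst.
Qed.

(** None of the added particles is ever visited, so an environment outside the box may be chosen
    after the run is known. *)
Lemma run_add L n c c' A : run L n c c' ->
  (forall x y, inbox L x y -> A x y = false) ->
  run L n (HConf (hst c) (hx c) (hy c) (fun x y => htp c x y || A x y))
     (HConf (hst c') (hx c') (hy c') (fun x y => htp c' x y || A x y)).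
Proof.
move=> r a0; elim: r => [{}c|{}n {}c {}c' b _ IH]; first exact: run0.
apply: runS => //; move: IH; rewrite /step /= (a0 _ _ b) orbF.
set X1 := (fun _ _ => upd _ _ _ _ _ _ || _); set X2 := upd _ _ _ _.
suff -> : X1 = X2 by [].
apply: tape_ext => x y; rewrite /X1 /X2 !updE; zcase => //.
by subst; rewrite (a0 _ _ b) orbF.
Qed.

Lemma fly_run L (n : nat) d x y X :
  (forall i, 0 <= i < Z.of_nat n ->
     X (x + i * dirx d) (y + i * diry d) = false /\
     inbox L (x + i * dirx d) (y + i * diry d)) ->
  run L n (HConf (Fly d) x y X)
          (HConf (Fly d) (x + Z.of_nat n * dirx d) (y + Z.of_nat n * diry d) X).
Proof.
elim: n x y => [|n IH] x y h.
  by rewrite !Z.mul_0_l !Z.add_0_r; apply: run0.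
have [h1 h2] : X x y = false /\ inbox L x y.
  by move: (h 0); rewrite !Z.mul_0_l !Z.add_0_r; apply; lia.
apply: runS => //; rewrite step_fly0 //.
have -> : x + Z.of_nat n.+1 * dirx d = x + dirx d + Z.of_nat n * dirx d by lia.
have -> : y + Z.of_nat n.+1 * diry d = y + diry d + Z.of_nat n * diry d by lia.
apply: IH => i hi; move: (h (i + 1)).
have -> : x + (i + 1) * dirx d = x + dirx d + i * dirx d by lia.
have -> : y + (i + 1) * diry d = y + diry d + i * diry d by lia.
by apply; lia.
Qed.

Lemma carry_run L (n : nat) d x y X :
  (forall i, 0 <= i <= Z.of_nat n ->
     X (x + i * dirx (push d)) (y + i * diry (push d)) = (i <? Z.of_nat n) /\
     inbox L (x + i * dirx (push d)) (y + i * diry (push d))) ->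
  let x' := x + Z.of_nat n * dirx (push d) in
  let y' := y + Z.of_nat n * diry (push d) in
  run L (n.*2.+1) (HConf (Carry d) x y X)
    (HConf (Fly (left d)) (x' + dirx (left d)) (y' + diry (left d))
       (upd X x' y' true)).
Proof.
elim: n x y => [|n IH] x y h x' y'.
  have [] := h 0 ltac:(lia); rewrite /x' /y' !Z.mul_0_l !Z.add_0_r => h1 h2.
  by apply: runS => //; rewrite step_carry0 //; apply: run0.
have [] := h 0 ltac:(lia); rewrite !Z.mul_0_l !Z.add_0_r => h1 h2.
rewrite doubleS; apply: runS => //; rewrite step_carry1; last by rewrite h1.
apply: runS => //; rewrite step_pause.
move: (IH (x + dirx (push d)) (y + diry (push d))) => /=.
set x1 := x + _ + _; set y1 := y + _ + _.
have -> : x1 = x' by rewrite /x1 /x'; lia.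
have -> : y1 = y' by rewrite /y1 /y'; lia.
apply=> i hi; have := h (i + 1) ltac:(lia).
have -> : x + (i + 1) * dirx (push d) = x + dirx (push d) + i * dirx (push d)
  by lia.
have -> : y + (i + 1) * diry (push d) = y + diry (push d) + i * diry (push d)
  by lia.
move=> [-> ?]; split=> //.
by case: (Z.ltb_spec i (Z.of_nat n)); case: Z.ltb_spec; lia.
Qed.

(** The particle in hand passes over the rest of the run, which is left as it was: in effect the
    first particle jumps to the hole. The first particle costs three steps, each further one two. *)
Lemma hit_run L d x y l X : 1 <= l ->
  (forall i, 0 <= i <= l ->
     X (x + i * dirx (push d)) (y + i * diry (push d)) = (i <? l) /\
     inbox L (x + i * dirx (push d)) (y + i * diry (push d))) ->
  let x' := x + l * dirx (push d) in
  let y' := y + l * diry (push d) in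
  run L (Z.to_nat (2 * l + 1)) (HConf (Fly d) x y X)
    (HConf (Fly (left d)) (x' + dirx (left d)) (y' + diry (left d))
       (upd (upd X x y false) x' y' true)).
Proof.
move=> l1 h x' y'.
have -> : Z.to_nat (2 * l + 1) = (Z.to_nat (l - 1)).*2.+3.
  by rewrite -addnn -plusE; lia.
have [] := h 0 ltac:(lia); rewrite !Z.mul_0_l !Z.add_0_r => h1 h2.
apply: runS => //; rewrite step_fly1; last by rewrite h1; apply/Z.ltb_spec0; lia.
apply: runS => //; rewrite step_pause.
set x1 := x + dirx (push d); set y1 := y + diry (push d).
have := @carry_run L (Z.to_nat (l - 1)) d x1 y1 (upd X x y false).
rewrite /= Z2Nat.id; last by lia.
have -> : x1 + (l - 1) * dirx (push d) = x' by rewrite /x1 /x'; lia.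
have -> : y1 + (l - 1) * diry (push d) = y' by rewrite /y1 /y'; lia.
apply=> i hi; have := h (i + 1) ltac:(lia).
have -> : x + (i + 1) * dirx (push d) = x1 + i * dirx (push d) by rewrite /x1; lia.
have -> : y + (i + 1) * diry (push d) = y1 + i * diry (push d) by rewrite /y1; lia.
move=> [e ?]; split=> //; rewrite updE e.
have -> : (x1 + i * dirx (push d) =? x) && (y1 + i * diry (push d) =? y) = false.
  by rewrite /x1 /y1; case: (d) => /=; zcase => //; lia.
by case: Z.ltb_spec; case: Z.ltb_spec; lia.
Qed.

(** * Finite supports, rays and weighted particle counts *)

Definition supp L (X : tape) := forall x y, X x y = true -> inbox L x y.

Lemma supp0 L X x y : supp L X -> ~ inbox L x y -> X x y = false.
Proof. by move=> s o; case e: (X x y) => //; case: o; apply: s. Qed.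

Lemma supp_mono L L' X : L <= L' -> supp L X -> supp L' X.
Proof. by move=> le s x y /s; rewrite /inbox; lia. Qed.

Lemma supp_upd L X x y b : inbox L x y -> supp L X -> supp L (upd X x y b).
Proof. by move=> i s x' y'; rewrite updE; zcase; try exact: s; subst. Qed.

Definition rayx L d l :=
  match d with East => L + 1 | West => - L - 1 | _ => l end.
Definition rayy L d l :=
  match d with North => L + 1 | South => - L - 1 | _ => l end.

Definition ray L d l X := HConf (Fly d) (rayx L d l) (rayy L d l) X.

Definition zr L := List.map (fun i => Z.of_nat i - L)
                            (List.seq 0 (Z.to_nat (2 * L + 1))).

Lemma in_zr L x : In x (zr L) <-> -L <= x <= L.
Proof.
rewrite /zr in_map_iff; split=> [[i [<- /in_seq]]|h]; first by lia.
by exists (Z.to_nat (x + L)); split; [|apply/in_seq]; lia.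
Qed.

Lemma NoDup_zr L : NoDup (zr L).
Proof.
apply: Injective_map_NoDup; last exact: seq_NoDup.
by move=> i j; lia.
Qed.

Fixpoint zsum (f : Z -> Z) (s : list Z) :=
  match s with nil => 0 | x :: s' => f x + zsum f s' end.

Lemma zsum_ge0 f s : (forall x, In x s -> 0 <= f x) -> 0 <= zsum f s.
Proof.
elim: s => [|x s IH] h /=; first by lia.
by have := h x (or_introl erefl); have := IH (fun y hy => h y (or_intror hy)); lia.
Qed.

Lemma eq_zsum f g s : (forall x, In x s -> f x = g x) -> zsum f s = zsum g s.
Proof.
elim: s => [|x s IH] h //=.
by rewrite h; [rewrite IH // => y hy; apply: h; right|left].
Qed.

Lemma zsum_upd f g x s : NoDup s -> In x s ->
  (forall y, y <> x -> g y = f y) -> zsum g s = zsum f s + g x - f x.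
Proof.
elim: s => [|z s IH] //= /NoDup_cons_iff [nz nd] [zx|i] h; first subst z.
  rewrite (@eq_zsum g f) => [|y hy]; first by lia.
  by apply: h => e; case: nz; rewrite -e.
rewrite (IH nd i h) h; first by lia.
by move=> e; apply: nz; rewrite e.
Qed.

Definition psum (w : Z -> Z) L (X : tape) :=
  zsum (fun x => zsum (fun y => if X x y then w y else 0) (zr L)) (zr L).

Lemma psum_ge0 w L X : (forall y, -L <= y <= L -> 0 <= w y) -> 0 <= psum w L X.
Proof.
move=> h; apply: zsum_ge0 => x _; apply: zsum_ge0 => y /in_zr /h.
by case: (X x y); lia.
Qed.

Lemma psum_upd w L X x y b : inbox L x y ->
  psum w L (upd X x y b)
    = psum w L X + (if b then w y else 0) - (if X x y then w y else 0).
Proof.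
move=> [ix iy]; rewrite /psum.
rewrite (@zsum_upd (fun x => zsum (fun y => if X x y then w y else 0) (zr L)) _ x).
- rewrite (@zsum_upd (fun y => if X x y then w y else 0)
      (fun y' => if upd X x y b x y' then w y' else 0) y).
  + by rewrite updE !Z.eqb_refl /=; lia.
  + exact: NoDup_zr.
  + by apply/in_zr.
  + by move=> y' ne; rewrite updE; zcase.
- exact: NoDup_zr.
- by apply/in_zr.
- by move=> x' ne; apply: eq_zsum => y' _; rewrite updE; zcase.
Qed.

(** * Forwards in time, every head leaves its box *)

Lemma lex_ind (T : Type) (I P : T -> Prop) (f g h : T -> Z) :
  (forall c, I c -> 0 <= f c /\ 0 <= g c /\ 0 <= h c) ->
  (forall c, I c -> (forall c', I c' ->
      f c' < f c \/ f c' = f c /\ (g c' < g c \/ g c' = g c /\ h c' < h c) ->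
      P c') -> P c) ->
  forall c, I c -> P c.
Proof.
move=> pos stp.
suff H : forall (a b k : nat) c, I c -> f c < Z.of_nat a -> g c < Z.of_nat b ->
    h c < Z.of_nat k -> P c.
  move=> c ic; apply: (H (Z.to_nat (f c + 1)) (Z.to_nat (g c + 1))
    (Z.to_nat (h c + 1))) => //; have := pos _ ic; lia.
elim=> [|a IHa]; first by move=> b k c /pos; lia.
elim=> [|b IHb]; first by move=> k c /pos; lia.
elim=> [|k IHk] c ic; first by have := pos _ ic; lia.
move=> fa gb hk; apply: stp => // c' ic' lt.
case: (Z.lt_ge_cases (f c') (Z.of_nat a)) => lf.
  apply: (IHa (Z.to_nat (g c' + 1)) (Z.to_nat (h c' + 1))) => //;
    have := pos _ ic'; lia.
case: (Z.lt_ge_cases (g c') (Z.of_nat b)) => lg.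
  apply: (IHb (Z.to_nat (h c' + 1))) => //; have := pos _ ic'; lia.
by apply: IHk => //; lia.
Qed.

(* Heads only turn left and only North-going heads change the height of a
   particle, by raising it; so (total depth of the particles, number of left
   turns before the next raise, distance left) decreases lexicographically. *)
Definition carried (w : Z -> Z) q (y : Z) :=
  match q with Fly _ => 0 | _ => w y end.

Definition energy (w : Z -> Z) L c :=
  psum w L (htp c) + carried w (hst c) (hy c).

(** A head in state [Carry North] has just raised its particle and so lowered the energy; its rank
    may jump from 0 to 4, above that of the state [Fly West] in which it will leave. *)
Definition rank q :=
  match q with
  | Carry North => 4
  | Fly West | Pause West | Carry West => 3
  | Fly South | Pause South | Carry South => 2
  | Fly East | Pause East | Carry East => 1
  | Fly North | Pause North => 0
  end.

Definition dist L d x y :=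
  match d with East => L - x | North => L - y | West => L + x | South => L + y end.

(** A distance inside the box is at most [2 * L], so [4 * L + 3] exceeds every value of [Pause].
    Each cell crossed while carrying takes two steps, hence the factor 2 and the offsets 1 and 2. *)
Definition fuel L c :=
  match hst c with
  | Fly d => 4 * L + 3 + dist L d (hx c) (hy c)
  | Pause d => 2 * dist L (push d) (hx c) (hy c) + 1
  | Carry d => 2 * dist L (push d) (hx c) (hy c) + 2
  end.

Definition inside L c := inbox L (hx c) (hy c) /\ supp L (htp c).

(** The margin of one cell is for the last particle: it may be pushed over the edge and dropped at
    distance [L + 1], and when the head turns along that side it meets nothing more. *)
Definition exits L c := exists n d l X,
  [/\ run (L + 1) n c (ray (L + 1) d l X), supp (L + 1) X & -L-1 <= l <= L+1].

Lemma exits_step L c : inside L c -> exits L (step c) -> exits L c.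
Proof.
move=> [i _] [n [d [l [X [r s b]]]]]; exists n.+1, d, l, X; split=> //.
by apply: runS => //; move: i; rewrite /inbox; lia.
Qed.

Lemma exits_fly L d x y X : supp (L + 1) X ->
  -L-1 <= match d with East | West => y | _ => x end <= L+1 ->
  -1 <= dist (L + 1) d x y <= 2 * L + 2 ->
  (forall i, 0 <= i <= dist (L + 1) d x y ->
     X (x + i * dirx d) (y + i * diry d) = false) ->
  exits L (HConf (Fly d) x y X).
Proof.
move=> s bl bd z.
exists (Z.to_nat (dist (L + 1) d x y + 1)), d,
  (match d with East | West => y | _ => x end), X; split=> //.
have := @fly_run (L + 1) (Z.to_nat (dist (L + 1) d x y + 1)) d x y X.
rewrite /ray Z2Nat.id; last by lia.
have -> : x + (dist (L + 1) d x y + 1) * dirx d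
    = rayx (L + 1) d match d with East | West => y | _ => x end.
  by case: d bl bd {z} => /=; lia.
have -> : y + (dist (L + 1) d x y + 1) * diry d
    = rayy (L + 1) d match d with East | West => y | _ => x end.
  by case: d bl bd {z} => /=; lia.
apply=> i hi; split; first by apply: z; lia.
by move: hi; rewrite /inbox; case: d bl bd {z} => /=; lia.
Qed.

Ltac outside s := apply: (supp0 s); rewrite /inbox; lia.

Lemma first_exit L c : inside L c -> exits L c.
Proof.
apply: (@lex_ind hconf (inside L) (exits L) (energy (Z.sub L) L)
  (fun c => rank (hst c)) (fuel L)) => {c} [c|c ic IH].
  move=> [[ix iy] s]; split.
    rewrite /energy; have := @psum_ge0 (Z.sub L) L (htp c) ltac:(by move=> y; lia).
    by rewrite /carried; case: (hst c); lia.
  by split; rewrite /rank /fuel; case: (hst c) => -[] /=; lia.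
case: c ic IH => q x y X [/= [ix iy] s] IH.
have s1 : supp (L + 1) X by apply: supp_mono s; lia.
have step_in c' : c' = step (HConf q x y X) -> inside L c' ->
    energy (Z.sub L) L c' < energy (Z.sub L) L (HConf q x y X) \/
    energy (Z.sub L) L c' = energy (Z.sub L) L (HConf q x y X) /\
    (rank (hst c') < rank q \/
     rank (hst c') = rank q /\ fuel L c' < fuel L (HConf q x y X)) ->
    exits L (HConf q x y X).
  by move=> -> i' lt; apply: exits_step => //; apply: IH.
case: q IH step_in => d IH step_in.
- case e: (X x y).
    apply: (step_in _ (esym (step_fly1 d e))).
      by split=> //=; apply: supp_upd.
    by rewrite /energy /= psum_upd // e /fuel /=; case: (d) => /=; lia.
  have [i'|o] : inbox L (x + dirx d) (y + diry d) \/
       ~ inbox L (x + dirx d) (y + diry d).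
    by rewrite /inbox; lia.
    apply: (step_in _ (esym (step_fly0 d e))) => //.
    by rewrite /energy /fuel /=; case: (d) => /=; lia.
  apply: exits_fly => //; try by case: (d) => /=; lia.
  move=> i hi; case: (Z.eq_dec i 0) => [->|ne]; first by rewrite !Z.add_0_r.
  by move: o hi; rewrite /inbox; case: (d) => /= o hi; outside s.
- have [i'|o] : inbox L (x + dirx (push d)) (y + diry (push d)) \/
       ~ inbox L (x + dirx (push d)) (y + diry (push d)).
    by rewrite /inbox; lia.
    apply: (step_in _ (esym (step_pause d x y X))) => //.
    by rewrite /energy /fuel /=; case: (d) => /=; lia.
  (* The particle is carried over the edge, where the cell is empty: it is dropped at once and the
     final flight begins. *)
  apply: exits_step => //; rewrite step_pause.
  have e : X (x + dirx (push d)) (y + diry (push d)) = false by apply: supp0 o.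
  set x' := x + _ in o e *; set y' := y + _ in o e *.
  have i1 : inbox (L + 1) x' y'.
    by rewrite /inbox /x' /y'; case: (d) => /=; lia.
  have s2 : supp (L + 1) (upd X x' y' true) by apply: supp_upd.
  suff K : exits L (step (HConf (Carry d) x' y' X)).
    case: K => n [d' [l [X' [r s' b]]]].
    by exists n.+1, d', l, X'; split=> //; apply: runS.
  rewrite (step_carry0 d e); move: o i1 e s2; rewrite /inbox /x' /y' => {x' y'}.
  case: (d) => /= o i1 e s2.
  + apply: exits_fly => //=; try lia; move=> i hi.
    by rewrite updE; zcase => //; try lia; outside s.
  + apply: exits_fly => //=; try lia; move=> i hi.
    by rewrite updE; zcase => //; try lia; outside s.
  + apply: exits_fly => //=; try lia; move=> i hi.
    by rewrite updE; zcase => //; try lia; outside s.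
  + apply: exits_fly => //=; try lia; move=> i hi.
- case e: (X x y).
    apply: (step_in _ (esym (step_carry1 d e))) => //.
    by rewrite /energy /fuel /=; case: (d) => /=; lia.
  have [i'|o] : inbox L (x + dirx (left d)) (y + diry (left d)) \/
       ~ inbox L (x + dirx (left d)) (y + diry (left d)).
    by rewrite /inbox; lia.
    apply: (step_in _ (esym (step_carry0 d e))) => //.
      by split=> //=; apply: supp_upd.
    by rewrite /energy /= psum_upd // e /fuel /=; case: (d) => /=; lia.
  apply: exits_step => //; rewrite step_carry0 //.
  apply: exits_fly; first by apply: supp_upd => //; rewrite /inbox; lia.
  + by case: (d) => /=; lia.
  + by case: (d) => /=; lia.
  + move=> i hi; rewrite updE; move: o hi; rewrite /inbox.
    by case: (d) => /= o hi; zcase => //; try lia; outside s.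
Qed.

(** * Backwards in time, every head comes from outside *)

Definition inx L d l :=
  match d with East => - L | West => L | _ => l end.
Definition iny L d l :=
  match d with North => - L | South => L | _ => l end.

Definition inray L d l X := HConf (Fly d) (inx L d l) (iny L d l) X.

Definition right d := left (left (left d)).

Definition backdist L d x y :=
  match d with East => L + x | North => L + y | West => L - x | South => L - y end.

Definition backfuel L c :=
  match hst c with
  | Fly d => backdist L d (hx c) (hy c)
  | Pause d => 2 * L + 2 + 2 * backdist L (push d) (hx c) (hy c)
  | Carry d => 2 * L + 1 + 2 * backdist L (push d) (hx c) (hy c)
  end.

Definition enters L c := exists n d l X,
  [/\ run (L + 1) n (inray (L + 1) d l X) c, supp (L + 1) X & -L-1 <= l <= L+1].

Lemma enters_step L c c' : step c' = c -> inbox (L + 1) (hx c') (hy c') ->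
  enters L c' -> enters L c.
Proof.
move=> <- i [n [d [l [X [r s b]]]]]; exists (addn n 1), d, l, X; split=> //.
by apply: (run_trans r); apply: runS; last exact: run0.
Qed.

Lemma enters_fly L d x y X : supp (L + 1) X ->
  -L-1 <= match d with East | West => y | _ => x end <= L+1 ->
  0 <= backdist (L + 1) d x y <= 2 * L + 3 ->
  (forall i, 0 < i <= backdist (L + 1) d x y ->
     X (x - i * dirx d) (y - i * diry d) = false) ->
  enters L (HConf (Fly d) x y X).
Proof.
move=> s bl bd z; set k := backdist (L + 1) d x y.
exists (Z.to_nat k), d, (match d with East | West => y | _ => x end), X.
split=> //.
have := @fly_run (L + 1) (Z.to_nat k) d (x - k * dirx d) (y - k * diry d) X.
rewrite /inray Z2Nat.id /k; last by lia.
have -> : x - backdist (L + 1) d x y * dirx d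
    = inx (L + 1) d match d with East | West => y | _ => x end.
  by case: d bl bd {z k} => /=; lia.
have -> : y - backdist (L + 1) d x y * diry d
    = iny (L + 1) d match d with East | West => y | _ => x end.
  by case: d bl bd {z k} => /=; lia.
have -> : inx (L + 1) d match d with East | West => y | _ => x end
      + backdist (L + 1) d x y * dirx d = x.
  by case: d bl bd {z k} => /=; lia.
have -> : iny (L + 1) d match d with East | West => y | _ => x end
      + backdist (L + 1) d x y * diry d = y.
  by case: d bl bd {z k} => /=; lia.
apply=> i hi; split.
  have <- := z (backdist (L + 1) d x y - i) ltac:(lia).
  by congr X; case: d bl bd hi {z k} => /=; lia.
by move: hi; rewrite /inbox; case: d bl bd {z k} => /=; lia.
Qed.

(** The measures of [first_exit] are reversed: backwards, particles are only lowered, so their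
    weight becomes [L + y], and heads only turn right. The unique predecessor of a state is read off
    from the tape. *)
Lemma first_entry L c : inside L c -> enters L c.
Proof.
apply: (@lex_ind hconf (inside L) (enters L) (energy (Z.add L) L)
  (fun c => 4 - rank (hst c)) (backfuel L)) => {c} [c|c ic IH].
  move=> [[ix iy] s]; split.
    rewrite /energy; have := @psum_ge0 (Z.add L) L (htp c) ltac:(by move=> y; lia).
    by rewrite /carried; case: (hst c); lia.
  by split; rewrite /rank /backfuel; case: (hst c) => -[] /=; lia.
case: c ic IH => q x y X [/= [ix iy] s] IH.
have s1 : supp (L + 1) X by apply: supp_mono s; lia.
have back c' : step c' = HConf q x y X -> inside L c' ->
    energy (Z.add L) L c' < energy (Z.add L) L (HConf q x y X) \/
    energy (Z.add L) L c' = energy (Z.add L) L (HConf q x y X) /\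
    (4 - rank (hst c') < 4 - rank q \/
     4 - rank (hst c') = 4 - rank q /\
     backfuel L c' < backfuel L (HConf q x y X)) ->
    enters L (HConf q x y X).
  move=> e i' lt; apply: (enters_step e); last exact: IH.
  by case: i'; rewrite /inbox; lia.
case: q IH back => d IH back.
- set x' := x - dirx d; set y' := y - diry d.
  have ex : x' + dirx d = x by rewrite /x'; lia.
  have ey : y' + diry d = y by rewrite /y'; lia.
  have [i'|o] : inbox L x' y' \/ ~ inbox L x' y' by rewrite /inbox; lia.
    (* A particle right behind a flying head was dropped there by a head that then turned left. *)
    case e : (X x' y').
      have el : left (right d) = d by case: (d).
      have e' : upd X x' y' false x' y' = false by rewrite updE !Z.eqb_refl.
      have es := step_carry0 (right d) e'; rewrite el ex ey in es.
      have eX : upd (upd X x' y' false) x' y' true = X.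
        by apply: tape_ext => a b; rewrite !updE; zcase => //; congruence.
      rewrite eX in es; apply: (back _ es).
        by split=> //=; apply: supp_upd.
      by rewrite /energy /= psum_upd // e /backfuel /=; case: (d) => /=; lia.
    have es := step_fly0 d e; rewrite ex ey in es; apply: (back _ es) => //.
    by rewrite /energy /backfuel /= /x' /y'; case: (d) => /=; lia.
  apply: enters_fly => //; try by case: (d) => /=; lia.
  move=> i hi; apply: (supp0 s); move: o hi; rewrite /inbox /x' /y'.
  by case: (d) => /=; lia.
(* The cell under a pausing head tells whether the head was already carrying or has just picked up a
   particle. *)
- case e: (X x y).
    by apply: (back _ (step_carry1 d e)) => //;
      rewrite /energy /backfuel /=; case: (d) => /=; lia.
  have e' : upd X x y true x y = true by rewrite updE !Z.eqb_refl.
  have es := step_fly1 d e'.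
  have eX : upd (upd X x y true) x y false = X.
    by apply: tape_ext => a b; rewrite !updE; zcase => //; congruence.
  rewrite eX in es; apply: (back _ es); first by split=> //=; apply: supp_upd.
  by rewrite /energy /= psum_upd // e /backfuel /=; case: (d) => /=; lia.
- set x' := x - dirx (push d); set y' := y - diry (push d).
  have ex : x' + dirx (push d) = x by rewrite /x'; lia.
  have ey : y' + diry (push d) = y by rewrite /y'; lia.
  have es := step_pause d x' y' X; rewrite ex ey in es.
  have [i'|o] : inbox L x' y' \/ ~ inbox L x' y' by rewrite /inbox; lia.
    apply: (back _ es) => //.
    by rewrite /energy /backfuel /= /x' /y'; case: (d) => /=; lia.
  have i1 : inbox (L + 1) x' y'.
    by rewrite /inbox /x' /y'; case: (d) => /=; lia.
  apply: (enters_step es) => //.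
  (* Outside the box the cell under the pausing head is empty, so the particle was picked up there
     by a head flying in. *)
  have e0 : X x' y' = false by apply: supp0 o.
  have e' : upd X x' y' true x' y' = true by rewrite updE !Z.eqb_refl.
  have es' := step_fly1 d e'.
  have eX : upd (upd X x' y' true) x' y' false = X.
    by apply: tape_ext => a b; rewrite !updE; zcase => //; congruence.
  rewrite eX in es'; apply: (enters_step es') => //.
  apply: enters_fly; first by apply: supp_upd.
  + by move: i1; rewrite /inbox; case: (d); lia.
  + by move: i1; rewrite /inbox; case: (d) => /=; lia.
  + move=> i hi; rewrite updE; move: o hi i1; rewrite /inbox /x' /y'.
    by case: (d) => /= o hi i1; zcase => //; try lia; outside s.
Qed.

Lemma fly_to L d x y x' y' X k : 0 <= k ->
  x' = x + k * dirx d -> y' = y + k * diry d ->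
  (forall i, 0 <= i < k ->
     X (x + i * dirx d) (y + i * diry d) = false /\
     inbox L (x + i * dirx d) (y + i * diry d)) ->
  run L (Z.to_nat k) (HConf (Fly d) x y X) (HConf (Fly d) x' y' X).
Proof.
move=> k0 -> -> h; have := @fly_run L (Z.to_nat k) d x y X.
by rewrite Z2Nat.id //; apply.
Qed.

Lemma hit_to L d x y x' y' l X : 1 <= l ->
  x' = x + l * dirx (push d) -> y' = y + l * diry (push d) ->
  (forall i, 0 <= i <= l ->
     X (x + i * dirx (push d)) (y + i * diry (push d)) = (i <? l) /\
     inbox L (x + i * dirx (push d)) (y + i * diry (push d))) ->
  run L (Z.to_nat (2 * l + 1)) (HConf (Fly d) x y X)
    (HConf (Fly (left d)) (x' + dirx (left d)) (y' + diry (left d))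
       (upd (upd X x y false) x' y' true)).
Proof. by move=> l1 -> -> h; apply: hit_run. Qed.

Lemma hit1_to L d x y x' y' X :
  x' = x + dirx (push d) -> y' = y + diry (push d) ->
  X x y = true -> X x' y' = false -> inbox L x y -> inbox L x' y' ->
  run L 3 (HConf (Fly d) x y X)
    (HConf (Fly (left d)) (x' + dirx (left d)) (y' + diry (left d))
       (upd (upd X x y false) x' y' true)).
Proof.
move=> ex ey h0 h1 i0 i1; apply: (@hit_to L d x y x' y' 1); try lia.
move=> i hi; have [->|->] : i = 0 \/ i = 1 by lia.
  by rewrite !Z.mul_0_l !Z.add_0_r.
by rewrite !Z.mul_1_l -ex -ey.
Qed.

(** * Steering a head into a prescribed entry *)

Section Target.
Variables (L0 : Z) (goal : hconf).

(** The tapes are compared only inside [L0], so particles used for steering may remain farther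
    out. *)
Definition hits_goal c :=
  [/\ hst c = hst goal, hx c = hx goal, hy c = hy goal &
      forall x y, inbox L0 x y -> htp c x y = htp goal x y].

Definition target L d l X :=
  [/\ L0 <= L, -L <= l <= L, supp L X &
      exists n c, run L n (inray L d l X) c /\ hits_goal c].

Lemma target_pre L L' d d' l l' X X' Y n : L <= L' -> -L' <= l' <= L' ->
  supp L' X' -> run L' n (inray L' d' l' X') (inray L d l Y) ->
  (forall x y, inbox L x y -> Y x y = X x y) ->
  target L d l X -> target L' d' l' X'.
Proof.
move=> le b s r e [le0 _ _ [m [c [r' [g1 g2 g3 g4]]]]].
have [Y' r'' e''] := run_local r' e.
split=> //; first by lia.
exists (addn n m), (HConf (hst c) (hx c) (hy c) Y'); split.
  by apply: (run_trans r); apply: run_mono r''.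
split=> //= x y i; rewrite -g4 //; apply: (e'' x y).1.
by move: i; rewrite /inbox; lia.
Qed.

(* A particle put at [(x, y)] turns a head coming along a free line left into the
   line on which it has to enter the box. *)
Lemma target_turn L L' d l l' X x y : target L d l X ->
  L + 3 < L' -> -L' < l' < L' ->
  match d with
  | West => [/\ L + 1 < l', x = l' & y = l - 1]
  | South => [/\ L + 1 < l', x = l + 1 & y = l']
  | East => [/\ l' < - L - 2, x = l' & y = l]
  | North => [/\ l' < - L - 1, x = l - 1 & y = l']
  end -> exists X', target L' (right d) l' X'.
Proof.
move=> T lt b h; have [_ bl s _] := T.
have ho : inbox L' x y /\ ~ inbox L x y.
  by rewrite /inbox; case: (d) h => -[]; lia.
have [hi no] := ho.
have s' : supp L' X by apply: supp_mono s; lia.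
exists (upd X x y true).
set d' := right d.
have el : left d' = d by rewrite /d'; case: (d).
have lk : 0 <= match d with
  West => y + L' | South => L' - x | East => L' - y | North => L' + x end.
  by case: (d) h => -[]; lia.
set k := match d with West => _ | _ => _ end in lk.
set x1 := x + dirx (push d'); set y1 := y + diry (push d').
have i1 : inbox L' x1 y1 /\ ~ inbox L x1 y1.
  by rewrite /inbox /x1 /y1 /d'; case: (d) h => -[] /=; lia.
have r1 : run L' (Z.to_nat k) (inray L' d' l' (upd X x y true))
    (HConf (Fly d') x y (upd X x y true)).
  apply: fly_to; first by [].
  - by rewrite /k /d'; case: (d) h => -[] /=; lia.
  - by rewrite /k /d'; case: (d) h => -[] /=; lia.
  move=> i hk; split.
    rewrite updE; move: hk; rewrite /k /d'.
    by case: (d) h => -[] /= h1 h2 h3 hk; zcase => //; try lia; outside s.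
  by move: hk; rewrite /inbox /k /d'; case: (d) h => -[] /=; lia.
have r2 := @hit1_to L' d' x y x1 y1 (upd X x y true) erefl erefl.
rewrite el in r2.
have {}r2 := r2 ltac:(by rewrite updE !Z.eqb_refl).
have e1 : upd X x y true x1 y1 = false.
  have [_ /(supp0 s) e1] := i1; rewrite updE e1 /x1 /y1 /d'.
  by case: (d) => /=; zcase => //; lia.
have {}r2 := r2 e1 hi i1.1.
set Y := upd _ x1 y1 true in r2.
have eY a c : Y a c = ((a =? x1) && (c =? y1)) || X a c.
  have ex := supp0 s no.
  by rewrite /Y !updE; zcase => //; congruence.
have lk' : 0 <= match d with
  West => x1 - 1 - L | South => y1 - 1 - L | East => - L - x1 - 1
  | North => - L - y1 - 1 end.
  by rewrite /x1 /y1 /d'; case: (d) h => -[] /=; lia.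
set k' := match d with West => _ | _ => _ end in lk'.
have r3 : run L' (Z.to_nat k') (HConf (Fly d) (x1 + dirx d) (y1 + diry d) Y)
    (inray L d l Y).
  apply: fly_to; first by [].
  - by rewrite /k' /x1 /y1 /d'; case: (d) h => -[] /=; lia.
  - by rewrite /k' /x1 /y1 /d'; case: (d) h => -[] /=; lia.
  move=> i hk; split.
    rewrite eY; move: hk; rewrite /k' /x1 /y1 /d'.
    by case: (d) h => -[] /= h1 h2 h3 hk; zcase => //; try lia; outside s.
  move: hk; rewrite /inbox /k' /x1 /y1 /d'.
  by case: (d) h => -[] /= h1 h2 h3; lia.
apply: (target_pre _ _ _ (run_trans (run_trans r1 r2) r3) _ T); try lia.
- exact: supp_upd.
- move=> a c iac; rewrite eY; zcase => //.
  by case: (i1.2); congruence.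
Qed.

(** Traced back through right turns, every entry becomes a West-going one; the turn before that is
    made from a North-going column which can be chosen freely, hence beyond [bound]. An entry that
    is North-going already makes the full round to get such a column. *)
Lemma target_north bound : inside L0 goal ->
  exists L z X, bound < z /\ target L North z X.
Proof.
move=> ing; have [n [d [l [X [r s b]]]]] := first_entry ing.
have T : target (L0 + 1) d l X by split=> //; try lia; exists n, goal; split.
have toN L l1 X1 : target L West l1 X1 ->
    exists L z X, bound < z /\ target L North z X.
  move=> T1; have [le b1 _ _] := T1.
  set z := Z.max (bound + 1) (L + 2).
  have [|||X2 T2] := @target_turn L (z + 2) West l1 z X1 z (l1 - 1) T1.
  - by rewrite /z; lia.
  - by rewrite /z; lia.
  - by split=> //; rewrite /z; lia.
  by exists (z + 2), z, X2; split=> //; rewrite /z; lia.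
have toW L l1 X1 : target L South l1 X1 ->
    exists L z X, bound < z /\ target L North z X.
  move=> T1; have [le b1 _ _] := T1.
  have [|||X2 T2] := @target_turn L (L + 4) South l1 (L + 2) X1 (l1 + 1) (L + 2) T1.
  - by lia.
  - by lia.
  - by split=> //; lia.
  exact: (toN _ _ _ T2).
have toS L l1 X1 : target L East l1 X1 ->
    exists L z X, bound < z /\ target L North z X.
  move=> T1; have [le b1 _ _] := T1.
  have [|||X2 T2] := @target_turn L (L + 4) East l1 (-L - 3) X1 (-L - 3) l1 T1.
  - by lia.
  - by lia.
  - by split=> //; lia.
  exact: (toW _ _ _ T2).
case: d T {r} => T; [exact: toS T| |exact: toN T|exact: toW T].
have [le b1 _ _] := T.
have [|||X2 T2] := @target_turn _ (L0 + 5) North l (- L0 - 3) X (l - 1) (- L0 - 3) T.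
- by lia.
- by lia.
- by split=> //; lia.
exact: (toS _ _ _ T2).
Qed.

End Target.

(** * Families of universes in a common environment *)

Definition tor (X Y : tape) : tape := fun x y => X x y || Y x y.
Definition pt a b : tape := fun x y => (x =? a) && (y =? b).
Definition vanish L (A : tape) := forall x y, inbox L x y -> A x y = false.

Ltac zsup := repeat match goal with s : supp ?L ?X |- context [?X ?a ?b] =>
  rewrite (@supp0 L X a b s); last by rewrite /inbox; lia end.

Definition turnx L a d l :=
  match d with East => L + a | West => - L - a | _ => l end.
Definition turny L a d l :=
  match d with North => L + a | South => - L - a | _ => l end.
(** A head leaves on the line where it drops the particle. This is one farther out than where the
    particle was, except for South-going heads, which push East and stay in its row. *)
Definition turnl L a d :=
  match d with East | North => L + a + 1 | West => - L - a - 1 | South => - L - a end.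

Lemma turn_run L a d l X : 1 <= a -> -L <= l <= L -> supp L X ->
  let x := turnx L a d l in let y := turny L a d l in
  exists n, run (L + a + 1) n (ray L d l (tor X (pt x y)))
    (ray (L + a + 1) (left d) (turnl L a d)
       (tor X (pt (x + dirx (push d)) (y + diry (push d))))).
Proof.
move=> a1 bl s x y.
set x1 := x + dirx (push d); set y1 := y + diry (push d).
have ixy : inbox (L + a + 1) x y /\ ~ inbox L x y.
  by rewrite /inbox /x /y; case: (d) => /=; lia.
have ixy1 : inbox (L + a + 1) x1 y1 /\ ~ inbox L x1 y1.
  by rewrite /inbox /x1 /y1 /x /y; case: (d) => /=; lia.
have e0 : tor X (pt x y) x y = true by rewrite /tor /pt !Z.eqb_refl orbT.
have e1 : tor X (pt x y) x1 y1 = false.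
  rewrite /tor (supp0 s ixy1.2) /pt /x1 /y1.
  by case: (d) => /=; zcase => //; lia.
have r1 : run (L + a + 1) (Z.to_nat (a - 1)) (ray L d l (tor X (pt x y)))
    (HConf (Fly d) x y (tor X (pt x y))).
  apply: fly_to; first by lia.
  - by rewrite /x; case: (d) => /=; lia.
  - by rewrite /y; case: (d) => /=; lia.
  move=> i hi; split; last by rewrite /inbox /rayx /rayy; case: (d) => /=; lia.
  rewrite /tor /pt /x /y; case: (d) => /=; zcase => //; try lia; by zsup.
have r2 := @hit1_to (L + a + 1) d x y x1 y1 _ erefl erefl e0 e1 ixy.1 ixy1.1.
set Y := upd _ x1 y1 true in r2.
have eY : Y = tor X (pt x1 y1).
  apply: tape_ext => u v; rewrite /Y !updE /tor /pt.
  have := supp0 s ixy.2; have := supp0 s ixy1.2.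
  by zcase; rewrite ?orbT ?orbF //; congruence.
rewrite eY in r2.
have lk' : 0 <= match d with
  East => L + a + 2 - (y1 + 1) | North => x1 - 1 + L + a + 2
  | West => y1 - 1 + L + a + 2 | South => L + a + 2 - (x1 + 1) end.
  by rewrite /x1 /y1 /x /y; case: (d) => /=; lia.
set k' := match d with West => _ | _ => _ end in lk'.
have r3 : run (L + a + 1) (Z.to_nat k')
    (HConf (Fly (left d)) (x1 + dirx (left d)) (y1 + diry (left d))
       (tor X (pt x1 y1)))
    (ray (L + a + 1) (left d) (turnl L a d) (tor X (pt x1 y1))).
  apply: fly_to; first by [].
  - by rewrite /k' /x1 /y1 /x /y; case: (d) => /=; lia.
  - by rewrite /k' /x1 /y1 /x /y; case: (d) => /=; lia.
  move=> i; rewrite /k' /tor /pt /x1 /y1 /x /y /inbox => hi.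
  by split; move: hi; case: (d) => /= hi; try lia; zcase => //; try lia; zsup.
by eexists; apply: (run_trans (run_trans r1 r2) r3).
Qed.

Record ustate := UState { ud : dir; ul : Z; ut : tape }.

Section Families.
Variables (I : Type) (good : I -> hconf -> Prop).

(* Universe [j] sits on its ray after [T j] steps; a common environment [A]
   outside the box must bring all universes to their goals at a common time. *)
Definition wins L (F : I -> ustate) := forall T : I -> nat, exists A t,
  vanish L A /\ forall j, exists n, t = addn (T j) n /\
    good j (iter n step (ray L (ud (F j)) (ul (F j)) (tor (ut (F j)) A))).

(** [A0] is joined to the environment obtained for the later family. That environment is empty
    inside [L'], so it does not disturb the runs in between, whose lengths are charged to [T]. *)
Lemma wins_step L L' A0 F F' : L <= L' -> vanish L A0 ->
  (forall j, exists n,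
     run L' n (ray L (ud (F j)) (ul (F j)) (tor (ut (F j)) A0))
              (ray L' (ud (F' j)) (ul (F' j)) (ut (F' j)))) ->
  wins L' F' -> wins L F.
Proof.
move=> le v /choice [n r] w T.
have [A [t [vA h]]] := w (fun j => addn (T j) (n j)).
exists (tor A0 A), t; split.
  by move=> x y i; rewrite /tor v // vA //; move: i; rewrite /inbox; lia.
move=> j; have [m [et g]] := h j; exists (addn (n j) m); split.
  by rewrite addnA.
rewrite addnC iterD.
have {}r := run_iter (run_add (r j) vA).
rewrite /= in r.
suff -> : iter (n j) step (ray L (ud (F j)) (ul (F j)) (tor (ut (F j)) (tor A0 A)))
    = ray L' (ud (F' j)) (ul (F' j)) (tor (ut (F' j)) A) by [].
apply: etrans r; congr (iter _ _ (HConf _ _ _ _)).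
by apply: tape_ext => x y; rewrite /tor orbA.
Qed.

Variable prot : Z -> Prop.

Definition ext L (X X' : tape) :=
  (forall x y, inbox L x y -> X' x y = X x y) /\
  (forall x y, prot x -> y < -L -> X' x y = false).

(** The bystanders of a group fly South, the side on which the work on the group leaves few
    particles; these avoid the columns of the bystanders and, for the sake of later entries, the
    protected ones. *)
Definition others (G : I -> Prop) L0 (F0 : I -> ustate) L F :=
  L0 <= L /\ forall j, ~ G j ->
  [/\ ud (F j) = South, ul (F j) = ul (F0 j), -L0 <= ul (F0 j) <= L0,
      ext L0 (ut (F0 j)) (ut (F j)) & supp L (ut (F j))].

Lemma wins_group G L0 F0 L F L' A0 f : 
  (forall x, prot x -> -L0 <= x <= L0) -> others G L0 F0 L F ->
  L <= L' -> vanish L A0 -> supp L' A0 ->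
  (forall x y, prot x \/ (exists2 j, ~ G j & x = ul (F0 j)) -> y < - L0 ->
     A0 x y = false) ->
  (forall j, G j -> exists n,
    run L' n (ray L (ud (F j)) (ul (F j)) (tor (ut (F j)) A0))
      (ray L' (ud (f j)) (ul (f j)) (ut (f j)))) ->
  (forall F', others G L0 F0 L' F' -> (forall j, G j -> F' j = f j) ->
     wins L' F') ->
  wins L F.
Proof.
move=> pr [le0 oth] le v s0 low r w.
pose F' j := if pselect (G j) then f j else
  UState (ud (F j)) (ul (F j)) (tor (ut (F j)) A0).
apply: (@wins_step L L' A0 F F') => //; last first.
  apply: w => [|j Gj]; last by rewrite /F'; case: pselect.
  split=> [|j nG]; first by lia.
  have [h1 h2 h3 [h4 h5] h6] := oth j nG; rewrite /F'; case: pselect => // _ /=.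
  split=> //.
  - split=> x y h; last by move=> hy; rewrite /tor h5 // low //; left.
    by rewrite /tor h4 // v ?orbF //; move: h; rewrite /inbox; lia.
  - by move=> x y /orP[/h6|/s0] //; rewrite /inbox; lia.
move=> j; rewrite /F'; case: pselect => [Gj|nG] /=; first exact: r.
have [h1 h2 h3 h4 h6] := oth j nG; exists (Z.to_nat (L' - L)); rewrite h1 h2.
apply: fly_to => /=; try lia; move=> i hi; rewrite /tor /inbox.
split; last by lia.
by rewrite low; [zsup|right; exists j => //; lia|lia].
Qed.

Lemma wins_turn G L0 F0 L F a d l X :
  (forall x, prot x -> -L0 <= x <= L0) -> others G L0 F0 L F -> 1 <= a ->
  -L <= l <= L ->
  (d = South -> ~ prot l /\ forall j, ~ G j -> ul (F0 j) <> l) ->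
  (forall j, G j -> F j = UState d l (X j) /\ supp L (X j)) ->
  (forall F', others G L0 F0 (L + a + 1) F' ->
     (forall j, G j -> F' j = UState (left d) (turnl L a d)
        (tor (X j) (pt (turnx L a d l + dirx (push d))
                       (turny L a d l + diry (push d))))) ->
     wins (L + a + 1) F') ->
  wins L F.
Proof.
move=> pr oth a1 bl ds h w; have le0 := oth.1.
apply: (wins_group (L' := L + a + 1) (A0 := pt (turnx L a d l) (turny L a d l))
  pr oth _ _ _ _ _ w).
- by lia.
- by move=> x y; rewrite /inbox /pt; case: (d) => /=; zcase => //; lia.
- by move=> x y; rewrite /inbox /pt; case: (d) => /=; zcase => //; lia.
- move=> x y lo hy; have bx : -L0 <= x <= L0.
    by case: lo => [/pr//|[j nG ->]]; case: (oth.2 j nG).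
  (* Only a South-going group needs its turning particle below the old box, on its own column; for
     the other directions it lies beside or above. *)
  rewrite /pt; case: (d) ds => /= ds; zcase => //; try lia.
  by have [np no] := ds erefl; case: lo => [|[j /no]]; rewrite e //; lia.
- by move=> j Gj; have [-> s] := h j Gj; apply: turn_run.
Qed.

End Families.

Lemma zleast (P : Z -> bool) h y0 : P y0 = true -> h < y0 ->
  exists y, [/\ h < y <= y0, P y = true & forall y', h < y' < y -> P y' = false].
Proof.
move=> p lt; have [k ek] : exists k : nat, y0 = h + 1 + Z.of_nat k.
  by exists (Z.to_nat (y0 - h - 1)); lia.
elim: k h lt ek => [|k IH] h lt ek.
  by exists y0; split=> //; [lia|move=> y'; lia].
case e: (P (h + 1)).
  by exists (h + 1); split=> //; [lia|move=> y'; lia].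
have [||y [b py n]] := IH (h + 1); try lia.
exists y; split=> //; first by lia.
move=> y' hy; case: (Z.eq_dec y' (h + 1)) => [->//|ne]; apply: n; lia.
Qed.

(** * The course of a single visit *)

Definition hmove (X : tape) x y x' y' := upd (upd X x y false) x' y' true.

(* Effect on a row of one visit: the head comes down column [p], pushes the
   port [(p, r)] one cell East, flies East, moves the first particle [(v, r)] to
   the first hole [(u, r)] and leaves North along column [u]. *)
Definition probe (X : tape) p r v u :=
  hmove (hmove X p r (p + 1) r) v r u r.

(** [U] contains the columns with debris above the strip. The way down must avoid them
    ([legal_fresh]), whereas column [u] may be one of them: debris there reflects the head West. *)
Record legal H B (U : Z -> Prop) (C : tape) p r v u : Prop := Legal {
  legal_r : -H <= r <= H;
  legal_p : -B <= p;
  legal_pv : p + 1 < v;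
  legal_vu : v < u;
  legal_u : u <= B;
  legal_fresh : ~ U p;
  legal_colp : forall y, r < y <= H -> C p y = false;
  legal_colu : forall y, r < y <= H -> C u y = false;
  legal_port : C p r = true;
  legal_gap : forall x, p < x < v -> C x r = false;
  legal_run : forall x, v <= x < u -> C x r = true;
  legal_hole : C u r = false
}.

Ltac tcase :=
  zcase; subst; rewrite ?orbF ?orbT //; try lia; try (by zsup).

Section ProbeRun.
Variables (L H B a l0 p r v u : Z) (U : Z -> Prop) (X : tape).
Hypotheses (sX : supp L X) (HL : 0 <= H <= L) (a1 : 1 <= a) (l0B : B < l0 <= L).
Hypothesis lg : legal H B U X p r v u.
Hypothesis colp : forall y, H < y -> X p y = false.

Let R := L + a + 1.
Let T0 := tor X (tor (pt l0 (L + a)) (pt (p + 1) R)).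
Let T1 := tor X (tor (pt l0 R) (pt (p + 1) R)).
Let T2 := tor X (tor (pt l0 R) (pt p R)).

Lemma probe_bounds : -L <= p /\ p + 2 <= v < u /\ u < l0 /\ -H <= r <= H.
Proof. by case: lg; lia. Qed.

(** The particle at [(l0, L + a)] sends the head West along row [R]; the one at [(p + 1, R)], pushed
    to column [p], sends it South onto the port. *)
Lemma probe_enter : exists n,
  run R n (ray L North l0 T0) (HConf (Fly North) u (r + 1) (probe T2 p r v u)).
Proof.
have [b1 [b2 [b3 b4]]] := probe_bounds.
have r1 : run R (Z.to_nat (a - 1)) (ray L North l0 T0)
    (HConf (Fly North) l0 (L + a) T0).
  apply: fly_to => /=; try lia; move=> i hi; rewrite /T0 /tor /pt /inbox /R.
  by split; [zsup; zcase => //; lia|lia].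
have r2 : run R 3 (HConf (Fly North) l0 (L + a) T0)
    (HConf (Fly West) (l0 - 1) R T1).
  have := @hit1_to R North l0 (L + a) l0 R T0; rewrite /= /R !Z.add_0_r => h.
  have -> : T1 = hmove T0 l0 (L + a) l0 (L + a + 1).
    apply: tape_ext => x y; rewrite /hmove !updE /T0 /T1 /R /tor /pt.
    by tcase.
  rewrite -Z.add_opp_r; apply: h; rewrite /inbox ?/T0 ?/R ?/tor ?/pt; try lia;
    zsup; zcase => //; lia.
have r3 : run R (Z.to_nat (l0 - 1 - (p + 1))) (HConf (Fly West) (l0 - 1) R T1)
    (HConf (Fly West) (p + 1) R T1).
  apply: fly_to => /=; try lia; move=> i hi; rewrite /T1 /tor /pt /inbox /R.
  by split; [zsup; zcase => //; lia|lia].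
have r4 : run R 3 (HConf (Fly West) (p + 1) R T1)
    (HConf (Fly South) p (R - 1) T2).
  have := @hit1_to R West (p + 1) R p R T1.
  rewrite /= /R !Z.add_0_r => h.
  have -> : T2 = hmove T1 (p + 1) (L + a + 1) p (L + a + 1).
    apply: tape_ext => x y; rewrite /hmove !updE /T2 /T1 /R /tor /pt.
    by tcase.
  rewrite -Z.add_opp_r; apply: h; rewrite /inbox ?/T1 ?/R ?/tor ?/pt; try lia;
    zsup; zcase => //; lia.
have e2 x y : y <= H -> T2 x y = X x y.
  by move=> le; rewrite /T2 /tor /pt /R; zcase; rewrite ?orbF //; lia.
have r5 : run R (Z.to_nat (R - 1 - r)) (HConf (Fly South) p (R - 1) T2)
    (HConf (Fly South) p r T2).
  apply: fly_to => /=; rewrite /R; try lia; move=> i hi; split; last first.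
    by rewrite /inbox; lia.
  rewrite Z.mul_0_r Z.add_0_r; set y := _ + i * _.
  have [le|gt] : y <= H \/ H < y by lia.
    by rewrite e2 //; apply: (legal_colp lg); rewrite /y in le *; lia.
  rewrite /T2 /tor /pt colp //.
  by rewrite /R; zcase => //; rewrite /y in e; lia.
have r6 : run R 3 (HConf (Fly South) p r T2)
    (HConf (Fly East) (p + 2) r (hmove T2 p r (p + 1) r)).
  have := @hit1_to R South p r (p + 1) r T2; rewrite /= !Z.add_0_r => h.
  have -> : p + 2 = p + 1 + 1 by lia.
  apply: h; rewrite ?e2 /inbox /R; try lia; first exact: (legal_port lg).
  by apply: (legal_gap lg); lia.
set T3 := hmove T2 _ _ _ _ in r6.
have e3 x : p + 1 < x -> T3 x r = X x r.
  by move=> lt; rewrite -e2; [rewrite /T3 /hmove !updE; zcase => //; lia|lia].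
have r7 : run R (Z.to_nat (v - (p + 2))) (HConf (Fly East) (p + 2) r T3)
    (HConf (Fly East) v r T3).
  apply: fly_to => /=; try lia; move=> i hi; split.
    rewrite Z.mul_0_r Z.add_0_r e3; last by lia.
    by apply: (legal_gap lg); lia.
  by rewrite /inbox /R; lia.
have r8 : run R (Z.to_nat (2 * (u - v) + 1)) (HConf (Fly East) v r T3)
    (HConf (Fly North) u (r + 1) (probe T2 p r v u)).
  have := @hit_to R East v r u r (u - v) T3; rewrite /= !Z.add_0_r; apply.
  - by lia.
  - by lia.
  - by lia.
  move=> i hi; rewrite Z.mul_0_r Z.add_0_r; split; last by rewrite /inbox /R; lia.
  rewrite e3; last by lia.
  have [lt|->] : i < u - v \/ i = u - v by lia.
    rewrite (legal_run lg); last by lia.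
    by case: Z.ltb_spec => //; lia.
  have -> : v + (u - v) * 1 = u by lia.
  by rewrite (legal_hole lg); case: Z.ltb_spec => //; lia.
exists (addn (addn (addn (addn (addn (addn (addn (Z.to_nat (a - 1)) 3)
  (Z.to_nat (l0 - 1 - (p + 1)))) 3) (Z.to_nat (R - 1 - r))) 3)
  (Z.to_nat (v - (p + 2)))) (Z.to_nat (2 * (u - v) + 1))).
do 6! (apply: run_trans; last by eassumption).
exact: run_trans r1 r2.
Qed.

Let X1 := tor (tor (probe X p r v u) (pt p R)) (pt l0 R).

Lemma probe_tape : probe T2 p r v u = X1.
Proof.
have [b1 [b2 [b3 b4]]] := probe_bounds.
apply: tape_ext => x y; rewrite /X1 /probe /hmove /tor !updE /T2 /tor /pt /R.
by zcase; rewrite ?orbF ?orbT //; lia.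
Qed.

Lemma probe_colu y : r < y <= H -> X1 u y = false.
Proof.
have [b1 [b2 [b3 b4]]] := probe_bounds.
move=> hy; rewrite /X1 /probe /hmove /tor !updE /pt /R (legal_colu lg) //.
by zcase => //; lia.
Qed.

Lemma probe_run_north : (forall y, H < y -> X u y = false) ->
  exists n, run R n (ray L North l0 T0) (ray R North u X1).
Proof.
have [b1 [b2 [b3 b4]]] := probe_bounds.
move=> cu; have [n rn] := probe_enter; rewrite probe_tape in rn.
eexists; apply: (run_trans rn).
apply: (@fly_to _ _ _ _ _ _ _ (R + 1 - (r + 1))) => /=; rewrite /R; try lia.
move=> i hi; split; last by rewrite /inbox; lia.
rewrite Z.mul_0_r Z.add_0_r; set y := _ + i * _.
have [le|gt] : y <= H \/ H < y by lia.
  by apply: probe_colu; rewrite /y in le *; lia.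
rewrite /X1 /probe /hmove /tor !updE cu // /pt.
by zcase => //; lia.
Qed.

(** The lowest debris in the exit column is raised by one cell, and the head leaves through the row
    it now occupies, which has to be empty. *)
Lemma probe_run_west y : H < y -> X u y = true ->
  (forall y', H < y' < y -> X u y' = false) ->
  (forall x, X x (y + 1) = false) ->
  exists n, run R n (ray L North l0 T0) (ray R West (y + 1)
    (tor (tor (probe (hmove X u y u (y + 1)) p r v u) (pt p R)) (pt l0 R))).
Proof.
have [b1 [b2 [b3 b4]]] := probe_bounds.
move=> hy xu low row; have [n rn] := probe_enter; rewrite probe_tape in rn.
have [_ yL] : inbox L u y by apply: sX.
have e1 x y' : H < y' < R -> X1 x y' = X x y'.
  move=> h; rewrite /X1 /probe /hmove /tor !updE /pt.
  by zcase; rewrite ?orbF //; lia.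
have r1 : run R (Z.to_nat (y - (r + 1))) (HConf (Fly North) u (r + 1) X1)
    (HConf (Fly North) u y X1).
  apply: fly_to => /=; try lia; move=> i hi; rewrite Z.mul_0_r Z.add_0_r.
  split; last by rewrite /inbox /R; lia.
  set y' := _ + i * _; have [le|gt] : y' <= H \/ H < y' by lia.
    by apply: probe_colu; rewrite /y' in le *; lia.
  by rewrite e1 ?low //; rewrite /y' in gt *; rewrite /R; lia.
have r2 : run R 3 (HConf (Fly North) u y X1)
    (HConf (Fly West) (u - 1) (y + 1) (hmove X1 u y u (y + 1))).
  have := @hit1_to R North u y u (y + 1) X1; rewrite /= !Z.add_0_r => h.
  rewrite -Z.add_opp_r; apply: h; rewrite /inbox ?e1 ?row //; rewrite /R; lia.
set Y := hmove X1 _ _ _ _ in r2.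
have -> : tor (tor (probe (hmove X u y u (y + 1)) p r v u) (pt p R)) (pt l0 R) = Y.
  apply: tape_ext => x y'; rewrite /Y /X1 /probe /hmove /tor !updE /pt /R.
  by zcase; rewrite ?orbF ?orbT //; lia.
exists (addn (addn (addn n (Z.to_nat (y - (r + 1)))) 3) (Z.to_nat (u - 1 + R + 1))).
apply: run_trans (run_trans (run_trans rn r1) r2) _.
apply: fly_to => /=; rewrite /R; try lia; move=> i hi.
split; last by rewrite /inbox; lia.
rewrite Z.mul_0_r Z.add_0_r /Y /hmove !updE e1; last by rewrite /R; lia.
by rewrite row; zcase => //; lia.
Qed.

End ProbeRun.

(** * Debris in the tapes of a group *)

Section Group.
Variables (I : Type) (good : I -> hconf -> Prop) (prot : Z -> Prop).
Variables (G : I -> Prop) (L0 : Z) (F0 : I -> ustate) (H B : Z).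
Hypothesis protP : forall x, prot x -> -L0 <= x <= L0.

Let wins := wins good.
Let others := others prot G L0 F0.

(* The members of [G] share the ray and everything off the strip [|y| <= H];
   [O] is that common part, [C] their contents of the strip, and [U] bounds the
   columns of the window [|x| <= B] that contain junk above the strip.  The [n]
   rows above junk are empty, so that [n] more heads leaving along its column
   are reflected West. *)
Record gstate L n (X C : I -> tape) (O : tape) (U : Z -> Prop) : Prop := GState {
  gs_H : 0 <= H <= L;
  gs_B : B <= L;
  gs_supp : forall j, G j -> supp L (X j);
  gs_strip : forall j, G j -> forall x y, -H <= y <= H -> X j x y = C j x y;
  gs_off : forall j, G j -> forall x y, ~ (-H <= y <= H) -> X j x y = O x y;
  gs_osupp : supp L O;
  gs_junk : forall x y, H < y -> -B <= x <= B -> O x y = true -> U x;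
  gs_rows : forall x y x' y', H < y -> -B <= x <= B -> O x y = true ->
    y < y' <= y + n -> O x' y' = false;
  gs_uniq : forall x x' y, H < y -> -B <= x <= B -> -B <= x' <= B ->
    O x y = true -> O x' y = true -> x' = x;
  gs_low : forall x y, prot x -> y < -H -> O x y = false
}.

Definition open_row (O : tape) n y' := forall x y, H < y -> -B <= x <= B ->
  O x y = true -> ~ (y < y' <= y + n).

(** Above the strip a particle must respect the rows kept empty. In the window it must in addition
    be higher than everything else, so that no two pieces of debris there share a row. *)
Lemma gs_add L L' n X C O U gx gy : gstate L n X C O U -> L <= L' ->
  inbox L' gx gy ->
  gy < -H /\ ~ prot gx \/
  H < gy /\ open_row O n gy /\ (~ (-B <= gx <= B) \/ U gx /\ L < gy) ->
  gstate L' n (fun j => tor (X j) (pt gx gy)) C (tor O (pt gx gy)) U.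
Proof.
move=> gs le ig h; have hH := gs_H gs.
have tp O' x y : tor O' (pt gx gy) x y = O' x y || ((x =? gx) && (y =? gy)) by [].
split.
- by have := gs_H gs; lia.
- by have := gs_B gs; lia.
- move=> j Gj x y; rewrite tp => /orP[/(gs_supp gs Gj)|].
    by rewrite /inbox; lia.
  by zcase => //; subst.
- move=> j Gj x y hy; rewrite tp (gs_strip gs) //.
  by zcase; rewrite ?orbF //; lia.
- by move=> j Gj x y hy; rewrite !tp (gs_off gs Gj).
- move=> x y; rewrite tp => /orP[/(gs_osupp gs)|].
    by rewrite /inbox; lia.
  by zcase => //; subst.
- move=> x y hy hx; rewrite tp => /orP[|]; first exact: (gs_junk gs hy hx).
  by zcase => //; subst; case: h => [|[_ [_ [|[]]]]] //; lia.
- move=> x y x' y' hy hx; rewrite !tp => /orP[o|e] hy'.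
    rewrite (gs_rows gs _ hy hx o hy') /=; zcase => //; subst.
    case: h => [|[_ [/(_ _ _ hy hx o)]]] //; lia.
  zcase; rewrite ?orbF //; try lia; subst;
    (case: h => [|[_ [_ [|[_ gL]]]]]; try lia);
    by apply: (supp0 (gs_osupp gs)); rewrite /inbox; lia.
- move=> x x' y hy hx hx'; rewrite !tp.
  have far : gy <= L \/ O x gy = false /\ O x' gy = false.
    have [|gt] : gy <= L \/ L < gy by lia.
      by left.
    by right; split; apply: (supp0 (gs_osupp gs)); rewrite /inbox; lia.
  zcase; rewrite ?orbF ?orbT; subst => //; try exact: (gs_uniq gs hy hx hx');
    (case: h => [|[_ [_ [|[_ gL]]]]]; try lia);
    by case: far => [|[e1 e2]]; try lia; rewrite ?e1 ?e2.
- move=> x y px hy; rewrite tp (gs_low gs) //=; zcase => //; subst.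
  by case: h => [[]//|]; lia.
Qed.

(** The raised particle uses up the first of the empty rows above it, so one reflection less remains
    possible. *)
Lemma gs_move L n X C O U u y : gstate L (n + 1) X C O U -> 0 <= n ->
  H < y -> -B <= u <= B -> O u y = true ->
  gstate (L + 1) n (fun j => hmove (X j) u y u (y + 1)) C
    (hmove O u y u (y + 1)) U.
Proof.
move=> gs n0 hy hu o; have [ox oy] := gs_osupp gs o; have hH := gs_H gs.
have hm O' x y' : hmove O' u y u (y + 1) x y' =
  if (x =? u) && (y' =? y + 1) then true else
  if (x =? u) && (y' =? y) then false else O' x y' by [].
split.
- by have := gs_H gs; lia.
- by have := gs_B gs; lia.
- move=> j Gj x y'; rewrite hm; zcase => //;
    try (by move=> _; rewrite /inbox; lia);
    by move=> /(gs_supp gs Gj); rewrite /inbox; lia.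
- move=> j Gj x y' hy'; rewrite hm (gs_strip gs) //.
  by zcase => //; lia.
- by move=> j Gj x y' hy'; rewrite !hm (gs_off gs Gj).
- move=> x y'; rewrite hm; zcase => //;
    try (by move=> _; rewrite /inbox; lia);
    by move=> /(gs_osupp gs); rewrite /inbox; lia.
- move=> x y' hy' hx; rewrite hm; zcase => // h; subst;
    by [exact: (gs_junk gs hy hu o)|exact: (gs_junk gs hy' hx h)].
- move=> x1 y1 x2 y2 hy1 hx1; rewrite !hm => o1 hy2.
  have e y' : y < y' <= y + 1 + n -> O x2 y' = false.
    by move=> hy'; apply: (gs_rows gs _ hy hu o); lia.
  have e' : O x1 y1 = true -> O x2 y2 = false.
    by move=> o'; apply: (gs_rows gs _ hy1 hx1 o'); lia.
  move: o1; zcase => // o1; subst; try lia; try (by rewrite e //; lia);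
    try exact: e';
    (have [lt|eq] : y1 < y \/ y1 = y by lia);
    try (by have := gs_rows gs u hy1 hx1 o1 (y' := y) ltac:(lia); rewrite o);
    try lia.
  by rewrite eq in o1; have := gs_uniq gs hy hx1 hu o1 o; lia.
- move=> x x' y' hy' hx hx'; rewrite !hm.
  have e x1 : O x1 (y + 1) = false by apply: (gs_rows gs _ hy hu o); lia.
  zcase => //; subst; rewrite ?e //; try exact: (gs_uniq gs hy' hx hx').
- move=> x y' px hy'; rewrite hm; zcase => //; try exact: (gs_low gs); lia.
Qed.

End Group.

(** * Repeated visits to a group *)

Section Probes.
Variables (I : Type) (good : I -> hconf -> Prop) (prot : Z -> Prop).
Variables (G : I -> Prop) (L0 : Z) (F0 : I -> ustate) (H B : Z).
Hypothesis protP : forall x, prot x -> -L0 <= x <= L0.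
Hypothesis L0_ge0 : 0 <= L0.

Let wins := wins good.
Let others := others prot G L0 F0.
Let gstate := gstate prot G H B.

Lemma gs_le L n n' X C O U : gstate L n X C O U -> n' <= n ->
  gstate L n' X C O U.
Proof.
case=> h1 h2 h3 h4 h5 h6 h7 h8 h9 h10 le; split=> // x y x' y' e1 e2 e3 e4.
by apply: (h8 x y x' y' e1 e2 e3); lia.
Qed.

Lemma gs_probe L n X C O (U U' : Z -> Prop) p r v u : gstate L n X C O U ->
  (forall x, U x -> U' x) ->
  (forall j, G j -> legal H B U (C j) p r (v j) (u j)) ->
  gstate L n (fun j => probe (X j) p r (v j) (u j))
    (fun j => probe (C j) p r (v j) (u j)) O U'.
Proof.
move=> gs sub lg; have [hH hB] := (gs_H gs, gs_B gs); split=> //.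
- move=> j Gj; have [] := lg j Gj => *.
  by do 4 (apply: supp_upd; first by rewrite /inbox; lia); exact: (gs_supp gs).
- by move=> j Gj x y hy; rewrite /probe /hmove !updE (gs_strip gs).
- move=> j Gj x y hy; have lr := legal_r (lg j Gj).
  rewrite /probe /hmove !updE -(gs_off gs Gj) //.
  by zcase => //; lia.
- exact: (gs_osupp gs).
- by move=> x y h1 h2 h3; apply: sub; apply: (gs_junk gs h1 h2 h3).
- by move=> x y x' y'; apply: (gs_rows gs).
- by move=> x x' y; apply: (gs_uniq gs).
- exact: (gs_low gs).
Qed.

(** [n] is the number of visits still planned. Debris has to be spaced for all of them in advance,
    since each may raise a particle by one row. The ray lies East of the window, from where the next
    visit starts. *)
Definition ready n (C : I -> tape) (U : Z -> Prop) := forall L F X O l0,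
  others L F -> (forall j, G j -> F j = UState North l0 (X j)) ->
  B < l0 <= L -> gstate L n X C O U -> wins L F.

(** Three left turns lead around the box to a North-going column East of the window. The first
    turning particle stays in row [l], hence the condition on that row. *)
Lemma wins_cycle_west L n F X C O U l : ready n C U -> others L F -> 0 <= n ->
  (forall j, G j -> F j = UState West l (X j)) -> H < l <= L ->
  open_row H B O n l -> gstate L n X C O U -> wins L F.
Proof.
move=> rd oth n0 eF bl op gs; have le0 := oth.1.
have [hH hB] := (gs_H gs, gs_B gs).
have low l' : l' < -L0 -> ~ prot l' /\ forall j, ~ G j -> ul (F0 j) <> l'.
  by move=> lt; split=> [/protP|j nG]; [|case: (oth.2 j nG)]; lia.
have e j : G j -> F j = UState West l (X j) /\ supp L (X j).
  by move=> Gj; split; [exact: eF|exact: (gs_supp gs)].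
apply: (wins_turn (a := 1) protP oth _ _ _ e) => //; try lia.
move=> F1 oth1 eF1 /=.
set L1 := L + 1 + 1 in oth1 eF1 *.
have gs1 := gs_add (L' := L1) (gx := - L - 1 - 1) (gy := l) gs
  ltac:(rewrite /L1; lia) ltac:(rewrite /inbox /L1; lia) ltac:(right; split;
  [lia|split => //; left; lia]).
rewrite /= Z.add_0_r in eF1.
have {}e j : G j -> F1 j = UState South (- L - 1 - 1)
      (tor (X j) (pt (-L - 1 - 1) l)) /\ supp L1 (tor (X j) (pt (-L - 1 - 1) l)).
  by move=> Gj; rewrite eF1 //; split=> //; exact: (gs_supp gs1).
apply: (wins_turn (a := 1) protP oth1 _ _ _ e) => //;
  try (move=> _; apply: low); try lia.
move=> F2 oth2 eF2 /=.
set L2 := L1 + 1 + 1 in oth2 eF2 *.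
have gs2 := gs_add (L' := L2) (gx := - L - 1 - 1 + 1) (gy := - L1 - 1) gs1
  ltac:(rewrite /L2; lia) ltac:(rewrite /inbox /L2 /L1; lia) ltac:(left; split; [lia|move/protP; lia]).
rewrite /= Z.add_0_r in eF2.
have {}e j : G j -> F2 j = UState East (- L1 - 1)
      (tor (tor (X j) (pt (-L - 1 - 1) l)) (pt (- L - 1 - 1 + 1) (- L1 - 1))) /\
      supp L2 (tor (tor (X j) (pt (-L - 1 - 1) l))
                   (pt (- L - 1 - 1 + 1) (- L1 - 1))).
  by move=> Gj; rewrite eF2 //; split=> //; exact: (gs_supp gs2).
apply: (wins_turn (a := 1) protP oth2 _ _ _ e) => //; try lia.
move=> F3 oth3 eF3 /=.
set L3 := L2 + 1 + 1 in oth3 eF3 *.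
have gs3 := gs_add (L' := L3) (gx := L2 + 1 + 1) (gy := - L1 - 1) gs2
  ltac:(rewrite /L3; lia) ltac:(rewrite /inbox /L3 /L2 /L1; lia)
  ltac:(left; split; [lia|move/protP; lia]).
rewrite /= Z.add_0_r in eF3.
apply: (rd _ _ _ _ _ oth3 eF3 _ gs3); rewrite /L3 /L2 /L1; lia.
Qed.

Lemma wins_cycle_north L n F X C O U l : ready n C U -> others L F -> 0 <= n ->
  (forall j, G j -> F j = UState North l (X j)) -> -L <= l <= L -> U l ->
  gstate L n X C O U -> wins L F.
Proof.
move=> rd oth n0 eF bl Ul gs; have le0 := oth.1.
have [hH hB] := (gs_H gs, gs_B gs).
have e j : G j -> F j = UState North l (X j) /\ supp L (X j).
  by move=> Gj; split; [exact: eF|exact: (gs_supp gs)].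
(* The particle ends in row [L + n + 2], beyond the [n] rows that must stay empty above any
   debris. *)
apply: (wins_turn (a := n + 1) protP oth _ _ _ e) => //; try lia.
move=> F1 oth1 eF1 /=.
set L1 := L + (n + 1) + 1 in oth1 eF1 *.
have op : open_row H B O n L1.
  by move=> x y hy hx /(gs_osupp gs) []; rewrite /L1; lia.
have gs1 := gs_add (L' := L1) (gx := l) (gy := L1) gs
  ltac:(rewrite /L1; lia) ltac:(rewrite /inbox /L1; lia) ltac:(right; split;
  [rewrite /L1; lia|split => //; right; split=> //; rewrite /L1; lia]).
rewrite /= Z.add_0_r in eF1.
apply: (wins_cycle_west rd oth1 n0 eF1 _ _ gs1); first by rewrite /L1; lia.
move=> x y hy hx /orP[/(op _ _ hy hx)//|].
by rewrite /pt; zcase => // _; lia.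
Qed.

Definition distinct_strips (C : I -> tape) := forall i j, G i -> G j -> i <> j ->
  ~ (forall x y, -H <= y <= H -> C i x y = C j x y).

(** The continuation once members of a group are on different rays; none of them flies South, which
    tells them from the bystanders. It is supplied by induction in [wins_spread] and holds vacuously
    in [wins_write]. *)
Definition splitwin := forall L F, others L F ->
  (forall j, G j ->
     [/\ ud (F j) <> South, -L <= ul (F j) <= L & supp L (ut (F j))]) ->
  (forall i j, G i -> G j -> i <> j ->
     ud (F i) = ud (F j) -> ul (F i) = ul (F j) -> ut (F i) <> ut (F j)) ->
  (exists i j, [/\ G i, G j & ~ (ud (F i) = ud (F j) /\ ul (F i) = ul (F j))]) ->
  wins L F.

(** If [v < v'], then [v'] lies inside the run of the first content and stays occupied, but is
    vacated in the second. So the first particles agree, and both moves can be undone. *)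
Lemma probe_inj (U U' : Z -> Prop) X X' p r v v' u :
  legal H B U X p r v u -> legal H B U' X' p r v' u ->
  (forall x y, -H <= y <= H ->
     probe X p r v u x y = probe X' p r v' u x y) ->
  forall x y, -H <= y <= H -> X x y = X' x y.
Proof.
move=> lg lg' e.
have vv : v = v'.
  have lem Y Y' w w' : legal H B U Y p r w u -> legal H B U' Y' p r w' u ->
      probe Y p r w u w' r = probe Y' p r w' u w' r -> ~ w < w'.
    move=> g g' + lt; rewrite /probe /hmove !updE (legal_run g); last first.
      by have := legal_vu g'; lia.
    have := legal_pv g; have := legal_vu g'.
    by zcase => //; lia.
  have lem' Y Y' w w' : legal H B U Y p r w u -> legal H B U' Y' p r w' u ->
      probe Y p r w u w r = probe Y' p r w' u w r -> ~ w' < w.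
    move=> g g' + lt; rewrite /probe /hmove !updE (legal_run g'); last first.
      by have := legal_vu g; lia.
    have := legal_pv g'; have := legal_vu g.
    by zcase => //; lia.
  have := lem _ _ _ _ lg lg' (e _ _ (legal_r lg)).
  by have := lem' _ _ _ _ lg lg' (e _ _ (legal_r lg)); lia.
subst v' => x y hy; move: (e x y hy).
have [gp gv] := (legal_pv lg, legal_vu lg).
have x1 : X (p + 1) r = X' (p + 1) r.
  by rewrite (legal_gap lg) ?(legal_gap lg') //; lia.
have x2 : X v r = X' v r.
  by rewrite (legal_run lg) ?(legal_run lg') //; lia.
rewrite /probe /hmove !updE; zcase => //; subst=> // _;
  by rewrite ?(legal_port lg) ?(legal_port lg') ?(legal_hole lg) ?(legal_hole lg').
Qed.

Lemma legal_ext (U : Z -> Prop) X X' p r v u : 0 <= H ->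
  (forall x y, -H <= y <= H -> X' x y = X x y) ->
  legal H B U X p r v u -> legal H B U X' p r v u.
Proof.
move=> h0 e [] *; split=> // *; rewrite e; try lia; auto.
Qed.

(** Members that leave on one ray left through one column: a North-going ray is that column, and a
    West-going one determines it because debris of different columns never shares a row. Their
    contents then still differ by [probe_inj]. So either the group splits, or it returns as a whole
    for the next visit. *)
Lemma ready_probe j0 n C U p r v u : G j0 -> 0 <= n -> distinct_strips C ->
  (forall j, G j -> legal H B U (C j) p r (v j) (u j)) -> splitwin ->
  ((forall j, G j -> u j = u j0) ->
     ready n (fun j => probe (C j) p r (v j) (u j))
       (fun x => [\/ U x, x = p | exists2 j, G j & x = u j])) ->
  ready (n + 1) C U.
Proof.
move=> G0 n0 dC lg sw rd L F X O l0 oth eF bl gs.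
have [hH hB] := (gs_H gs, gs_B gs); have le0 := oth.1.
have lgX j : G j -> legal H B U (X j) p r (v j) (u j).
  by move=> Gj; apply: legal_ext (lg j Gj); [lia|exact: (gs_strip gs)].
(* Row [R] lies more than [n] rows above all earlier debris. *)
pose a := n + 2; pose R := L + a + 1.
pose A0 := tor (pt l0 (L + a)) (pt (p + 1) R).
pose U' x := [\/ U x, x = p | exists2 j, G j & x = u j].
pose after X j := tor (tor (probe X p r (v j) (u j)) (pt p R)) (pt l0 R).
pose spec j s := G j ->
  ((forall y, H < y -> O (u j) y = false) /\
     s = UState North (u j) (after (X j) j)) \/
  (exists y, [/\ H < y, O (u j) y = true,
     (forall y', H < y' < y -> O (u j) y' = false) &
     s = UState West (y + 1) (after (hmove (X j) (u j) y (u j) (y + 1)) j)]).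
have bu j : G j -> -B <= u j <= B /\ -B <= p /\ p + 2 <= v j < u j.
  by move=> Gj; have [] := lg j Gj; lia.
have colp j : G j -> forall y, H < y -> X j p y = false.
  move=> Gj y hy; rewrite (gs_off gs) //; last by lia.
  have [bu1 [bu2 bu3]] := bu j Gj.
  case e: (O p y) => //; case: (legal_fresh (lg j Gj)).
  by apply: (gs_junk gs hy _ e); lia.
have /choice [f fP] : forall j, exists s, spec j s /\ (G j -> exists m,
    run R m (ray L North l0 (tor (X j) A0)) (ray R (ud s) (ul s) (ut s))).
  move=> j; have [Gj|nG] := pselect (G j); last by exists (F j); split=> /nG.
  have [[y1 hy1 o1]|no] := pselect (exists2 y, H < y & O (u j) y = true).
    have [y [hy oy low]] := zleast o1 hy1.
    have hy' : H < y by lia.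
    exists (UState West (y + 1) (after (hmove (X j) (u j) y (u j) (y + 1)) j)).
    split; first by move=> _; right; exists y.
    move=> _ /=; apply: (@probe_run_west L H B a l0 p r (v j) (u j) U) => //.
    - exact: (gs_supp gs).
    - by rewrite /a; lia.
    - exact: lgX.
    - exact: colp.
    - by rewrite (gs_off gs) //; lia.
    - by move=> y' h; rewrite (gs_off gs) ?low //; lia.
    - move=> x; rewrite (gs_off gs) //; last by lia.
      by apply: (gs_rows gs x hy' (bu j Gj).1 oy); lia.
  exists (UState North (u j) (after (X j) j)).
  have z y : H < y -> O (u j) y = false.
    by move=> hy; case e: (O (u j) y) => //; case: no; exists y.
  split; first by move=> _; left.
  move=> _ /=; apply: (@probe_run_north L H B a l0 p r (v j) (u j) U) => //.
  - exact: (gs_supp gs).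
  - by rewrite /a; lia.
  - exact: lgX.
  - exact: colp.
  - by move=> y hy; rewrite (gs_off gs) ?z //; lia.
apply: (wins_group (A0 := A0) (f := f) protP oth (L' := R)).
- by rewrite /R /a; lia.
- move=> x y; rewrite /inbox /A0 /tor /pt /R /a.
  by zcase => //; lia.
- have [bu1 [bu2 bu3]] := bu j0 G0.
  move=> x y; rewrite /inbox /A0 /tor /pt /R /a.
  by zcase => // _; lia.
- move=> x y _ hy; rewrite /A0 /tor /pt /R /a.
  by zcase => //; lia.
- by move=> j Gj; rewrite eF //=; apply: (fP j).2.
move=> F' oth' eF'.
have gsN := gs_probe (gs_le gs (n' := n) ltac:(lia))
  (fun x => @Or31 (U x) (x = p) (exists2 j, G j & x = u j)) lg.
have gsA O' X' L' : gstate L' n X' (fun j => probe (C j) p r (v j) (u j)) O' U' ->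
    L <= L' <= L + 1 -> gstate R n (fun j => tor (tor (X' j) (pt p R)) (pt l0 R))
      (fun j => probe (C j) p r (v j) (u j)) (tor (tor O' (pt p R)) (pt l0 R)) U'.
  move=> g hL; have [bu1 [bu2 bu3]] := bu j0 G0.
  have op : open_row H B O' n R.
    by move=> x y hy hx /(gs_osupp g) []; rewrite /R /a; lia.
  have g1 := gs_add (L' := R) (gx := p) (gy := R) g
    ltac:(rewrite /R /a; lia) ltac:(rewrite /inbox /R /a; lia)
    ltac:(right; split; [rewrite /R /a; lia|split=> //; right; split;
      [by apply: Or32|rewrite /R /a; lia]]).
  apply: (gs_add g1); [lia|rewrite /inbox /R /a; lia|right; split].
    by rewrite /R /a; lia.
  split; last by left; lia.
  move=> x y hy hx /orP[/(op _ _ hy hx)//|].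
  by rewrite /pt; zcase => // _; lia.
have gsW y : H < y -> O (u j0) y = true -> (forall j, G j -> u j = u j0) ->
    gstate R n (fun j => after (hmove (X j) (u j) y (u j) (y + 1)) j)
      (fun j => probe (C j) p r (v j) (u j))
      (tor (tor (hmove O (u j0) y (u j0) (y + 1)) (pt p R)) (pt l0 R)) U'.
  move=> hy oy eu.
  have g1 := gs_move gs n0 hy (bu j0 G0).1 oy.
  have g2 := gs_probe g1
    (fun x => @Or31 (U x) (x = p) (exists2 j, G j & x = u j)) lg.
  have g3 := gsA _ _ _ g2 ltac:(lia).
  case: g3 => h1 h2 h3 h4 h5 h6 h7 h8 h9 h10; split=> // j Gj; rewrite /after eu //.
  - by have := h3 j Gj; rewrite eu.
  - by have := h4 j Gj; rewrite eu.
  - by have := h5 j Gj; rewrite eu.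
have gsN' := gsA _ _ _ gsN ltac:(lia).
have rN := legal_r (lg j0 G0).
have strip j : G j -> forall x y, -H <= y <= H ->
    ut (f j) x y = probe (C j) p r (v j) (u j) x y.
  move=> Gj x y hy; have e := gs_strip gsN Gj x hy.
  have ra X' : after X' j x y = probe X' p r (v j) (u j) x y.
    rewrite /after /tor /pt /R /a.
    by zcase; rewrite ?orbF //; lia.
  case: ((fP j).1 Gj) => [[_ ->]|[y1 [hy1 o1 _ ->]]] /=; first by rewrite ra.
  rewrite ra -e /probe /hmove !updE; zcase => //; lia.
have same_u i j : G i -> G j -> ud (f i) = ud (f j) -> ul (f i) = ul (f j) ->
    u i = u j.
  move=> Gi Gj; case: ((fP i).1 Gi) => [[_ ->]|[y [hy o _ ->]]];
  case: ((fP j).1 Gj) => [[_ ->]|[y' [hy' o' _ ->]]] //= _ ey.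
  have {}ey : y' = y by lia.
  subst y'; exact: (gs_uniq gs hy (bu j Gj).1 (bu i Gi).1 o' o).
(* Unless all members leave through one column, the group has split and [sw] takes over. *)
have [eu|ne] := pselect (forall j, G j -> u j = u j0); last first.
  apply: sw oth' _ _ _.
  - move=> j Gj; rewrite eF' //; have [bu1 [bu2 bu3]] := bu j Gj.
    case: ((fP j).1 Gj) => [[_ ->]|[y [hy o low ->]]] /=.
      split=> //; first by rewrite /R /a; lia.
      exact: (gs_supp gsN' Gj).
    have [_ yL] := gs_osupp gs o.
    split=> //; first by rewrite /R /a; lia.
    move=> x y'; rewrite /after /tor /pt => /orP[/orP[]|].
    + have [] := legal_r (lg j Gj) => r1 r2.
      rewrite /probe /hmove !updE; zcase => //; rewrite /inbox /R /a; try lia;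
        by move=> /(gs_supp gs Gj); rewrite /inbox; lia.
    + by zcase => // _; rewrite /inbox /R /a; lia.
    + by zcase => // _; rewrite /inbox /R /a; lia.
  - move=> i j Gi Gj nij; rewrite !eF' // => e1 e2 e3.
    have eu := same_u i j Gi Gj e1 e2.
    apply: (dC i j Gi Gj nij); have lj := lg j Gj; rewrite -eu in lj.
    apply: (probe_inj (lg i Gi) lj) => x y hy.
    have si := strip i Gi x y hy; have sj := strip j Gj x y hy.
    by rewrite -eu in sj; rewrite -si -sj e3.
  - have [j Gj nj] : exists2 j, G j & u j <> u j0.
      apply: contrapT => no; apply: ne => j Gj; apply: contrapT => nj.
      by apply: no; exists j.
    exists j, j0; split=> //; rewrite !eF' // => -[e1 e2].
    by apply: nj; apply: same_u.
have [bu1 [bu2 bu3]] := bu j0 G0.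
(* Whether the common exit column holds debris is the same for all members, since [O] is common. *)
case: ((fP j0).1 G0) => [[z0 _]|[y [hy o low _]]].
  apply: (wins_cycle_north (rd eu) oth' n0 _ _ _ gsN' (l := u j0)).
  - move=> j Gj; rewrite eF' //.
    case: ((fP j).1 Gj) => [[_ ->]|[y [hy o low _]]]; first by rewrite {1}(eu j Gj).
    by move: o; rewrite eu // z0.
  - by rewrite /R /a; lia.
  - by apply: Or33; exists j0.
have [_ yL] := gs_osupp gs o.
apply: (wins_cycle_west (rd eu) oth' n0 _ _ _ (gsW y hy o eu) (l := y + 1)).
- move=> j Gj; rewrite eF' //.
  case: ((fP j).1 Gj) => [[z0 _]|[y' [hy' o' low' ->]]].
    by move: o; rewrite -(eu j Gj) z0.
  rewrite (eu j Gj) in o' low'.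
  suff -> : y' = y by [].
  have [lt|[//|lt]] : y' < y \/ y' = y \/ y < y' by lia.
    by move: o'; rewrite low //; lia.
  by move: o; rewrite low' //; lia.
- by rewrite /R /a; lia.
- move=> x y1 hy1 hx o1 hy2.
  have [{}o1 ne] : O x y1 = true /\ ~ (x = u j0 /\ y1 = y).
    move: o1; rewrite /tor /hmove /pt !updE /R /a.
    by zcase; rewrite ?orbF ?orbT //; try lia; move=> o2; split=> // -[].
  (* Debris just below [y] would have kept row [y] empty, and at height [y] itself there is only the
     particle that has been raised. *)
  have [lt|e] : y1 < y \/ y1 = y by lia.
    by have := gs_rows gs (u j0) hy1 hx o1 (y' := y) ltac:(lia); rewrite o.
  by subst y1; apply: ne; have := gs_uniq gs hy hx bu1 o1 o.
Qed.

End Probes.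

(** * Counting the visits that clear a row *)

Lemma zsum_remove f v s : (forall x, 0 <= f x) -> In v s ->
  zsum f (remove Z.eq_dec v s) <= zsum f s - f v.
Proof.
move=> f0; elim: s => //= x s IH [->|i].
  case: Z.eq_dec => // _.
  suff : zsum f (remove Z.eq_dec v s) <= zsum f s by lia.
  elim: s {IH} => [|y s IH] /=; first by lia.
  by case: Z.eq_dec => _ /=; have := f0 y; lia.
by have := IH i; have := f0 x; case: Z.eq_dec => [e|_] /=; [subst|]; lia.
Qed.

Lemma list_min (s : list Z) : s <> nil ->
  exists2 v, In v s & forall x, In x s -> v <= x.
Proof.
elim: s => // x [|y s] IH _.
  by exists x => [|z [<-|//]]; [left|lia].
have [v iv mv] := IH ltac:(by []).
have [le|lt] : x <= v \/ v < x by lia.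
  by exists x => [|z [<-|/mv]]; [left| |]; lia.
by exists v => [|z [<-|/mv]]; [by right|lia|lia].
Qed.

(** Bounds the number of visits after which all of [s] lies beyond [e], as each advances some
    particle by at least one cell. *)
Definition excess e s := zsum (fun x => Z.max 0 (e + 1 - x)) s.

Lemma excess_ge0 e s : 0 <= excess e s.
Proof. by apply: zsum_ge0; lia. Qed.

Lemma excess_gt e s x : excess e s <= 0 -> In x s -> e < x.
Proof.
rewrite /excess; elim: s => //= y s IH h.
have := @zsum_ge0 (fun x => Z.max 0 (e + 1 - x)) s ltac:(by move=> z; lia).
by move=> p [<-|i]; [lia|apply: IH => //; lia].
Qed.

Lemma excess0 e s : (forall x, In x s -> e < x) -> excess e s = 0.
Proof.
rewrite /excess; elim: s => //= y s IH h.
rewrite IH; last by move=> x i; apply: h; right.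
by have := h y (or_introl erefl); lia.
Qed.

Definition jump v u (s : list Z) := u :: remove Z.eq_dec v s.

Lemma in_jump v u s x : In x (jump v u s) <-> x = u \/ In x s /\ x <> v.
Proof.
rewrite /jump /=; split=> [[e|h]|[e|[i n]]]; first by left.
- by right; apply: (in_remove Z.eq_dec).
- by left.
- by right; apply: in_in_remove.
Qed.

Lemma excess_jump e v u s : In v s -> v < u -> v <= e ->
  excess e (jump v u s) <= excess e s - 1.
Proof.
move=> i lt le; rewrite /excess /=.
have := @zsum_remove (fun x => Z.max 0 (e + 1 - x)) v s ltac:(by move=> z; lia) i.
by lia.
Qed.

(** When the first particle is already beyond [e], so are all the others and the landing cell:
    surplus visits do no harm, and any bound on the excess will do. *)
Lemma excess_jump_le e v u s (M : nat) : In v s ->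
  (forall x, In x s -> v <= x) -> v < u -> excess e s <= Z.of_nat M.+1 ->
  excess e (jump v u s) <= Z.of_nat M.
Proof.
move=> i mv lt le; have [ve|ve] : v <= e \/ e < v by lia.
  by have := excess_jump i lt ve; lia.
rewrite excess0; first by lia.
by move=> x /in_jump [->|[/mv h _]]; lia.
Qed.

(** * Scripts of visits to one row *)

Section Scripts.
Variables (I : Type) (good : I -> hconf -> Prop) (prot : Z -> Prop).
Variables (G : I -> Prop) (L0 : Z) (F0 : I -> ustate) (H : Z) (j0 : I).
Hypothesis protP : forall x, prot x -> -L0 <= x <= L0.
Hypothesis L0_ge0 : 0 <= L0.
Hypothesis H_ge0 : 0 <= H.
Hypothesis G0 : G j0.
Hypothesis splitG : splitwin good prot G L0 F0.

Let ready B n C U := ready good prot G L0 F0 H B n C U.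
Let distinct C := @distinct_strips I G H C.

Lemma distinct_probe B (U : Z -> Prop) C p r v u : distinct C ->
  (forall j, G j -> legal H B U (C j) p r (v j) u) ->
  distinct (fun j => probe (C j) p r (v j) u).
Proof.
move=> dC lg i j Gi Gj ne e; apply: (dC i j Gi Gj ne).
exact: (probe_inj (lg i Gi) (lg j Gj) e).
Qed.

(** The cells [v] and [u] do not depend on the member, so no split can occur. *)
Lemma ready_probe_row B n C U p r v u : 0 <= n -> distinct C ->
  (forall j, G j -> legal H B U (C j) p r v u) ->
  (distinct (fun j => probe (C j) p r v u) ->
   ready B n (fun j => probe (C j) p r v u) (fun x => [\/ U x, x = p | x = u])) ->
  ready B (n + 1) C U.
Proof.
move=> n0 dC lg rd.
apply: (ready_probe protP L0_ge0 (v := fun=> v) (u := fun=> u) G0 n0 dC lg splitG).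
move=> _ L F X O l0 oth eF bl gs.
apply: (rd (distinct_probe dC lg) _ _ _ _ _ oth eF bl).
case: gs => h1 h2 h3 h4 h5 h6 h7 h8 h9 h10; split;
  [exact: h1|exact: h2|exact: h3|exact: h4|exact: h5|exact: h6| |exact: h8|exact: h9
  |exact: h10].
move=> x y hy hx o.
by have [?|?|[? ? ?]] := h7 x y hy hx o; [apply: Or31|apply: Or32|apply: Or33].
Qed.

Definition frame r c (C C' : I -> tape) := forall j, G j ->
  (forall x y, -H <= y <= H -> y <> r -> C' j x y = C j x y) /\
  (forall x, x < c -> C' j x r = C j x r).

(** Every visit advances the port by one cell, so the same particle serves the next visit, and each
    entry column is used only once. The gap of [M] cells keeps the port away from the particles,
    which all end up beyond [e]. *)
Lemma clear_row B r e b lo s P (M : nat) n C U : -H <= r <= H -> 0 <= n ->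
  -B <= P -> b + Z.of_nat M <= B -> s <> nil -> excess e s <= Z.of_nat M ->
  (forall x, In x s -> P + Z.of_nat M + 1 < x /\ lo <= x <= b) ->
  distinct C ->
  (forall j, G j -> C j P r = true /\
     forall x, P < x -> (C j x r = true <-> In x s)) ->
  (forall j x y, G j -> r < y <= H -> P <= x <= b + Z.of_nat M ->
     C j x y = false) ->
  (forall x, P <= x < P + Z.of_nat M -> ~ U x) ->
  (forall C' U', distinct C' -> frame r P C C' ->
     (forall j, G j -> C' j (P + Z.of_nat M) r = true /\
        forall x, P <= x <= e -> x <> P + Z.of_nat M -> C' j x r = false) ->
     (forall x, U' x -> [\/ U x, P <= x < P + Z.of_nat M |
        lo < x <= b + Z.of_nat M]) ->
     ready B n C' U') ->
  ready B (n + Z.of_nat M) C U.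
Proof.
move=> hr n0; elim: M P b s C U => [|M IH] P b s C U.
  move=> hP hb s0 le hs dC row above fresh cont.
  rewrite (Z.add_0_r n : n + Z.of_nat 0 = n).
  apply: cont => //.
  - move=> j Gj; have [p1 p2] := row j Gj; rewrite Z.add_0_r; split=> // x hx ne.
    case e1: (C j x r) => //; have lt : P < x by lia.
    by move: e1 => /(p2 x lt).1 /(excess_gt le); lia.
  - by move=> x; apply: Or31.
move=> hP hb s0 le hs dC row above fresh cont.
have [v iv mv] := list_min s0.
have [hv1 hv2] := hs v iv.
have eb : C j0 (b + 1) r = false.
  case e1: (C j0 (b + 1) r) => //.
  by move: e1 => /((row j0 G0).2 (b + 1) ltac:(lia)).1 /hs; lia.
have [u [hu cu run]] := @zleast (fun x => ~~ C j0 x r) v (b + 1)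
  ltac:(by rewrite /= eb) ltac:(lia).
have same j x : G j -> P < x -> C j x r = C j0 x r.
  move=> Gj lt; have := (row j Gj).2 x lt; have := (row j0 G0).2 x lt.
  by move=> h1 h2; apply/idP/idP => [/h2/h1|/h1/h2].
have cv : C j0 v r = true by apply/(row j0 G0).2 => //; lia.
have lg j : G j -> legal H B U (C j) P r v u.
  move=> Gj; split=> //; try lia.
  - by apply: fresh; lia.
  - by move=> y hy; apply: above => //; lia.
  - by move=> y hy; apply: above => //; lia.
  - exact: (row j Gj).1.
  - move=> x hx; case e1: (C j x r) => //.
    by move: e1 => /((row j Gj).2 x ltac:(lia)).1 /mv; lia.
  - move=> x hx; rewrite same //; last by lia.
    case: (Z.eq_dec x v) => [->//|ne].
    by have := run x ltac:(lia); case: (C j0 x r).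
  - by rewrite same //; [move: cu; case: (C j0 u r)|lia].
have -> : n + Z.of_nat M.+1 = (n + Z.of_nat M) + 1 by lia.
apply: (ready_probe_row _ dC lg); first by lia.
move=> dC1; apply: (IH (P + 1) (b + 1) (jump v u s)) => //; try lia.
- by apply: (excess_jump_le iv mv _ le); lia.
- by move=> x /in_jump [->|[/hs]]; lia.
- move=> j Gj; have [p1 p2] := row j Gj; split.
    by rewrite /probe /hmove !updE; zcase => //; lia.
  move=> x hx; have := p2 x ltac:(lia).
  rewrite in_jump /probe /hmove !updE.
  by zcase; intuition (try lia; try congruence).
- move=> j x y Gj hy hx; rewrite /probe /hmove !updE.
  by zcase; rewrite ?above //; lia.
- by move=> x hx [|e1|e1]; try lia; apply: fresh; lia.
- move=> C' U' dC' fr row' hU'; apply: cont => //.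
  + move=> j Gj; have [f1 f2] := fr j Gj; split=> [x y hy ne|x hx].
      by rewrite f1 // /probe /hmove !updE; zcase.
    by rewrite f2 /probe /hmove ?updE; [zcase => //; lia|lia].
  + move=> j Gj; have [e1 e2] := row' j Gj; split.
      by rewrite -e1; congr (C' j _ r); lia.
    move=> x hx ne; have [->|lt] : x = P \/ P < x by lia.
      have [_ ->] := fr j Gj; last by lia.
      by rewrite /probe /hmove !updE; zcase => //; lia.
    by apply: e2; lia.
  + move=> x /hU' [[h|h|h]|h|h]; try (by apply: Or31);
      by [apply: Or32; lia|apply: Or33; lia].
Qed.

(** A lone particle has its hole right in front of it, so each visit advances it and its port by one
    cell. *)
Lemma write_one B r w m (N : nat) n C U : -H <= r <= H -> 0 <= n ->
  -B <= w -> m + Z.of_nat N <= B -> w + Z.of_nat N < m - 1 ->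
  distinct C ->
  (forall j x, G j -> w <= x <= m + Z.of_nat N ->
     C j x r = (x =? w) || (x =? m)) ->
  (forall j x y, G j -> r < y <= H -> w <= x <= m + Z.of_nat N ->
     C j x y = false) ->
  (forall x, w <= x < w + Z.of_nat N -> ~ U x) ->
  (forall C' U', distinct C' -> frame r w C C' ->
     (forall j x, G j -> w <= x -> C' j x r =
        if x <=? m + Z.of_nat N then (x =? w + Z.of_nat N) || (x =? m + Z.of_nat N)
        else C j x r) ->
     (forall x, U' x -> U x \/ w <= x <= m + Z.of_nat N) ->
     ready B n C' U') ->
  ready B (n + Z.of_nat N) C U.
Proof.
move=> hr n0; elim: N w m C U => [|N IH] w m C U hw hm lt dC row above fresh cont.
  rewrite (Z.add_0_r n : n + Z.of_nat 0 = n).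
  apply: cont => //; last by move=> x; left.
  move=> j x Gj hx; rewrite !Z.add_0_r; case: Z.leb_spec => // le.
  by apply: row => //; lia.
have lg j : G j -> legal H B U (C j) w r m (m + 1).
  move=> Gj; split=> //; try lia; try (by move=> y hy; apply: above => //; lia).
  - by apply: fresh; lia.
  - by rewrite row ?Z.eqb_refl //; lia.
  - by move=> x hx; rewrite row //; [zcase => //; lia|lia].
  - by move=> x hx; rewrite row //; [zcase => //; lia|lia].
  - by rewrite row //; [zcase => //; lia|lia].
have -> : n + Z.of_nat N.+1 = (n + Z.of_nat N) + 1 by lia.
apply: (ready_probe_row _ dC lg); first by lia.
move=> dC1; apply: (IH (w + 1) (m + 1)) => //; try lia.
- move=> j x Gj hx; rewrite /probe /hmove !updE row //; last by lia.
  by zcase => //; lia.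
- move=> j x y Gj hy hx; rewrite /probe /hmove !updE above //; last by lia.
  by zcase => //; lia.
- by move=> x hx [|e1|e1]; try lia; apply: fresh; lia.
- move=> C' U' dC' fr row' hU'; apply: cont => //.
  + move=> j Gj; have [f1 f2] := fr j Gj; split=> [x y hy ne|x hx].
      by rewrite f1 // /probe /hmove !updE; zcase.
    by rewrite f2 /probe /hmove ?updE; [zcase => //; lia|lia].
  + move=> j x Gj hx; have [->|lt'] : x = w \/ w < x by lia.
      have [_ ->] := fr j Gj; last by lia.
      rewrite /probe /hmove !updE; case: Z.leb_spec => ?; last by lia.
      by zcase => //; lia.
    rewrite row' //; last by lia.
    rewrite /probe /hmove !updE.
    case: Z.leb_spec => ?; case: Z.leb_spec => ?; zcase => //; lia.
  + by move=> x /hU' [[h|h|h]|h]; [by left| | |]; right; lia.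
Qed.

(** Targets are filled from the right, so that no particle has to get past one already in place. *)
Fixpoint desc (s : list Z) :=
  match s with nil => True | a :: s' => (forall x, In x s' -> x < a) /\ desc s' end.

(* The port left over after placing one target is the particle moved to the
   next one, so ports are set up farther and farther West. *)
Lemma write_chain r ts m b t : -H <= r <= H -> desc ts ->
  (forall a, In a ts -> m < a <= t) -> m <= t ->
  exists zone lo N, [/\ 0 <= N, lo <= b, lo <= m,
    (forall x, In x zone -> lo <= x < b /\ x < m) &
    forall B n C U, 0 <= n -> -B <= lo -> t <= B -> distinct C ->
      (forall j x, G j -> lo <= x <= t ->
         (C j x r = true <-> x = m \/ In x zone)) ->
      (forall j x y, G j -> r < y <= H -> lo <= x <= t -> C j x y = false) ->
      (forall x, lo <= x < b -> ~ U x) ->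
      (forall C' U', distinct C' -> frame r lo C C' ->
         (forall j x, G j -> m < x ->
            (C' j x r = true <-> In x ts \/ C j x r = true)) ->
         (forall x, U' x -> U x \/ lo <= x <= t) ->
         ready B n C' U') ->
      ready B (n + N) C U].
Proof.
move=> hr; elim: ts m b t => [|a ts IH] m b t ds hts hmt.
  exists nil, (Z.min b m), 0; split=> //; try lia.
  move=> B n C U n0 _ _ dC _ _ _ cont; rewrite Z.add_0_r; apply: cont => //.
    by move=> j x Gj hx; split=> [|[]//]; right.
  by move=> x; left.
have [da ds'] := ds; have ha := hts a (or_introl erefl).
pose N1 := Z.to_nat (a - m).
(* The port has to make [a - m] moves and stop at [m'], where it becomes the next particle; two
   cells are left between it and the starting point [m]. *)
pose m' := Z.min b m - 2; pose w := m' - Z.of_nat N1.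
have eN1 : Z.of_nat N1 = a - m by rewrite /N1; lia.
have [||zone [lo [N [N0 lob lom hz P]]]] := IH m' w (a - 1) ds'.
- move=> x ix; have := da x ix; have := hts x (or_intror ix); rewrite /m'; lia.
- by rewrite /m'; lia.
exists (w :: zone), lo, (N + Z.of_nat N1); split=> //; try lia.
  by move=> x [<-|/hz]; rewrite /w /m'; lia.
move=> B n C U n0 hB htB dC row above fresh cont.
rewrite Z.add_assoc.
have ew : w + Z.of_nat N1 = m' by rewrite /w; lia.
have em : m + Z.of_nat N1 = a by lia.
apply: (@write_one B r w m N1) => //; try (rewrite /w /m'; lia).
- move=> j x Gj; rewrite em => hx; have := row j x Gj ltac:(lia).
  case: (C j x r) => h.
    have [e|[e|/hz]] := h.1 erefl; [subst x|subst x|by lia];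
      by rewrite Z.eqb_refl ?orbT.
  by zcase => //; apply: h.2; [right; left|left].
- by move=> j x y Gj hy hx; apply: above => //; lia.
- by move=> x hx; apply: fresh; rewrite /m' in ew; lia.
move=> C1 U1 dC1 fr1 row1 hU1; rewrite ew em in row1 hU1.
apply: P => //; try lia.
- move=> j x Gj hx; have [lt|ge] : x < w \/ w <= x by lia.
    have [_ ->] := fr1 j Gj => //; rewrite row //; last by lia.
    by split=> [[|[]]|[|]]; try (rewrite /m' in ew; lia); right=> //; right.
  rewrite row1 //; case: Z.leb_spec => ?; last by lia.
  split=> [|[->|/hz]]; [zcase => //; try lia| |by lia].
  by rewrite Z.eqb_refl.
- move=> j x y Gj hy hx; have [f1 _] := fr1 j Gj; rewrite f1; try lia.
  by apply: above => //; lia.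
- move=> x hx /hU1 [|]; last by lia.
  by apply: fresh; rewrite /m' in ew; lia.
move=> C' U' dC' fr' row' hU'; apply: cont => //.
- move=> j Gj; have [f1 f2] := fr' j Gj; have [g1 g2] := fr1 j Gj.
  split=> [x y hy ne|x hx]; first by rewrite f1 // g1.
  by rewrite f2 // g2 //; lia.
- move=> j x Gj hx; rewrite row' //; last by rewrite /m'; lia.
  rewrite row1 //; last by rewrite /m' in ew; lia.
  case: Z.leb_spec => le.
    have := row j x Gj ltac:(lia); case: (C j x r) => h.
      have [|[|/hz]] := h.1 erefl; try lia; rewrite /w /m'; lia.
    split=> [[i|e]|[[e|i]|//]].
    + by left; right.
    + by left; left; move: e; zcase => // _; rewrite /m' in e; lia.
    + by right; subst x; rewrite Z.eqb_refl orbT.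
    + by left.
  split=> [[i|->]|[[e|i]|->]]; try (by right); try (by left); try lia.
  by left; right.
- by move=> x /hU' [/hU1 [|]|]; [by left| |]; right; lia.
Qed.

End Scripts.

(** * Plans for the rows of a strip *)

Definition inl (x : Z) s := if in_dec Z.eq_dec x s then true else false.

Lemma inlP x s : inl x s = true <-> In x s.
Proof. by rewrite /inl; case: in_dec. Qed.

Fixpoint zdown x n :=
  match n with O => nil | S n' => x :: zdown (x - 1) n' end.

Lemma in_zdown x n y : In y (zdown x n) <-> x - Z.of_nat n < y <= x.
Proof.
by elim: n x => [|n IH] x; [|rewrite [zdown _ _]/= [In _ _]/= IH]; simpl In; lia.
Qed.

Lemma desc_zdown (P : Z -> bool) x n : desc (List.filter P (zdown x n)).
Proof.
elim: n x => //= n IH x; case: (P x) => //=; split=> // y.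
by move=> /filter_In [/in_zdown]; lia.
Qed.

Definition row_list H (X : tape) r := List.filter (fun x => X x r)
  (zdown H (Z.to_nat (2 * H + 1))).

Lemma in_row_list H X r x : In x (row_list H X r) <-> -H <= x <= H /\ X x r = true.
Proof. by rewrite /row_list filter_In in_zdown; intuition lia. Qed.

Section Plans.
Variables (I : Type) (good : I -> hconf -> Prop) (prot : Z -> Prop).
Variables (G : I -> Prop) (L0 : Z) (F0 : I -> ustate) (H : Z) (j0 : I).
Hypothesis protP : forall x, prot x -> -L0 <= x <= L0.
Hypothesis L0_ge0 : 0 <= L0.
Hypothesis H_ge0 : 0 <= H.
Hypothesis G0 : G j0.
Hypothesis splitG : splitwin good prot G L0 F0.

Let ready B n C U := ready good prot G L0 F0 H B n C U.
Let distinct C := @distinct_strips I G H C.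

(* [q = -H-2] is an extra particle of row [r] and [P] its port; rows are
   cleared from the top, hence into thresholds and zones that are wider for
   higher rows. *)
Lemma plan_clear (X : I -> tape) r b e :
  -H <= r <= H -> b <= -H - 1 -> H <= e ->
  (forall j x, G j -> X j x r = true -> -H <= x <= H) ->
  (forall j x, G j -> X j x r = X j0 x r) ->
  exists P (M : nat), [/\ P + Z.of_nat M + 2 < b &
    forall B n C U, 0 <= n -> -B <= P -> H + Z.of_nat M <= B ->
      distinct C ->
      (forall j x, G j -> P <= x ->
         C j x r = X j x r || inl x [:: P; - H - 2]) ->
      (forall j x y, G j -> r < y <= H -> P <= x <= H + Z.of_nat M ->
         C j x y = false) ->
      (forall x, P <= x < P + Z.of_nat M -> ~ U x) ->
      (forall C' U', distinct C' -> frame G H r P C C' ->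
         (forall j, G j -> C' j (P + Z.of_nat M) r = true /\
            forall x, P <= x <= e -> x <> P + Z.of_nat M -> C' j x r = false) ->
         (forall x, U' x -> [\/ U x, P <= x < P + Z.of_nat M |
            - H - 2 < x <= H + Z.of_nat M]) ->
         ready B n C' U') ->
      ready B (n + Z.of_nat M) C U].
Proof.
move=> hr hb he sX cX.
pose s := -H - 2 :: row_list H (X j0) r.
pose M := Z.to_nat (excess e s).
exists (b - Z.of_nat M - 3), M; set P := b - _ - 3; split; first by rewrite /P; lia.
have hs x : In x s -> P + Z.of_nat M + 1 < x /\ -H - 2 <= x <= H.
  by move=> [<-|/in_row_list []]; rewrite /P; lia.
move=> B n C U n0 hP hB dC row above fresh cont.
apply: (clear_row (e := e) protP L0_ge0 G0 splitG hr n0 hP hB _ _ hs dC) => //.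
  by rewrite /M; have := @excess_ge0 e s; lia.
move=> j Gj; split=> [|x hx].
  by rewrite row //; [apply/orP; right; apply/inlP; left|lia].
rewrite row //; last by lia.
rewrite cX // /s /=; split=> [/orP[h|/inlP [|[]]]|[e1|/in_row_list [_ ->]]] //.
- by right; apply/in_row_list; split=> //; apply: (sX j0).
- by lia.
- by left.
- by apply/orP; right; apply/inlP; right; left.
Qed.

(** Row [h] is cleared before the lower rows are treated, because the heads reach them through it,
    and it is written only afterwards. [Zt] holds the ports that must be there from the start; [b]
    and [B1] bound the columns used. *)
Lemma plan_write (X D : tape) (k : nat) :
  (forall x y, X x y = true -> -H <= x <= H) ->
  let h := - H - 1 + Z.of_nat k in h <= H ->
  exists Zt b B1 N, [/\ 0 <= N, b <= -H - 1,
    (forall x y, Zt x y = true -> b <= x <= - H - 2 /\ -H <= y <= h) &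
    forall B n C U, 0 <= n -> -B <= b -> B1 <= B -> distinct C ->
      (forall j x y, G j -> b <= x -> -H <= y <= h -> C j x y = X x y || Zt x y) ->
      (forall j x y, G j -> h < y <= H -> b <= x <= B1 -> C j x y = false) ->
      (forall x, b <= x <= - H - 2 -> ~ U x) ->
      (forall C' U', distinct C' ->
         (forall j x y, G j -> h < y <= H -> C' j x y = C j x y) ->
         (forall j x y, G j -> -H <= x <= H -> -H <= y <= h ->
            C' j x y = D x y) ->
         (forall x, U' x -> U x \/ b <= x <= B1) -> ready B n C' U') ->
      ready B (n + N) C U].
Proof.
move=> sX; elim: k => [|k IH] h hh.
  exists (fun _ _ => false), (-H - 1), 0, 0; split=> //; try lia.
  move=> B n C U n0 _ _ dC _ _ _ cont; rewrite Z.add_0_r; apply: cont => //.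
    by move=> j x y _ _; rewrite /h; lia.
  by move=> x; left.
move: IH; set h0 := - H - 1 + Z.of_nat k => IH.
have eh : h = h0 + 1 by rewrite /h /h0; lia.
have [|Z0 [b0 [B0 [N0 [N0p hb0 hZ0 P0]]]]] := IH; first by lia.
(* The particles of row [h] are driven beyond the columns used by the lower rows. *)
pose e := Z.max B0 H.
have hr : -H <= h <= H by rewrite /h; lia.
have [P [M [hPM clr]]] := @plan_clear (fun=> X) h b0 e hr hb0
  ltac:(rewrite /e; lia) ltac:(by move=> j x _; apply: sX) ltac:(by []).
(* The port left by the clearing, at [P + M], is the first particle to be placed; the ports for
   writing lie West of [P], where the clearing changes nothing. *)
have [||zw [lo [Nw [Nwp lob lom hz wr]]]] := @write_chain I good prot G L0 F0 H j0
  protP L0_ge0 G0 splitG h (row_list H D h) (P + Z.of_nat M) P e hr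
  (desc_zdown _ _ _).
- by move=> a /in_row_list; rewrite /e; lia.
- by rewrite /e; lia.
pose Z1 : tape := fun x y => Z0 x y || ((y =? h) && inl x [:: P, -H - 2 & zw]).
exists Z1, lo, (Z.max e (H + Z.of_nat M)), (Nw + N0 + Z.of_nat M).
have hzone x : In x [:: P, -H - 2 & zw] -> lo <= x <= -H - 2.
  by move=> [<-|[<-|/hz]]; lia.
split; try lia.
  move=> x y /orP[/hZ0|/andP[/Z.eqb_spec -> /inlP/hzone]]; lia.
move=> B n C U n0 hB hB1 dC rows above fresh cont.
rewrite !Z.add_assoc.
have far x y : x < -H -> X x y = false.
  by move=> lt; case e1: (X x y) => //; have := sX x y e1; lia.
have Z0h x : Z0 x h = false by case e1: (Z0 x h) => //; have := hZ0 x h e1; lia.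
apply: clr => //; try lia.
- move=> j x Gj hx; rewrite rows //; try lia.
  rewrite /Z1 Z0h Z.eqb_refl /=; congr (_ || _).
  apply/idP/idP => /inlP i; apply/inlP; last by case: i => [|[|]] //=; auto.
  by case: i => [|[|/hz]] /=; auto; lia.
- by move=> j x y Gj hy hx; apply: above => //; lia.
- by move=> x hx; apply: fresh; lia.
move=> C1 U1 dC1 fr1 row1 hU1; apply: P0 => //; try lia.
- move=> j x y Gj hx hy; have [f1 _] := fr1 j Gj; rewrite f1; try lia.
  rewrite rows //; try lia; rewrite /Z1.
  by case: Z.eqb_spec => e1; rewrite ?orbF //; lia.
- move=> j x y Gj hy hx; case: (Z.eq_dec y h) => [->|ne].
    by have [_ ->] := row1 j Gj => //; rewrite /e; lia.
  have [f1 _] := fr1 j Gj; rewrite f1; try lia.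
  by apply: above => //; rewrite /e; lia.
- by move=> x hx /hU1 [| |]; try lia; apply: fresh; lia.
move=> C2 U2 dC2 hi2 core2 hU2.
have row2 j x : G j -> lo <= x <= e ->
    C2 j x h = (x =? P + Z.of_nat M) || inl x zw.
  move=> Gj hx; rewrite hi2 //; last by lia.
  have [lt|ge] : x < P \/ P <= x by lia.
    have [_ ->] := fr1 j Gj => //.
    rewrite rows //; try lia; rewrite far /Z1 ?Z0h ?Z.eqb_refl /=; last by lia.
    case: Z.eqb_spec => [|_]; first by lia.
    apply/idP/idP => /inlP i; apply/inlP; last by right; right.
    by case: i => [|[|//]]; lia.
  have [e1 e2] := row1 j Gj; case: Z.eqb_spec => [->//|ne] /=.
  rewrite e2 //; last by lia.
  by case e3: (inl x zw) => //; move: e3 => /inlP/hz; lia.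
apply: wr => //; try (rewrite /e in hB1 *; lia).
- move=> j x Gj hx; rewrite row2 //; split=> [/orP[/Z.eqb_spec|/inlP]|[->|i]].
  + by left.
  + by right.
  + by rewrite Z.eqb_refl.
  + by apply/orP; right; apply/inlP.
- move=> j x y Gj hy hx; rewrite hi2 //; last by lia.
  have [f1 _] := fr1 j Gj; rewrite f1; try lia.
  by apply: above => //; rewrite /e in hx *; lia.
- by move=> x hx /hU2 [/hU1 []|]; try lia; apply: fresh; lia.
move=> C3 U3 dC3 fr3 row3 hU3; apply: cont => //.
- move=> j x y Gj hy; have [f3 _] := fr3 j Gj; rewrite f3; try lia.
  rewrite hi2 //; last by lia.
  by have [f1 _] := fr1 j Gj; rewrite f1 //; lia.
- move=> j x y Gj hx hy; case: (Z.eq_dec y h) => [->|ne]; last first.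
    have [f3 _] := fr3 j Gj; rewrite f3; try lia.
    by rewrite core2 //; lia.
  have := row3 j x Gj ltac:(lia); rewrite in_row_list row2 //; last by rewrite /e; lia.
  case: Z.eqb_spec => [|_]; first by lia.
  have -> : inl x zw = false by case e3: (inl x zw) => //; move: e3 => /inlP/hz; lia.
  by move=> h3; apply/idP/idP => [/h3 [[]|]//|d]; apply/h3; left.
- move=> x /hU3 [/hU2 [/hU1 [| |]|]|]; [by left| | | |]; right; rewrite /e in hPM *; lia.
Qed.

End Plans.

(** * Separating the members of a group *)

Section Separation.
Variables (I : Type) (good : I -> hconf -> Prop) (prot : Z -> Prop).
Variables (G : I -> Prop) (L0 : Z) (F0 : I -> ustate) (H : Z) (j0 : I).
Hypothesis protP : forall x, prot x -> -L0 <= x <= L0.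
Hypothesis L0_ge0 : 0 <= L0.
Hypothesis H_ge0 : 0 <= H.
Hypothesis G0 : G j0.
Hypothesis splitG : splitwin good prot G L0 F0.

Let ready B n C U := ready good prot G L0 F0 H B n C U.
Let distinct C := @distinct_strips I G H C.

(* Below the least column [a] in which two members differ all of them move the
   same particles; once a run of particles ends at [a - 1], its first particle
   lands in [a] for some members only. *)
Lemma sep_row B r a b s P (M : nat) n C U : -H <= r <= H -> 0 <= n ->
  -B <= P -> b + 1 <= B -> a <= b -> s <> nil ->
  excess (a - 1) s <= Z.of_nat M ->
  (forall x, In x s -> P + Z.of_nat M + 1 < x < a) ->
  distinct C ->
  (forall j, G j -> [/\ C j P r = true,
     forall x, P < x < a -> (C j x r = true <-> In x s) &
     forall x, b < x -> C j x r = false]) ->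
  (exists i k, [/\ G i, G k, C i a r = true & C k a r = false]) ->
  (forall j x y, G j -> r < y <= H -> P <= x <= b + 1 -> C j x y = false) ->
  (forall x, P <= x < P + Z.of_nat M -> ~ U x) ->
  ready B (n + Z.of_nat M) C U.
Proof.
move=> hr n0; elim: M P s C U => [|M IH] P s C U hP hb ab s0 le hs dC row
  [i [k [Gi Gk ci ck]]] above fresh.
  (* Without excess the first particle would lie beyond [a - 1], although all of [s] lies before
     [a]. *)
  have [v iv _] := list_min s0.
  by have := excess_gt le iv; have := hs v iv; lia.
have [v iv mv] := list_min s0; have hv := hs v iv.
have /choice [u hu] : forall j, exists u, G j ->
    [/\ v < u <= b + 1, C j u r = false & forall x, v < x < u -> C j x r = true].
  move=> j; have [Gj|nG] := pselect (G j); last by exists 0 => /nG.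
  have [_ _ z] := row j Gj.
  have [u [h1 h2 h3]] := @zleast (fun x => ~~ C j x r) v (b + 1)
    ltac:(by rewrite /= z //; lia) ltac:(lia).
  exists u => _; split=> //; first exact: negbTE.
  by move=> x /h3 /negbFE.
have lg j : G j -> legal H B U (C j) P r v (u j).
  move=> Gj; have [h1 h2 h3] := hu j Gj; have [p1 p2 p3] := row j Gj.
  split=> //; try lia.
  - by apply: fresh; lia.
  - by move=> y hy; apply: above => //; lia.
  - by move=> y hy; apply: above => //; lia.
  - move=> x hx; case e1: (C j x r) => //.
    by move: e1 => /(p2 x ltac:(lia)).1 /mv; lia.
  - move=> x hx; case: (Z.eq_dec x v) => [->|ne]; last by apply: h3; lia.
    by apply/p2 => //; lia.
have -> : n + Z.of_nat M.+1 = (n + Z.of_nat M) + 1 by lia.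
apply: (ready_probe protP L0_ge0 (v := fun=> v) (u := u) G0 _ dC lg splitG).
  by lia.
(* A common hole before [a] distinguishes nothing yet, and the visit only brings the particles
   closer to [a]. *)
move=> eu; have [lt|ge] : u j0 < a \/ a <= u j0 by lia.
  have dC1 : distinct (fun j => probe (C j) P r v (u j)).
    move=> i' j' Gi' Gj' ne e; apply: (dC i' j' Gi' Gj' ne).
    have e' := e; have l1 := lg i' Gi'; have l2 := lg j' Gj'.
    rewrite (eu i' Gi') in l1 e'; rewrite (eu j' Gj') in l2 e'.
    exact: (probe_inj l1 l2 e').
  have [h1 h2 h3] := hu j0 G0.
  have pa j : G j -> forall x, a <= x -> probe (C j) P r v (u j) x r = C j x r.
    move=> Gj x hx; rewrite /probe /hmove !updE (eu j Gj).
    by zcase => //; lia.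
  apply: (IH (P + 1) (jump v (u j0) s)) => //; try lia.
  - by apply: (excess_jump_le iv mv _ le); lia.
  - by move=> x /in_jump [->|[/hs]]; lia.
  - move=> j Gj; have [p1 p2 p3] := row j Gj; split.
    + by rewrite /probe /hmove !updE; zcase => //; lia.
    + move=> x hx; have := p2 x ltac:(lia).
      rewrite in_jump /probe /hmove !updE (eu j Gj).
      by zcase; intuition (try lia; try congruence).
    + by move=> x hx; rewrite pa // ?p3 //; lia.
  - by exists i, k; split=> //; rewrite pa //; lia.
  - move=> j x y Gj hy hx; rewrite /probe /hmove !updE.
    by zcase; rewrite ?above //; lia.
  - move=> x hx [|e1|[j Gj e1]]; first by apply: fresh; lia.
      by lia.
    by rewrite eu // in e1; lia.
(* A common hole cannot lie at or beyond [a], which is occupied in [i] and free in [k]. *)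
exfalso; have [i1 i2 i3] := hu i Gi; have [k1 k2 k3] := hu k Gk.
rewrite (eu i Gi) in i1 i2 i3; rewrite (eu k Gk) in k1 k2 k3.
have [lt|e] : a < u j0 \/ u j0 = a by lia.
  by move: (k3 a ltac:(lia)); rewrite ck.
by rewrite e ci in i2.
Qed.

(** The members agree in the rows above [r0], so these can be cleared without splitting the group,
    after which [sep_row] has access to row [r0]. *)
Lemma plan_separate (X : I -> tape) r0 (n0 : nat) :
  (forall j x y, G j -> X j x y = true -> -H <= x <= H) ->
  (forall j x y, G j -> r0 < y <= H -> X j x y = X j0 x y) ->
  (exists i k x, [/\ G i, G k & X i x r0 <> X k x r0]) -> -H <= r0 ->
  let h := r0 + Z.of_nat n0 in h <= H ->
  exists Zt b B1 N, [/\ 0 <= N, b <= -H - 1,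
    (forall x y, Zt x y = true -> b <= x <= - H - 2 /\ r0 <= y <= h) &
    forall B n C U, 0 <= n -> -B <= b -> B1 <= B -> distinct C ->
      (forall j x y, G j -> b <= x -> r0 <= y <= h ->
         C j x y = X j x y || Zt x y) ->
      (forall j x y, G j -> h < y <= H -> b <= x <= B1 -> C j x y = false) ->
      (forall x, b <= x <= - H - 2 -> ~ U x) ->
      ready B (n + N) C U].
Proof.
move=> sX cX [i0 [k0 [x0 [Gi0 Gk0 dx0]]]] hr0.
have far j x y : G j -> ~ (-H <= x <= H) -> X j x y = false.
  by move=> Gj o; case e: (X j x y) => //; case: o; apply: sX e.
elim: n0 => [|k IH] h hh.
  pose diff x := `[< exists i k, [/\ G i, G k & X i x r0 <> X k x r0] >].
  have d0 : diff x0 = true by apply/asboolP; exists i0, k0.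
  have bx0 : -H <= x0 <= H.
    apply: contrapT => o; apply: dx0; rewrite !far //.
  have [a [ha da la]] := zleast d0 (h := - H - 1) ltac:(lia).
  have same j x : G j -> x < a -> X j x r0 = X j0 x r0.
    move=> Gj lt; have [lo|hi] : -H <= x \/ x < -H by lia.
      apply: contrapT => ne; have : diff x = true.
        by apply/asboolP; exists j, j0.
      by rewrite la //; lia.
    by rewrite !far //; lia.
  (* The extra particle at [-H - 2] gives the visits something to move even if the row is empty
     before [a]. *)
  pose s := -H - 2 :: List.filter (fun x => x <? a) (row_list H (X j0) r0).
  pose M := Z.to_nat (excess (a - 1) s).
  pose P := -H - 4 - Z.of_nat M.
  have hs x : In x s -> P + Z.of_nat M + 1 < x < a.
    move=> [<-|i]; first by rewrite /P; lia.
    have [/in_row_list [h1 _] h2] := (filter_In _ _ _).1 i.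
    by move: h2 => /Z.ltb_lt; rewrite /P; lia.
  pose Z1 : tape := fun x y => (y =? r0) && inl x [:: P; -H - 2].
  have Z1E x : Z1 x r0 = inl x [:: P; -H - 2] by rewrite /Z1 Z.eqb_refl.
  exists Z1, P, (H + 1), (Z.of_nat M); split; try (rewrite /P; lia).
    by move=> x y /andP[/Z.eqb_spec -> /inlP [<-|[<-|[]]]]; rewrite /P /h; lia.
  move=> B n C U n0 hB hB1 dC rows above fresh.
  apply: (@sep_row B r0 a H s P M) => //; try (rewrite /h in hh *; lia).
  - have rowsE j x : G j -> P <= x -> C j x r0 = X j x r0 || inl x [:: P; -H - 2].
      by move=> Gj hx; rewrite rows ?Z1E //; rewrite /h; lia.
    move=> j Gj; split.
    + rewrite rowsE //; last by lia.
      by apply/orP; right; apply/inlP; left.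
    + move=> x hx; rewrite rowsE //; last by lia.
      rewrite same //; last by lia.
      rewrite /s /= filter_In in_row_list.
      split=> [/orP[h1|/inlP [|[]]]|[e1|[[_ ->]]]] //; try lia.
      * right; split; last by apply/Z.ltb_spec0; lia.
        by split=> //; apply: sX h1.
      * by apply/orP; right; apply/inlP; right; left.
    + move=> x hx; rewrite rowsE //; last by rewrite /P; lia.
      rewrite far //=; last by lia.
      case e: (inl _ _) => //; move: e => /inlP [|[|[]]]; rewrite /P; lia.
  - have rowsE j : G j -> C j a r0 = X j a r0.
      move=> Gj; rewrite rows ?Z1E //; try (rewrite /h /P; lia).
      case e: (inl _ _); last by rewrite orbF.
      by move: e => /inlP [|[|[]]]; rewrite /P; lia.
    move: da => /asboolP [i [k [Gi Gk]]]; rewrite -!rowsE //.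
    by case ei: (C i a r0); case ek: (C k a r0) => // _;
      [exists i, k|exists k, i].
  - by move=> j x y Gj hy hx; apply: above => //; rewrite /h; lia.
  - by move=> x hx; apply: fresh; rewrite /P in hx *; lia.
move: IH; set h0 := r0 + Z.of_nat k => IH.
have eh : h = h0 + 1 by rewrite /h /h0; lia.
have [|Z0 [b0 [B0 [N0 [N0p hb0 hZ0 P0]]]]] := IH; first by lia.
pose e := Z.max B0 H.
have hr : -H <= h <= H by rewrite /h; lia.
have [P [M [hPM clr]]] := @plan_clear I good prot G L0 F0 H j0 protP L0_ge0 H_ge0
  G0 splitG X h b0 e hr hb0
  ltac:(rewrite /e; lia) ltac:(by move=> j x Gj; apply: sX)
  ltac:(by move=> j x Gj; apply: cX => //; rewrite /h; lia).
pose Z1 : tape := fun x y => Z0 x y || ((y =? h) && inl x [:: P; -H - 2]).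
exists Z1, P, (Z.max e (H + Z.of_nat M)), (N0 + Z.of_nat M).
split; try lia.
  move=> x y /orP[/hZ0|/andP[/Z.eqb_spec -> /inlP [<-|[<-|[]]]]];
    rewrite /h0 /h; lia.
move=> B n C U n0 hB hB1 dC rows above fresh.
rewrite !Z.add_assoc.
have Z0h x : Z0 x h = false by case e1: (Z0 x h) => //; have := hZ0 x h e1; lia.
apply: clr => //; try lia.
- by move=> j x Gj hx; rewrite rows // ?/Z1 ?Z0h ?Z.eqb_refl //; rewrite /h; lia.
- by move=> j x y Gj hy hx; apply: above => //; lia.
- by move=> x hx; apply: fresh; lia.
move=> C1 U1 dC1 fr1 row1 hU1; apply: P0 => //; try (rewrite /e in hB1; lia).
- move=> j x y Gj hx hy; have [f1 _] := fr1 j Gj; rewrite f1; try lia.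
  rewrite rows //; try lia; rewrite /Z1.
  by case: Z.eqb_spec => e1; rewrite ?orbF //; lia.
- move=> j x y Gj hy hx; case: (Z.eq_dec y h) => [->|ne].
    by have [_ ->] := row1 j Gj => //; rewrite /e; lia.
  have [f1 _] := fr1 j Gj; rewrite f1; try lia.
  by apply: above => //; rewrite /e; lia.
- by move=> x hx /hU1 [| |]; try lia; apply: fresh; lia.
Qed.

End Separation.

(** * From a South-going ray to visits and back *)

Section Process.
Variables (I : Type) (good : I -> hconf -> Prop) (prot : Z -> Prop).
Variables (G : I -> Prop) (L0 : Z) (F0 : I -> ustate) (l : Z) (X : I -> tape).
Hypothesis protP : forall x, prot x -> -L0 <= x <= L0.
Hypothesis L0_ge0 : 0 <= L0.
Hypothesis oth0 : others prot G L0 F0 L0 F0.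
Hypothesis bl : -L0 <= l <= L0.
Hypothesis free : ~ prot l /\ ~ prot (l + 1).
Hypothesis alone : forall j, ~ G j -> ul (F0 j) <> l.
Hypothesis memb : forall j, G j -> F0 j = UState South l (X j) /\ supp L0 (X j).

(** Two turns, South to East to North, lead to a column East of the window, with no debris above the
    strip yet. The first turning particle is put on column [l] and ends on [l + 1], hence the two
    conditions in [free]. *)
Lemma wins_begin H b B n (Zt : tape) : L0 <= H ->
  (forall x y, Zt x y = true -> b <= x <= - H - 2 /\ -H <= y <= H) ->
  0 <= n ->
  ready good prot G L0 F0 H B n (fun j => tor (X j) Zt) (fun=> False) ->
  wins good L0 F0.
Proof.
move=> leH hZ n0 rd.
pose L1 := Z.max (Z.max H B) (Z.max L0 (- b)) + 1.
pose C j := tor (X j) Zt.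
have sC j : G j -> supp L1 (C j).
  move=> Gj x y /orP[/(memb Gj).2|/hZ]; rewrite /inbox /L1; lia.
apply: (wins_group (L' := L1) (A0 := Zt) (f := fun j => UState South l (C j))
  protP oth0).
- by rewrite /L1; lia.
- move=> x y; rewrite /inbox => i; case e: (Zt x y) => //.
  by move: e => /hZ; lia.
- by move=> x y /hZ; rewrite /inbox /L1; lia.
- move=> x y lo hy; have bx : -L0 <= x <= L0.
    by case: lo => [/protP//|[j nG ->]]; case: (oth0.2 j nG).
  by case e: (Zt x y) => //; move: e => /hZ; lia.
- move=> j Gj; have [-> s] := memb Gj.
  eexists; apply: (@fly_to _ _ _ _ _ _ _ (L1 - L0)) => /=; try (rewrite /L1; lia).
  move=> i hi; split; last by rewrite /inbox /L1 in hi *; lia.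
  rewrite /tor (supp0 s) ?/inbox; last by lia.
  by case e: (Zt _ _) => //; move: e => /hZ; lia.
move=> F1 oth1 eF1.
have gs1 : gstate prot G H B L1 n C C (fun _ _ => false) (fun=> False).
  split=> //; try (rewrite /L1; lia).
  move=> j Gj x y hy; case e: (C j x y) => //; case: hy.
  by move: e => /orP[/(memb Gj).2|/hZ]; rewrite ?/inbox; lia.
have e1 j : G j -> F1 j = UState South l (C j) /\ supp L1 (C j).
  by move=> Gj; rewrite eF1 //; split=> //; apply: sC.
apply: (wins_turn (a := 1) protP oth1 _ _ _ e1) => //; try (rewrite /L1; lia).
  by move=> _; split=> //; case: free.
move=> F2 oth2 eF2 /=.
set L2 := L1 + 1 + 1 in oth2 eF2 *.
have gs2 := gs_add (L' := L2) (gx := l + 1) (gy := - L1 - 1) gs1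
  ltac:(rewrite /L2; lia) ltac:(rewrite /inbox /L2 /L1; lia)
  ltac:(left; split; [rewrite /L1; lia|by case: free]).
rewrite /= Z.add_0_r in eF2.
have e2 j : G j -> F2 j = UState East (- L1 - 1)
      (tor (C j) (pt (l + 1) (- L1 - 1))) /\
      supp L2 (tor (C j) (pt (l + 1) (- L1 - 1))).
  by move=> Gj; rewrite eF2 //; split=> //; exact: (gs_supp gs2).
apply: (wins_turn (a := 1) protP oth2 _ _ _ e2) => //; try (rewrite /L2 /L1; lia).
move=> F3 oth3 eF3 /=.
set L3 := L2 + 1 + 1 in oth3 eF3 *.
have gs3 := gs_add (L' := L3) (gx := L2 + 1 + 1) (gy := - L1 - 1) gs2
  ltac:(rewrite /L3; lia) ltac:(rewrite /inbox /L3 /L2 /L1; lia)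
  ltac:(left; split; [rewrite /L1; lia|move/protP; rewrite /L2 /L1; lia]).
rewrite /= Z.add_0_r in eF3.
apply: (rd _ _ _ _ _ oth3 eF3 _ gs3); rewrite /L3 /L2 /L1; lia.
Qed.

Lemma wins_separate i0 k0 : G i0 -> G k0 -> i0 <> k0 ->
  (forall i k, G i -> G k -> i <> k -> X i <> X k) ->
  splitwin good prot G L0 F0 -> wins good L0 F0.
Proof.
move=> Gi0 Gk0 ne dX sp.
pose diff y := `[< exists i k x, [/\ G i, G k & X i x y <> X k x y] >].
have [y0 hy0 d0] : exists2 y, -L0 <= y <= L0 & diff y = true.
  apply: contrapT => no; apply: (dX _ _ Gi0 Gk0 ne); apply: tape_ext => x y.
  apply: contrapT => n; apply: no; exists y.
    apply: contrapT => o; apply: n.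
    by rewrite !(supp0 (memb _).2) // /inbox; lia.
  by apply/asboolP; exists i0, k0, x.
(* Heights are negated: the least [z] gives the topmost row in which members differ. *)
have [z [hz dz lz]] := @zleast (fun z => diff (- z)) (- L0 - 1) (- y0)
  ltac:(by cbv beta; rewrite Z.opp_involutive) ltac:(lia).
have sX j x y : G j -> X j x y = true -> -L0 <= x <= L0.
  by move=> Gj /(memb Gj).2 []; lia.
have common j x y : G j -> - z < y <= L0 -> X j x y = X i0 x y.
  move=> Gj hy; apply: contrapT => n.
  have := lz (- y) ltac:(lia); rewrite Z.opp_involutive => /asboolPn; apply.
  by exists j, i0, x.
have ex : exists i k x, [/\ G i, G k & X i x (- z) <> X k x (- z)].
  by apply/asboolP.
have [||Zt [b [B1 [N [N0 hb hZ P]]]]] := @plan_separate I good prot G L0 F0 L0 i0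
  protP L0_ge0 L0_ge0 Gi0 sp X (- z) (Z.to_nat (L0 + z)) sX common ex; try lia.
apply: (@wins_begin L0 b (Z.max (- b) B1) (0 + N) Zt); try lia.
  by move=> x y /hZ; lia.
apply: P; try lia.
- move=> i k Gi Gk nik e; apply: (dX i k Gi Gk nik); apply: tape_ext => x y.
  have [hy|o] : -L0 <= y <= L0 \/ ~ (-L0 <= y <= L0) by lia.
    have := e x y hy; rewrite /tor.
    case ez: (Zt x y); last by rewrite !orbF.
    by have := hZ x y ez => hz'; rewrite !(supp0 (memb _).2) // /inbox; lia.
  by rewrite !(supp0 (memb _).2) // /inbox; lia.
- by [].
Qed.

End Process.

(** A group with one member never splits. Two final turns, North to West to South, send it off West
    of the old box, and hence away from the columns of the bystanders. *)
Lemma wins_write (I : Type) (good : I -> hconf -> Prop) (prot : Z -> Prop)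
    (j : I) L0 F0 l X D H :
  (forall x, prot x -> -L0 <= x <= L0) -> 0 <= L0 ->
  others prot (eq j) L0 F0 L0 F0 -> -L0 <= l <= L0 ->
  ~ prot l /\ ~ prot (l + 1) ->
  (forall i, i <> j -> ul (F0 i) <> l) ->
  F0 j = UState South l X -> supp L0 X -> L0 <= H ->
  (forall L' F' l' X', others prot (eq j) L0 F0 L' F' -> l' < -L0 ->
     -L' <= l' -> H <= L' ->
     F' j = UState South l' X' -> supp L' X' ->
     (forall x y, -H <= x <= H -> -H <= y <= H -> X' x y = D x y) ->
     (forall x y, prot x -> y < -H -> X' x y = false) ->
     wins good L' F') ->
  wins good L0 F0.
Proof.
move=> protP L0_ge0 oth0 bl free alone ej s leH cont.
have H0 : 0 <= H by lia.
have sp : splitwin good prot (eq j) L0 F0.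
  by move=> L F _ _ _ [i [k [<- <- []]]].
have [|Zt [b [B1 [N [N0 hb hZ P]]]]] := @plan_write I good prot (eq j) L0 F0 H j
  protP L0_ge0 H0 erefl sp X D (Z.to_nat (2 * H + 1))
  ltac:(by move=> x y /s []; lia); first by lia.
have memb i : j = i -> F0 i = UState South l X /\ supp L0 X.
  by move=> <-.
apply: (@wins_begin I good prot (eq j) L0 F0 l (fun=> X) protP L0_ge0 oth0 bl
  free _ memb H b (Z.max (- b) B1) (0 + N) Zt) => //; try lia.
- by move=> i ne; apply: alone => e; apply: ne.
- by move=> x y /hZ; lia.
apply: P; try lia.
- by move=> i k <- <-.
- by [].
move=> C' U' _ _ core _ L F X1 O l0 oth eF hl0 gs.
have le0 := oth.1; have [hH hB] := (gs_H gs, gs_B gs).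
have coreX x y : -H <= x <= H -> -H <= y <= H -> X1 j x y = D x y.
  by move=> hx hy; rewrite (gs_strip gs) // core //; lia.
have e i : j = i -> F i = UState North l0 (X1 i) /\ supp L (X1 i).
  by move=> Gi; split; [apply: eF|apply: (gs_supp gs)].
apply: (wins_turn (a := 1) protP oth _ _ _ e) => //; try lia.
move=> F1 oth1 eF1 /=.
set L1 := L + 1 + 1 in oth1 eF1 *.
rewrite /= Z.add_0_r in eF1.
pose X2 i := tor (X1 i) (pt l0 (L + 1 + 1)).
have s2 : supp L1 (X2 j).
  move=> x y /orP[/(gs_supp gs erefl)|]; rewrite /inbox /L1; first by lia.
  by rewrite /pt; zcase => // _; lia.
have e1 i : j = i -> F1 i = UState West (L + 1 + 1) (X2 i) /\ supp L1 (X2 i).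
  by move=> Gi; subst i; split=> //; apply: eF1.
apply: (wins_turn (a := 1) protP oth1 _ _ _ e1) => //; try (rewrite /L1; lia).
move=> F2 oth2 eF2 /=.
set L2 := L1 + 1 + 1 in oth2 eF2 *.
rewrite /= Z.add_0_r in eF2.
apply: (cont _ _ _ _ oth2 _ _ _ (eF2 j erefl)); try (rewrite /L2 /L1; lia).
- move=> x y /orP[/s2|]; rewrite /inbox /L2 /L1; first by lia.
  by rewrite /pt; zcase => // _; lia.
- move=> x y hx hy; rewrite /X2 /tor /pt coreX //.
  by zcase; rewrite ?orbF //; lia.
- move=> x y px hy; rewrite /X2 /tor /pt (gs_off gs) //; last by lia.
  by rewrite (gs_low gs) //=; zcase => //; lia.
Qed.

(** * Spreading the universes over distinct rays *)

Section Spread.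
Variables (k : nat) (good : 'I_k -> hconf -> Prop).
Local Notation family := ('I_k -> ustate).

Definition valid L (F : family) := forall j, -L <= ul (F j) <= L /\ supp L (ut (F j)).

Definition same (F : family) i j := ud (F i) = ud (F j) /\ ul (F i) = ul (F j).

Definition apart (F : family) := forall i j, i <> j -> same F i j ->
  ut (F i) <> ut (F j).

Definition ties (F : family) :=
  #|[set ij : 'I_k * 'I_k | (ij.1 != ij.2) && `[< same F ij.1 ij.2 >]]|.

(** A particle just off the box is met from one ray only, and the line on which the heads leave it
    lies outside [[-L, L]], so no two rays merge. *)
Lemma wins_turn_any L (F : family) j0 : valid L F -> apart F ->
  (forall F', valid (L + 2) F' -> apart F' ->
     (forall i j, same F' i j <-> same F i j) ->
     (forall j, same F j j0 -> ud (F' j) = left (ud (F j))) ->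
     (forall j, ~ same F j j0 -> ud (F' j) = ud (F j)) ->
     wins good (L + 2) F') ->
  wins good L F.
Proof.
move=> vF aF w; set d := ud (F j0); set l := ul (F j0).
have bl := (vF j0).1.
pose gx := turnx L 1 d l; pose gy := turny L 1 d l.
pose rx := gx + dirx (push d); pose ry := gy + diry (push d).
pose F' j := if pselect (same F j j0) then
    UState (left d) (turnl L 1 d) (tor (ut (F j)) (pt rx ry))
  else UState (ud (F j)) (ul (F j)) (tor (ut (F j)) (pt gx gy)).
have FT j : same F j j0 ->
    F' j = UState (left d) (turnl L 1 d) (tor (ut (F j)) (pt rx ry)).
  by rewrite /F'; case: pselect.
have FN j : ~ same F j j0 ->
    F' j = UState (ud (F j)) (ul (F j)) (tor (ut (F j)) (pt gx gy)).
  by rewrite /F'; case: pselect.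
have ig : inbox (L + 2) gx gy /\ ~ inbox L gx gy.
  by rewrite /inbox /gx /gy /l; case: (d) => /=; lia.
have ir : inbox (L + 2) rx ry /\ ~ inbox L rx ry.
  by rewrite /inbox /rx /ry /gx /gy /l; case: (d) => /=; lia.
have bl' : -(L + 2) <= turnl L 1 d <= L + 2 /\ ~ (-L <= turnl L 1 d <= L).
  by case: (d) => /=; lia.
have st j x y : inbox (L + 2) x y -> supp (L + 2) (tor (ut (F j)) (pt x y)).
  move=> i x' y' /orP[/(vF j).2|]; first by rewrite /inbox; lia.
  by rewrite /pt; zcase => // _; subst.
have eqL : L + 1 + 1 = L + 2 by lia.
have sameF i j : same F' i j <-> same F i j.
  have [si|ni] := pselect (same F i j0); have [sj|nj] := pselect (same F j j0).
  - rewrite /same !FT //=; split=> // _.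
    by case: si => -> ->; case: sj => -> ->.
  - rewrite /same FT // FN //=; split=> [[_ e]|[e1 e2]].
      by have := (vF j).1; lia.
    by case: nj; case: si => f1 f2; split; congruence.
  - rewrite /same FN // FT //=; split=> [[_ e]|[e1 e2]].
      by have := (vF i).1; lia.
    by case: ni; case: sj => f1 f2; split; congruence.
  - by rewrite /same !FN.
apply: (@wins_step _ good L (L + 2) (pt gx gy) F F'); first by lia.
- by move=> x y i; rewrite /pt; zcase => //; subst; case: ig.
- move=> j; have [sj|nj] := pselect (same F j j0).
    rewrite FT //=; case: (sj) => -> ->.
    have [n r] := @turn_run L 1 d l (ut (F j)) ltac:(lia) bl (vF j).2.
    by rewrite eqL in r; exists n.
  rewrite FN //=; exists (Z.to_nat 2).
  have [bj sj] := vF j.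
  apply: fly_to; [by []|by case: (ud (F j)) => /=; lia
    |by case: (ud (F j)) => /=; lia|].
  move=> i hi; split; last by rewrite /inbox; case: (ud (F j)) => /=; lia.
  rewrite /tor (supp0 sj); last by rewrite /inbox; case: (ud (F j)) => /=; lia.
  have : ~ (ud (F j) = d /\ ul (F j) = l) by [].
  rewrite /pt /gx /gy; case: (d); case: (ud (F j)) => /= ne; zcase => //; try lia;
    by case: ne; split=> //; lia.
apply: w => //.
- move=> j; have [sj|nj] := pselect (same F j j0).
    by rewrite FT //=; split; [lia|apply: st; case: ir].
  by rewrite FN //=; split; [have := (vF j).1; lia|apply: st; case: ig].
- have tinj x y (X Y : tape) : supp L X -> supp L Y -> ~ inbox L x y ->
      tor X (pt x y) = tor Y (pt x y) -> X = Y.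
    move=> sX sY o e; apply: tape_ext => a b.
    have := congr1 (fun T : tape => T a b) e; rewrite /tor /pt.
    zcase; rewrite ?orbF // => _; subst.
    by rewrite (supp0 sX o) (supp0 sY o).
  move=> i j ne /sameF s; have [si|ni] := pselect (same F i j0).
    have sj : same F j j0 by case: s => e1 e2; case: si => f1 f2; split; congruence.
    rewrite !FT //= => /tinj e; apply: (aF i j ne s); apply: e.
    + exact: (vF i).2.
    + exact: (vF j).2.
    + by case: ir.
  have nj : ~ same F j j0.
    by move=> sj; apply: ni; case: s => e1 e2; case: sj => f1 f2; split; congruence.
  rewrite !FN //= => /tinj e; apply: (aF i j ne s); apply: e.
  + exact: (vF i).2.
  + exact: (vF j).2.
  + by case: ig.
- by move=> j sj; rewrite FT //=; case: sj => ->.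
- by move=> j nj; rewrite FN.
Qed.

Definition turns d := match d with South => 0%nat | West => 1%nat | North => 2%nat | East => 3%nat end.

Lemma wins_to_south L (F : family) : valid L F -> apart F ->
  (forall L' F', L <= L' -> valid L' F' -> apart F' -> (forall j, ud (F' j) = South) ->
     (forall i j, same F' i j <-> same F i j) -> wins good L' F') ->
  wins good L F.
Proof.
move: {2}(\sum_j turns (ud (F j)))%nat (leqnn (\sum_j turns (ud (F j)))%nat) => n.
elim: n L F => [|n IH] L F le vF aF w.
  apply: w => //; try lia; move=> j.
  move: le; rewrite leqn0 sum_nat_eq0 => /forallP/(_ j).
  by case: (ud (F j)).
have [all|] := pselect (forall j, ud (F j) = South).
  by apply: w => //; lia.
move=> /existsNP[j0 nS].
apply: (wins_turn_any (j0 := j0) vF aF) => F' vF' aF' sF' t1 t2.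
apply: (IH _ _ _ vF' aF') => [|L' F'' hL vF'' aF'' S sF''].
  rewrite -ltnS; apply: leq_trans le; rewrite (bigD1 j0) //= [X in (_ < X)%nat](bigD1 j0) //=.
  rewrite -addSn; apply: leq_add.
    by rewrite t1 //; case: (ud (F j0)) nS.
  apply: leq_sum => j _; have [s|ns] := pselect (same F j j0).
    by rewrite t1 //; case: s => -> _; case: (ud (F j0)) nS.
  by rewrite t2.
apply: w => //; first by lia.
by move=> i j; rewrite sF'' sF'.
Qed.

(** Induction on the number of tied pairs. Separating a class creates no ties, since its members
    then do not fly South while the others still do on their old columns; and at least one tie is
    lost. *)
Lemma wins_spread L (F : family) : 0 <= L -> valid L F -> apart F ->
  (forall L' F', 0 <= L' -> valid L' F' -> (forall j, ud (F' j) = South) ->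
     (forall i j, i <> j -> ul (F' i) <> ul (F' j)) -> wins good L' F') ->
  wins good L F.
Proof.
move=> L_ge0 vF aF w.
move: {2}(ties F) (leqnn (ties F)) => n.
elim: n L F L_ge0 vF aF => [|n IH] L F L_ge0 vF aF le.
  apply: (wins_to_south vF aF) => L' F' hL vF' aF' S sF'.
  apply: w => //; first by lia.
  move=> i j ne e; move: le; rewrite leqn0 cards_eq0 => /eqP/setP/(_ (i, j)).
  rewrite !inE /=; have -> : (i != j) by apply/eqP.
  move=> /= /asboolPn; apply; apply/sF'; split=> //.
  by rewrite !S.
apply: (wins_to_south vF aF) => L' F' hL vF' aF' S sF'.
have [no|] := pselect (forall i j, i <> j -> ul (F' i) <> ul (F' j)).
  by apply: w => //; lia.
move=> /existsNP[i0 /existsNP[k0 /not_implyP[ne /contrapT e]]].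
pose G j := same F' j i0.
have memb j : G j -> F' j = UState South (ul (F' i0)) (ut (F' j)) /\
    supp L' (ut (F' j)).
  move=> [e1 e2]; split; last exact: (vF' j).2.
  by case: (F' j) (S j) e2 => d l X /= -> ->.
apply: (@wins_separate _ good (fun=> False) G L' F' (ul (F' i0))
  (fun j => ut (F' j)) _ _ _ _ _ _ memb i0 k0) => //; try lia.
- split=> [|j _]; first by lia.
  by split=> //; [exact: (vF' j).1|exact: (vF' j).2].
- exact: (vF' i0).1.
- by move=> j nG e1; apply: nG; split=> //; rewrite !S.
- by split=> //; rewrite !S.
- move=> i j [a1 b1] [a2 b2] nij; apply: aF' => //.
  by split; congruence.
- move=> L'' F'' oth m1 m2 [i1 [k1 [Gi1 Gk1 n1]]].
  have sub i j : same F'' i j -> same F' i j.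
    move=> [e1 e2]; have [Gi|nGi] := pselect (G i); have [Gj|nGj] := pselect (G j).
    + by case: Gi => a1 b1; case: Gj => a2 b2; split; congruence.
    + have [h1 _ _] := m1 i Gi; have [h2 _ _ _ _] := oth.2 j nGj.
      by case: h1; congruence.
    + have [h1 _ _] := m1 j Gj; have [h2 _ _ _ _] := oth.2 i nGi.
      by case: h1; congruence.
    + have [_ h1 _ _ _] := oth.2 i nGi; have [_ h2 _ _ _] := oth.2 j nGj.
      by split; [rewrite !S|congruence].
  apply: IH.
  + by have := oth.1; lia.
  + move=> j; have [Gj|nG] := pselect (G j); first by have [_ h1 h2] := m1 j Gj.
    have [_ -> h1 _ h2] := oth.2 j nG; have := oth.1; split=> //; lia.
  + move=> i j nij s; have [e1 e2] := s.
    have [Gi|nGi] := pselect (G i); have [Gj|nGj] := pselect (G j).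
    * exact: m2.
    * have [h1 _ _] := m1 i Gi; have [h2 _ _ _ _] := oth.2 j nGj.
      by case: h1; congruence.
    * have [h1 _ _] := m1 j Gj; have [h2 _ _ _ _] := oth.2 i nGi.
      by case: h1; congruence.
    * have [_ _ _ [x1 _] _] := oth.2 i nGi; have [_ _ _ [x2 _] _] := oth.2 j nGj.
      move=> eX; apply: (aF' i j nij (sub _ _ s)); apply: tape_ext => x y.
      have [ib|o] : inbox L' x y \/ ~ inbox L' x y by rewrite /inbox; lia.
        by rewrite -x1 // eX x2.
      by rewrite !(supp0 (vF' _).2 o).
  + rewrite -ltnS; apply: leq_trans le; apply: proper_card.
    apply/properP; split.
      apply/fintype.subsetP => -[i j]; rewrite !inE /= => /andP[-> /asboolP /sub s].
      by apply/asboolP/sF'.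
    exists (i1, k1); rewrite !inE /=.
      apply/andP; split.
        by apply/eqP => e1; apply: n1; rewrite e1.
      apply/asboolP/sF'; case: Gi1 => a1 b1; case: Gk1 => a2 b2.
      by split; congruence.
    by apply/negP => /andP[_ /asboolP].
Qed.

End Spread.

(** * Synchronised arrival *)

Section Finish.
Variables (k : nat) (Lg : Z) (goal : 'I_k -> hconf).
Hypothesis goalP : forall j, inside Lg (goal j).
Local Notation family := ('I_k -> ustate).

Let good j c := hits_goal Lg (goal j) c.

(** Column [z] must be free below [Ht], so that a head coming from outside reaches the box of the
    entry. *)
Definition armed z j L (u : ustate) := exists D Ht,
  [/\ target Lg (goal j) Ht North z D, Ht <= L,
      forall x y, inbox Ht x y -> ut u x y = D x y &
      forall y, y < - Ht -> ut u z y = false].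

Lemma bounded_ord (f : 'I_k -> Z) : exists b, forall j, f j <= b.
Proof.
suff H : forall s : seq 'I_k, exists b, forall j, j \in s -> f j <= b.
  by have [b hb] := H (enum 'I_k); exists b => j; apply: hb; rewrite mem_enum.
elim=> [|i s [b hb]]; first by exists 0.
exists (Z.max (f i) b) => j; rewrite inE => /orP[/eqP ->|/hb]; lia.
Qed.

Lemma Z_of_addn a b : Z.of_nat (addn a b) = Z.of_nat a + Z.of_nat b.
Proof. by rewrite -plusE; lia. Qed.

(* Head [j] turns East on row [-L - a j] and North on column [z j], where it
   meets [n j] particles in a row; [a] and [n] adjust the arrival time. *)
Lemma wins_armed L (F : family) (z : 'I_k -> Z) : valid L F -> 0 <= L ->
  (forall j, ud (F j) = South) -> (forall j, ul (F j) < 0) ->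
  (forall i j, i <> j -> ul (F i) <> ul (F j)) ->
  (forall j, armed (z j) j L (F j)) ->
  (forall j, 2 * Z.of_nat k + 3 < z j) ->
  (forall i j, i <> j -> 2 * Z.of_nat k < Z.abs (z i - z j)) ->
  wins good L F.
Proof.
move=> vF L0 S neg dis arm zbig zfar T.
have /choice [Ht hHt] : forall j, exists Ht, exists D, exists tau, exists c,
    [/\ Lg <= Ht <= L, -Ht <= z j <= Ht,
        run Ht tau (inray Ht North (z j) D) c, good j c &
        (forall x y, inbox Ht x y -> ut (F j) x y = D x y) /\
        (forall y, y < - Ht -> ut (F j) (z j) y = false)].
  move=> j; have [D [Ht [[h1 h2 h3 [tau [c [h4 h5]]]] h6 h7 h8]]] := arm j.
  by exists Ht, D, tau, c; split.
move: hHt => /choice [D] /choice [tau] /choice [c hP].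
(* The arrival time without its adjustable part [2 * a j + n j]. *)
pose base j := z j - ul (F j) + L - Ht j + Z.of_nat (tau j) + Z.of_nat (T j).
have [b hb] := bounded_ord base.
(* Large enough for every quotient [q j] to be positive. *)
pose t := Z.max b 0 + 5 * Z.of_nat k + 5.
pose k2 := 2 * Z.of_nat k.
have kj (j : 'I_k) : 0 <= Z.of_nat j < Z.of_nat k.
  by have /ltP := ltn_ord j; lia.
(* Division by [2 * k]: the quotient goes into the row [a j], the remainder into the run length
   [n j], and the residue [j] of [a j] modulo [k] keeps the rows distinct. *)
pose q j := (t - base j - 2 * Z.of_nat j - 1) / k2.
pose a j := Z.of_nat k * q j + Z.of_nat j.
pose n j := 1 + (t - base j - 2 * Z.of_nat j - 1) mod k2.
have hq j : 1 <= q j.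
  apply: Z.div_le_lower_bound; have := hb j; have := kj j; rewrite /k2 /t; lia.
have hn j : 1 <= n j <= k2.
  have := Z.mod_pos_bound (t - base j - 2 * Z.of_nat j - 1) k2.
  by rewrite /n; have := kj j; rewrite /k2; lia.
have ha j : 1 <= a j by have := hq j; have := kj j; rewrite /a; nia.
have han j : 2 * a j + n j = t - base j.
  rewrite /a /n /q.
  have := Z.div_mod (t - base j - 2 * Z.of_nat j - 1) k2.
  by have := kj j; rewrite /k2; lia.
have adis i j : i <> j -> a i <> a j.
  move=> ne e; apply: ne; apply: ord_inj; rewrite /a in e.
  have hi := kj i; have hj := kj j.
  have [//|eq] : q i = q j \/ q i <> q j by lia.
    by move=> eq; rewrite eq in e; lia.
  by nia.
pose A : tape := fun x y => `[< exists j, y = - L - a j /\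
  (x = ul (F j) \/ z j - n j <= x < z j) >].
have AP x y j : y = - L - a j ->
    A x y = (x =? ul (F j)) || ((z j - n j <=? x) && (x <? z j)).
  move=> ey; apply/asboolP/idP => [[i [ei hx]]|h].
    have ij : i = j.
      by apply: contrapT => ne; apply: (adis i j ne); lia.
    rewrite ij in hx; case: hx => [->|[h1 h2]]; first by rewrite Z.eqb_refl.
    apply/orP; right; apply/andP; split; [exact/Z.leb_spec0|exact/Z.ltb_spec0].
  exists j; split=> //.
  by case/orP: h => [/Z.eqb_spec|/andP[/Z.leb_spec0 h1 /Z.ltb_spec0 h2]]; [left|right].
have A0 x y : A x y = true -> exists j, y = - L - a j /\
   (x = ul (F j) \/ z j - n j <= x < z j) by move=> /asboolP.
exists A, (Z.to_nat t); split.
  move=> x y [_ hy]; case e: (A x y) => //; have [j [ey _]] := A0 _ _ e.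
  by have := ha j; lia.
move=> j; have [hL hz r g [core col]] := hP j.
have [bj sj] := vF j; have nj := neg j; have aj := ha j; have zj := zbig j.
have njb := hn j; rewrite /k2 in njb.
set l := ul (F j) in nj bj *.
pose Y0 := tor (ut (F j)) A.
pose Lb := L + a j + 2.
have r1 : run Lb (Z.to_nat (a j - 1)) (ray L South l Y0)
    (HConf (Fly South) l (- L - a j) Y0).
  apply: fly_to => /=; try (rewrite /Lb; lia).
  move=> i hi; split; last by rewrite /inbox /Lb; lia.
  rewrite /Y0 /tor (supp0 sj) /inbox; last by lia.
  case e: (A _ _) => //; have [i' [ey hx]] := A0 _ _ e.
  have [ei|ni] := pselect (i' = j); first by subst i'; lia.
  by case: hx => [|hx]; [have := dis i' j ni; rewrite -/l; lia
                        |have := zbig i'; have := hn i'; rewrite /k2; lia].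
have Ylow x y : y < - L -> Y0 x y = A x y.
  by move=> hy; rewrite /Y0 /tor (supp0 sj) // /inbox; lia.
have r2 : run Lb 3 (HConf (Fly South) l (- L - a j) Y0)
    (HConf (Fly East) (l + 1 + 1) (- L - a j)
       (hmove Y0 l (- L - a j) (l + 1) (- L - a j))).
  have := @hit1_to Lb South l (- L - a j) (l + 1) (- L - a j) Y0.
  rewrite /= !Z.add_0_r; apply=> //; try (rewrite /inbox /Lb; lia).
    by rewrite Ylow ?(AP _ _ j) ?Z.eqb_refl //; lia.
  rewrite Ylow ?(AP _ _ j) //; last by lia.
  rewrite -/l; case: Z.eqb_spec => [|_]; first by lia.
  by case: Z.leb_spec => //; lia.
set Y1 := hmove Y0 _ _ _ _ in r2.
have Y1row x : l + 1 < x -> Y1 x (- L - a j) = (z j - n j <=? x) && (x <? z j).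
  move=> hx; rewrite /Y1 /hmove !updE; zcase; try lia;
    (rewrite Ylow ?(AP _ _ j) //; last by lia); rewrite -/l;
    by case: Z.eqb_spec => //; lia.
have r3 : run Lb (Z.to_nat (z j - n j - l - 2))
    (HConf (Fly East) (l + 1 + 1) (- L - a j) Y1)
    (HConf (Fly East) (z j - n j) (- L - a j) Y1).
  apply: fly_to => /=; try lia; move=> i hi.
  split; last by rewrite /inbox /Lb; lia.
  rewrite Z.mul_0_r Z.add_0_r Y1row; last by lia.
  by case: Z.leb_spec => //; lia.
have r4 : run Lb (Z.to_nat (2 * n j + 1))
    (HConf (Fly East) (z j - n j) (- L - a j) Y1)
    (HConf (Fly North) (z j) (- L - a j + 1)
       (hmove Y1 (z j - n j) (- L - a j) (z j) (- L - a j))).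
  have := @hit_to Lb East (z j - n j) (- L - a j) (z j) (- L - a j) (n j) Y1.
  rewrite /= !Z.add_0_r; apply; try lia.
  move=> i hi; rewrite Z.mul_0_r Z.add_0_r; split; last by rewrite /inbox /Lb; lia.
  rewrite Y1row; last by lia.
  have -> : (z j - n j <=? z j - n j + i * 1) = true by apply/Z.leb_spec0; lia.
  by case: Z.ltb_spec; case: Z.ltb_spec => //=; lia.
set Y2 := hmove Y1 _ _ _ _ in r4.
have Y2up x y : - L - a j < y -> Y2 x y = Y0 x y.
  by move=> hy; rewrite /Y2 /Y1 /hmove !updE; zcase => //; lia.
have r5 : run Lb (Z.to_nat (L + a j - 1 - Ht j))
    (HConf (Fly North) (z j) (- L - a j + 1) Y2) (inray (Ht j) North (z j) Y2).
  apply: fly_to => /=; try lia; move=> i hi.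
  split; last by rewrite /inbox /Lb; lia.
  rewrite Z.mul_0_r Z.add_0_r Y2up; last by lia.
  rewrite /Y0 /tor col; last by lia.
  case e: (A _ _) => //; have [i' [ey hx]] := A0 _ _ e.
  have [ei|ni] := pselect (i' = j); first by subst i'; lia.
  (* Runs have length at most [2 * k], less than the distance between entry columns, so no foreign
     run reaches column [z j]. *)
  have := zfar i' j ni; have := hn i'; have := neg i'; rewrite /k2.
  by case: hx; lia.
have core2 x y : inbox (Ht j) x y -> Y2 x y = htp (inray (Ht j) North (z j) (D j)) x y.
  move=> i; rewrite /= -core // Y2up; last by case: i; lia.
  rewrite /Y0 /tor; case e: (A x y); last by rewrite orbF.
  have [i' [ey _]] := A0 _ _ e; have := ha i'; case: i; lia.
have [Y3 r6 hY3] := run_local r core2.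
exists (addn (addn (addn (addn (addn (Z.to_nat (a j - 1)) 3)
  (Z.to_nat (z j - n j - l - 2))) (Z.to_nat (2 * n j + 1)))
  (Z.to_nat (L + a j - 1 - Ht j))) (tau j)).
split.
  apply: Nat2Z.inj; rewrite !Z_of_addn.
  have := han j; rewrite /base -/l => e.
  rewrite !Z2Nat.id; try lia.
have Lb' : Ht j <= Lb by rewrite /Lb; lia.
have R := run_trans (run_trans (run_trans (run_trans (run_trans r1 r2) r3) r4) r5)
  (run_mono Lb' r6).
rewrite S (run_iter R); case: g => g1 g2 g3 g4.
split=> //= x y i; rewrite -g4 //; apply: (hY3 x y).1.
by move: i; rewrite /inbox; lia.
Qed.

End Finish.

(** * Preparing the universes one at a time *)

Section Arming.
Variables (k : nat) (Lg : Z) (goal : 'I_k -> hconf).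
Hypothesis goalP : forall j, inside Lg (goal j).
Local Notation family := ('I_k -> ustate).

Let good j c := hits_goal Lg (goal j) c.

Lemma wins_widen L L' (F : family) : valid L F -> 0 <= L <= L' ->
  (forall j, ud (F j) = South) -> wins good L' F -> wins good L F.
Proof.
move=> vF hL S; apply: (@wins_step _ good L L' (fun _ _ => false)) => //.
  by lia.
move=> j; exists (Z.to_nat (L' - L)); have [bj sj] := vF j.
have -> : tor (ut (F j)) (fun _ _ => false) = ut (F j).
  by apply: tape_ext => x y; rewrite /tor orbF.
rewrite !S; apply: fly_to => /=; try lia; move=> i hi.
by split; [apply: (supp0 sj)|]; rewrite /inbox; lia.
Qed.

(** The first [m] universes are prepared. The others still fly within [Lp], so that neither their
    columns nor the adjacent ones meet the protected columns, which lie beyond [Lp + 2]. *)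
Lemma wins_arm (m : nat) Lp L (F : family) (z : 'I_k -> Z) : valid L F ->
  0 <= Lp <= L -> (forall j, ud (F j) = South) ->
  (forall i j, i <> j -> ul (F i) <> ul (F j)) ->
  (forall j : 'I_k, (j < m)%nat -> [/\ ul (F j) < 0,
     armed Lg goal (z j) j L (F j), Lp + 2 < z j <= L &
     2 * Z.of_nat k + 3 < z j]) ->
  (forall i j : 'I_k, (i < m)%nat -> (j < m)%nat -> i <> j ->
     2 * Z.of_nat k < Z.abs (z i - z j)) ->
  (forall j : 'I_k, (m <= j)%nat -> -Lp <= ul (F j) <= Lp) ->
  wins good L F.
Proof.
move ed : (k - m)%nat => d.
elim: d m ed L F z => [|d IH] m ed L F z vF hLp S dis done far todo.
  have lt (j : 'I_k) : (nat_of_ord j < m)%nat.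
    by apply: leq_trans (ltn_ord j) _; apply/eqP.
  apply: (wins_armed (z := z)) => //; try lia.
  - by move=> j; case: (done j (lt j)).
  - by move=> j; case: (done j (lt j)).
  - by move=> j; case: (done j (lt j)).
  - by move=> i j; apply: far; apply: lt.
have mk : (m < k)%nat by rewrite -subn_gt0 ed.
pose j0 := Ordinal mk.
(* Earlier entry columns are at most [L], so the new one is more than [2 * k] away from them. *)
have [Ht [zz [D [hz T]]]] := target_north (L + 2 * Z.of_nat k + 4) (goalP j0).
have [LgH bz sD _] := T.
pose L1 := Z.max L Ht.
pose z' i := if i == j0 then zz else z i.
have zj0 : z' j0 = zz by rewrite /z' eqxx.
have zlt (i : 'I_k) : (i < m)%nat -> z' i = z i /\ i <> j0.
  by rewrite /z'; case: eqP => // ->; rewrite ltnn.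
(* The new column is already protected while the contents for it are being written. *)
pose prot x := exists2 i : 'I_k, (i <= m)%nat & x = z' i.
have split_le (i : 'I_k) : (i <= m)%nat -> i = j0 \/ (i < m)%nat.
  by rewrite leq_eqVlt => /orP[/eqP e|]; [left; apply: ord_inj|right].
have protE x : prot x -> Lp + 2 < x <= L1.
  move=> [i /split_le [->|lt] ->]; first by rewrite zj0 /L1; lia.
  by have [-> _] := zlt i lt; case: (done i lt) => _ _; rewrite /L1; lia.
apply: (@wins_widen L L1) => //; first by rewrite /L1; lia.
have bj0 : -Lp <= ul (F j0) <= Lp by apply: todo; rewrite /= leqnn.
apply: (@wins_write _ good prot j0 L1 F (ul (F j0)) (ut (F j0)) D L1).
- by move=> x /protE; lia.
- by rewrite /L1; lia.
- split=> [|i _]; first by lia.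
  have [b1 s1] := vF i; split=> //.
  + by rewrite /L1; lia.
  + split=> // x y _ hy; apply: (supp0 s1); rewrite /inbox /L1 in hy *; lia.
  + by apply: supp_mono s1; rewrite /L1; lia.
- by rewrite /L1; lia.
- by split=> /protE; lia.
- by move=> i ne; apply: dis.
- by case: (F j0) (S j0) => d' l X /= ->.
- by apply: supp_mono (vF j0).2; rewrite /L1; lia.
- by lia.
move=> L' F' l' X' oth hl' hl'' hL' eF' sX' core low.
have neq i : i <> j0 -> j0 <> i by move=> ne e; apply: ne.
apply: (IH m.+1 _ L' F' z').
- by rewrite subnS ed.
- move=> j; have [->|ne] := pselect (j = j0); first by rewrite eF' /=; split=> //; lia.
  have [_ -> h1 _ h2] := oth.2 j (neq j ne).
  by split=> //; have := oth.1; lia.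
- by move: hLp hL'; rewrite /L1; lia.
- move=> j; have [->|ne] := pselect (j = j0); first by rewrite eF'.
  by have [-> _ _ _ _] := oth.2 j (neq j ne).
- have far' j : j <> j0 -> ul (F' j) = ul (F j) /\ l' < ul (F' j).
    by move=> ne; have [_ -> h1 _ _] := oth.2 j (neq j ne); split=> //; lia.
  have ej0 : ul (F' j0) = l' by rewrite eF'.
  move=> i j; have [->|ni] := pselect (i = j0); have [->|nj] := pselect (j = j0) => //.
  + by move=> _; rewrite ej0; have := far' j nj; lia.
  + by move=> _; rewrite ej0; have := far' i ni; lia.
  + by move=> ne; rewrite (far' i ni).1 (far' j nj).1; apply: dis.
- move=> j /split_le [->|lt].
    rewrite zj0 eF' /=; split; try (rewrite /L1 in hl' hL' *; lia).
    exists D, Ht; split=> //=.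
    + by rewrite /L1 in hL'; lia.
    + by move=> x y [hx hy]; apply: core; rewrite /L1; lia.
    + move=> y hy; have [hy'|hy'] : y < - L1 \/ - L1 <= y by lia.
        by apply: low => //; exists j0 => //=; rewrite ?zj0.
      rewrite core; try (rewrite /L1; lia).
  have [ez ne] := zlt j lt; rewrite ez.
  have [h1 [D' [Ht' [h2 h3 h4 h5]]] h6 h7] := done j lt.
  have [_ e1 _ [e2 e3] _] := oth.2 j (neq j ne).
  have hLL : L <= L' by rewrite /L1 in hL'; lia.
  have bz' : -Ht' <= z j <= Ht' by case: h2.
  rewrite e1; split=> //; try lia.
  exists D', Ht'; split=> //.
  + by lia.
  + move=> x y ib; rewrite e2 ?h4 //; move: ib; rewrite /inbox /L1; lia.
  + move=> y hy; have [hy'|hy'] : y < - L1 \/ - L1 <= y by lia.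
      by apply: e3 => //; exists j; rewrite ?ez // ltnW.
    by rewrite e2 ?h5 //; rewrite /inbox /L1 in hy' *; lia.
- have fz i : (nat_of_ord i < m)%nat -> z i <= L by move=> lt; case: (done i lt); lia.
  move=> i j /split_le [->|li] /split_le [->|lj] //.
  + by move=> _; rewrite zj0 (zlt j lj).1; have := fz j lj; lia.
  + by move=> _; rewrite zj0 (zlt i li).1; have := fz i li; lia.
  + by rewrite (zlt j lj).1 (zlt i li).1; apply: far.
- move=> j hj; have ne : j <> j0 by move=> e; move: hj; rewrite e /= ltnn.
  by have [_ -> _ _ _] := oth.2 j (neq j ne); apply: todo; apply: ltnW.
Qed.

Lemma wins_all L (F : family) : 0 <= L -> valid L F -> apart F -> wins good L F.
Proof.
move=> L0 vF aF; apply: (wins_spread L0 vF aF) => L' F' L0' vF' S dis.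
apply: (@wins_arm 0 L' L' F' (fun=> 0)) => //; first by lia.
by move=> j _; case: (vF' j).
Qed.

Theorem universal L (start : 'I_k -> hconf) : 0 <= L ->
  (forall j, inside L (start j)) ->
  (forall i j, i <> j -> forall n m, iter n step (start i) <> iter m step (start j)) ->
  exists A t, vanish L A /\ forall j,
    good j (iter t step (HConf (hst (start j)) (hx (start j)) (hy (start j))
                               (tor (htp (start j)) A))).
Proof.
move=> L0 ins disj.
have /choice [n /choice [d /choice [l /choice [X hX]]]] :=
  fun j => first_exit (ins j).
pose F j := UState (d j) (l j) (X j).
have vF : valid (L + 1) F by move=> j; have [_ s b] := hX j; split=> //=; lia.
have aF : apart F.
  (* Equal rays and equal tapes would be a common configuration of two orbits. *)
  move=> i j ne [/= e1 e2] e3; apply: (disj i j ne (n i) (n j)).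
  have [r1 _ _] := hX i; have [r2 _ _] := hX j.
  by rewrite (run_iter r1) (run_iter r2) e1 e2 e3.
have L1 : 0 <= L + 1 by lia.
have [A [t [vA h]]] := wins_all L1 vF aF n.
exists A, t; split.
  by move=> x y i; apply: vA; move: i; rewrite /inbox; lia.
move=> j; have [m [-> g]] := h j.
have [r _ _] := hX j.
by rewrite addnC iterD (run_iter (run_add r vA)).
Qed.

End Arming.

(** * The pusher as a Turing machine *)

Definition dir_code d : bool * bool :=
  match d with
  | East => (false, false) | North => (false, true)
  | West => (true, false) | South => (true, true)
  end.

Definition dir_decode (c : bool * bool) :=
  match c with
  | (false, false) => East | (false, true) => North
  | (true, false) => West | (true, true) => South
  end.

Definition mode_code q : option bool * (bool * bool) :=
  match q with
  | Fly d => (None, dir_code d)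
  | Pause d => (Some false, dir_code d)
  | Carry d => (Some true, dir_code d)
  end.

Definition mode_decode (c : option bool * (bool * bool)) :=
  match c.1 with
  | None => Fly (dir_decode c.2)
  | Some false => Pause (dir_decode c.2)
  | Some true => Carry (dir_decode c.2)
  end.

Lemma mode_codeK : cancel mode_code mode_decode.
Proof. by case=> -[]. Qed.

HB.instance Definition _ := Equality.copy mode (can_type mode_codeK).
HB.instance Definition _ := Choice.copy mode (can_type mode_codeK).
HB.instance Definition _ := Countable.copy mode (can_type mode_codeK).
HB.instance Definition _ := Finite.copy mode (can_type mode_codeK).

Definition untrans (c : mode * bool) : mode * bool :=
  match c with
  | (Fly d, false) => (Fly d, false)
  | (Fly d, true) => (Carry (left (left (left d))), false)
  | (Pause d, false) => (Fly d, true)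
  | (Pause d, true) => (Carry d, true)
  | (Carry d, s) => (Pause d, s)
  end.

Definition ptrans (c : mode * bool) := trans c.1 c.2.

Lemma ptransK : cancel ptrans untrans.
Proof. by case=> -[[]|[]|[]] []. Qed.

Lemma untransK : cancel untrans ptrans.
Proof. by case=> -[[]|[]|[]] []. Qed.

Arguments untrans : simpl never.

Definition mvec q : Z2 := (int_of_Z (movex q), int_of_Z (movey q)).

(** The displacement returned by [delta] is an element of the neighbourhood, which therefore
    contains all unit moves, although only the cell of the head influences a step. *)
Definition cross : {fset Z2} := [fset v in unit_moves]%fset.

Lemma mvec_unit q : mvec q \in unit_moves.
Proof. by case: q => -[]. Qed.

Lemma mvec_cross q : mvec q \in cross.
Proof. by rewrite in_fset /= mvec_unit. Qed.

Lemma origin_cross : (0%R, 0%R) \in cross.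
Proof. by rewrite in_fset. Qed.

Definition local_rule (c : mode * {ffun cross -> bool}) :
    mode * {ffun cross -> bool} * cross :=
  let q := trans c.1 (c.2 [` origin_cross]%fset) in
  (q.1, [ffun u => if val u == (0%R, 0%R) then q.2 else c.2 u],
   [` mvec_cross q.1]%fset).

Lemma mode_gt0 : (0 < #|{: mode}|)%N.
Proof. by apply/card_gt0P; exists (Fly East). Qed.

Definition pusher := @TuringMachine mode bool cross local_rule false mode_gt0.

Local Notation headM := (@head_step pusher).
Local Notation tapeM := (@tape_step pusher).

Lemma write_rule q v (x : Z2 -> bool) :
  write v (local_rule (q, local_view (M := pusher) (Defs.shift v x))).1.2 x
    = write1 v (trans q (x v)).2 x.
Proof.
apply: funext => w; rewrite /write /write1.
have ev : Defs.shift v x (0%R, 0%R) = x v.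
  by rewrite /Defs.shift; congr x; exact: (GRing.add0r v).
case: insubP => [u _ eu|nin] /=.
  rewrite !ffunE /= ev eu.
  have -> : ((w - v)%R == (0%R, 0%R)) = (w == v) by exact: (GRing.subr_eq0 w v).
  by case: ifP => // _; rewrite /Defs.shift GRing.subrK.
case: eqP => // e; case/negP: nin; rewrite e GRing.subrr.
exact: origin_cross.
Qed.

Lemma head_actE q v (x : Z2 -> bool) : head_act (M := pusher) q v x =
  (head_at (trans q (x v)).1 (v + mvec (trans q (x v)).1)%R,
   write1 v (trans q (x v)).2 x).
Proof.
rewrite -write_rule /head_act /= ffunE /=.
have -> : Defs.shift v x (0%R, 0%R) = x v.
  by rewrite /Defs.shift; congr x; exact: (GRing.add0r v).
by [].
Qed.

Lemma head_at_inj (q q' : mode) v v' :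
  head_at q v = head_at q' v' -> q = q' /\ v = v'.
Proof.
move=> e; have := congr1 (fun f => f v) e; rewrite /head_at eqxx.
by case: eqP => // -> [].
Qed.

Lemma head_stepE q v (x : Z2 -> bool) : headM (head_at q v, x) =
  (head_at (trans q (x v)).1 (v + mvec (trans q (x v)).1)%R,
   write1 v (trans q (x v)).2 x).
Proof.
rewrite /head_step; case: pselect => [h|[]]; last by exists (q, v).
case: cid => -[q' v'] /= /head_at_inj [<- <-].
exact: head_actE.
Qed.

Lemma head_step_headless (c : conf mode bool) :
  (forall q v, c.1 <> head_at q v) -> headM c = c.
Proof.
by move=> n; rewrite /head_step; case: pselect => // -[[q v] e]; case: (n _ _ e).
Qed.

Lemma tape_stepE q (x : Z2 -> bool) : tapeM (q, x) =
  ((trans q (x (0%R, 0%R))).1,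
   Defs.shift (mvec (trans q (x (0%R, 0%R))).1)
     (write1 (0%R, 0%R) (trans q (x (0%R, 0%R))).2 x)).
Proof.
have e0 : Defs.shift (0%R, 0%R) x = x.
  by apply: funext => w; rewrite /Defs.shift; congr x; exact: (GRing.addr0 w).
have := write_rule q (0%R, 0%R) x; rewrite e0 => <-.
by rewrite /tape_step /= ffunE.
Qed.

Lemma classical_pusher : classical pusher.
Proof.
exists (perm (can_inj ptransK)), mvec; split.
- exact: mvec_unit.
- move=> q v x; rewrite head_stepE permE /ptrans /=.
  by case: (trans _ _).
- move=> q x; rewrite tape_stepE permE /ptrans /=.
  by case: (trans _ _).
Qed.

Lemma head_of (c : conf mode bool) q v : confs c -> c.1 v = Some q ->
  c.1 = head_at q v.
Proof.
move=> hc e; apply: funext => w; rewrite /head_at; case: eqP => [->//|ne].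
by case ew: (c.1 w) => [q'|//]; case: ne; apply: hc; rewrite ?ew ?e.
Qed.

Lemma head_case (c : conf mode bool) : confs c ->
  (exists q v, c = (head_at q v, c.2)) \/ (forall q v, c.1 <> head_at q v).
Proof.
move=> hc; have [[v hv]|no] := pselect (exists v, c.1 v <> None).
  left; case e: (c.1 v) hv => [q|//] _; exists q, v.
  by rewrite -(head_of hc e) -surjective_pairing.
by right=> q v e; apply: no; exists v; rewrite e /head_at eqxx.
Qed.

Lemma confs_head_at q v (x : Z2 -> bool) : confs ((head_at q v, x) : conf mode bool).
Proof.
by move=> a b; rewrite /= /head_at; case: eqP => // ->; case: eqP.
Qed.

Lemma write1K v a (x : Z2 -> bool) : write1 v (x v) (write1 v a x) = x.
Proof. by apply: funext => w; rewrite /write1; case: eqP => // ->. Qed.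

Lemma reversible_pusher : reversible pusher.
Proof.
split.
  split.
  - move=> c hc; case: (head_case hc) => [[q [v ->]]|n].
      by rewrite head_stepE; apply: confs_head_at.
    by rewrite head_step_headless.
  - move=> c c' /set_mem hc /set_mem hc'.
    case: (head_case hc) => [[q [v ->]]|n]; case: (head_case hc') => [[q' [v' ->]]|n'].
    + rewrite !head_stepE => -[/head_at_inj [eq ev] ex].
      (* The move depends on the new state alone, so equal new states and positions give equal old
         positions. *)
      have {}ev : v = v' by apply: (GRing.addIr (mvec (trans q' (c'.2 v')).1)); rewrite -{1}eq.
      subst v'.
      have et : ptrans (q, c.2 v) = ptrans (q', c'.2 v).
        rewrite /ptrans [LHS]surjective_pairing [RHS]surjective_pairing eq; congr pair.
        by have := congr1 (fun f => f v) ex; rewrite /write1 eqxx.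
      have [-> e] := can_inj ptransK et; congr pair.
      by rewrite -(write1K v (trans q (c.2 v)).2 c.2) ex e write1K.
    + rewrite head_stepE head_step_headless // => e.
      by case: (n' _ _ (esym (congr1 fst e))).
    + rewrite head_stepE head_step_headless // => e.
      by case: (n _ _ (congr1 fst e)).
    + by rewrite !head_step_headless.
  - move=> c hc; case: (head_case hc) => [[p [w ->]]|n]; last first.
      by exists c => //; rewrite head_step_headless.
    pose v := (w - mvec p)%R.
    pose qs := untrans (p, c.2 v).
    exists (head_at qs.1 v, write1 v qs.2 c.2); first exact: confs_head_at.
    rewrite head_stepE; have ew : write1 v qs.2 c.2 v = qs.2 by rewrite /write1 eqxx.
    rewrite ew; have -> : trans qs.1 qs.2 = (p, c.2 v) by apply: untransK.
    by rewrite /= GRing.subrK write1K.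
pose inv (c : mode * (Z2 -> bool)) :=
  let z := Defs.shift (- mvec c.1)%R c.2 in
  let qs := untrans (c.1, z (0%R, 0%R)) in (qs.1, write1 (0%R, 0%R) qs.2 z).
have shiftK v (x : Z2 -> bool) : Defs.shift (- v)%R (Defs.shift v x) = x.
  by apply: funext => w; rewrite /Defs.shift GRing.addrNK.
have shiftKV v (x : Z2 -> bool) : Defs.shift v (Defs.shift (- v)%R x) = x.
  by apply: funext => w; rewrite /Defs.shift GRing.addrK.
exists inv => -[q x].
  rewrite tape_stepE /inv /= shiftK.
  have -> : write1 (0%R, 0%R) (trans q (x (0%R, 0%R))).2 x (0%R, 0%R)
      = (trans q (x (0%R, 0%R))).2 by rewrite /write1 eqxx.
  set s := x (0%R, 0%R).
  have -> : untrans ((trans q s).1, (trans q s).2) = (q, s).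
    by rewrite -surjective_pairing; exact: (ptransK (q, s)).
  by rewrite /= write1K.
rewrite /inv tape_stepE /=; set z := Defs.shift _ _; set qs := untrans _.
have -> : write1 (0%R, 0%R) qs.2 z (0%R, 0%R) = qs.2 by rewrite /write1 eqxx.
have -> : trans qs.1 qs.2 = (q, z (0%R, 0%R)) by apply: untransK.
by rewrite /= write1K /z shiftKV.
Qed.

(** * Transfer to the two models *)

Local Notation zi := Z_of_int.

Definition config (c : hconf) : conf mode bool :=
  (head_at (hst c) (int_of_Z (hx c), int_of_Z (hy c)),
   fun v => htp c (zi v.1) (zi v.2)).

(** The tape as seen from the head. The position is forgotten, so equal configurations have equal
    images, which is the direction needed to transfer disjointness of orbits. *)
Definition tape_config (c : hconf) : mode * (Z2 -> bool) :=
  (hst c, fun v => htp c (zi v.1 + hx c) (zi v.2 + hy c)).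

Lemma zi_add a b : zi (a + b)%R = zi a + zi b.
Proof. exact: GRing.raddfD. Qed.

Lemma head_step_config c : headM (config c) = config (step c).
Proof.
rewrite /config head_stepE /= !int_of_ZK; congr pair.
  congr head_at; rewrite /mvec; congr pair; rewrite /=.
    by apply: (can_inj Z_of_intK); rewrite zi_add !int_of_ZK.
  by apply: (can_inj Z_of_intK); rewrite zi_add !int_of_ZK.
apply: funext => -[a b]; rewrite /write1 updE /=.
have -> : ((a, b) == (int_of_Z (hx c), int_of_Z (hy c)))
    = (zi a =? hx c) && (zi b =? hy c); last by [].
rewrite xpair_eqE; congr andb.
  by apply/eqP/Z.eqb_spec => [->|<-]; rewrite ?int_of_ZK ?Z_of_intK.
by apply/eqP/Z.eqb_spec => [->|<-]; rewrite ?int_of_ZK ?Z_of_intK.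
Qed.

Lemma tape_step_config c : tapeM (tape_config c) = tape_config (step c).
Proof.
rewrite /tape_config tape_stepE /=; congr pair.
apply: funext => -[a b]; rewrite /Defs.shift /write1 updE /= !zi_add !int_of_ZK.
set q := (trans _ _).1.
have -> : (((a, b) + mvec q)%R == (0%R, 0%R))
    = (zi a + (hx c + movex q) =? hx c) && (zi b + (hy c + movey q) =? hy c).
  rewrite xpair_eqE /=; congr andb.
    apply/eqP/Z.eqb_spec => [/(congr1 zi)|e].
      by rewrite zi_add int_of_ZK => e; change (zi 0%R) with 0 in e; lia.
    apply: (can_inj Z_of_intK); rewrite zi_add int_of_ZK.
    by change (zi 0%R) with 0; lia.
  apply/eqP/Z.eqb_spec => [/(congr1 zi)|e].
    by rewrite zi_add int_of_ZK => e; change (zi 0%R) with 0 in e; lia.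
  apply: (can_inj Z_of_intK); rewrite zi_add int_of_ZK.
  by change (zi 0%R) with 0; lia.
by case: ifP => // _; congr (htp c _ _); lia.
Qed.

Lemma iter_head c n : iter n headM (config c) = config (iter n step c).
Proof. by elim: n => //= n ->; rewrite head_step_config. Qed.

Lemma iter_tape c n : iter n tapeM (tape_config c) = tape_config (iter n step c).
Proof. by elim: n => //= n ->; rewrite tape_step_config. Qed.

Section Universality.
Variable m : nat.
Let outside := predC (box m).

Lemma box_inbox v : box m v -> inbox (Z.of_nat m) (zi v.1) (zi v.2).
Proof.
rewrite /box /inbox; case: v => a b /= /andP[/andP[a1 a2] /andP[b1 b2]]; lia.
Qed.

Lemma join_in T (p : partial (box m) T) x v (h : box m v) :
  join p x v = p (exist _ v h).
Proof.
rewrite /join; case: pselect => [h'|n]; last by case: n.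
by congr p; apply: eq_exist.
Qed.

Lemma join_out T (p : partial (box m) T) (f : Z2 -> T) v :
  ~ box m v -> join p (fun u : {v | outside v} => f (sval u)) v = f v.
Proof. by move=> n; rewrite /join; case: pselect. Qed.

Definition box_tape (p : partial (box m) bool) : tape :=
  fun a b => join p (fun=> false) (int_of_Z a, int_of_Z b).

Lemma box_tape_supp p : supp (Z.of_nat m) (box_tape p).
Proof.
move=> a b; rewrite /box_tape.
have [h _|n] := pselect (box m (int_of_Z a, int_of_Z b)).
  by have := box_inbox h; rewrite /= !int_of_ZK.
by rewrite (join_out p (fun=> false) n).
Qed.

Lemma join_box_tape p A v : vanish (Z.of_nat m) A ->
  join p (fun u : {v | outside v} => A (zi (sval u).1) (zi (sval u).2)) v
    = tor (box_tape p) A (zi v.1) (zi v.2).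
Proof.
move=> vA; rewrite /tor /box_tape !Z_of_intK -surjective_pairing.
have [h|n] := pselect (box m v).
  by rewrite !join_in vA ?orbF //; apply: box_inbox.
rewrite (join_out p (fun=> false) n).
by rewrite (join_out p (fun v => A (zi v.1) (zi v.2)) n).
Qed.

Lemma join_box_tape0 p v :
  join p (fun=> false) v = box_tape p (zi v.1) (zi v.2).
Proof. by rewrite /box_tape !Z_of_intK -surjective_pairing. Qed.

Lemma box_tape_restr p v (h : box m v) :
  box_tape p (zi v.1) (zi v.2) = p (exist _ v h).
Proof. by rewrite -join_box_tape0 join_in. Qed.

(** All heads start at the origin and have their goals there. Since a goal includes the position,
    the final tape is read in its original alignment. *)
Lemma tape_universal (k : nat) (P R : 'I_k -> mode * partial (box m) bool) :
  tape_disjoint0 (M := pusher) P -> tape_transformable (M := pusher) P R.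
Proof.
move=> dP.
pose conf0 (p : mode * partial (box m) bool) := HConf p.1 0 0 (box_tape p.2).
have in0 p : inside (Z.of_nat m) (conf0 p).
  by split; [rewrite /inbox /=; lia|apply: box_tape_supp].
have start p : tape_config (conf0 p) = (p.1, join p.2 (fun=> false)).
  congr pair; apply: funext => v.
  by rewrite /= !Z.add_0_r -join_box_tape0.
have [||A [t [vA h]]] := @universal k (Z.of_nat m) (conf0 \o R)
  (fun j => in0 (R j)) (Z.of_nat m) (conf0 \o P) _ (fun j => in0 (P j)).
- by lia.
- move=> i j ne n l e.
  have := dP i j ltac:(exact/eqP) => /seteqP [/(_ (tape_config
    (iter n step (conf0 (P i)))))]; case; split.
  + by exists n; left; rewrite -iter_tape start.
  + by exists l; left; rewrite e -iter_tape start.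
exists t, (fun u => A (zi (sval u).1) (zi (sval u).2)) => j.
have {}h := h j; set c := iter t step _ in h.
have -> : ((P j).1, join (P j).2 (fun u => A (zi (sval u).1) (zi (sval u).2)))
    = tape_config (HConf (P j).1 0 0 (tor (box_tape (P j).2) A)).
  congr pair; apply: funext => v.
  by rewrite join_box_tape //= !Z.add_0_r.
rewrite iter_tape /=; case: h => h1 h2 h3 h4; split; first exact: h1.
apply: funext => -[v hv]; rewrite /restr /= -(box_tape_restr _ hv).
have := h4 _ _ (box_inbox hv) => /= <-.
by rewrite -/c h2 h3 /= !Z.add_0_r.
Qed.

Lemma head_pattern (p : pattern mode bool (box m)) : patterns_head p ->
  exists qv : mode * Z2, box m qv.2 /\ p.1 = restr (box m) (head_at qv.1 qv.2).
Proof.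
move=> [[c hc <-] [[w hw] /=]]; rewrite /restr /=.
by case e: (c.1 w) => [q|//] _; exists (q, w); rewrite /= (head_of hc e).
Qed.

Lemma head_universal (k : nat) (P R : 'I_k -> pattern mode bool (box m)) :
  (forall j, patterns_head (P j)) -> (forall j, patterns_head (R j)) ->
  head_disjoint0 (M := pusher) P -> head_transformable (M := pusher) P R.
Proof.
move=> hP hR dP.
have /choice [p hp] := fun j => head_pattern (hP j).
have /choice [r hr] := fun j => head_pattern (hR j).
pose conf0 (qv : mode * Z2) (T : partial (box m) bool) :=
  HConf qv.1 (zi qv.2.1) (zi qv.2.2) (box_tape T).
have in0 qv T : box m qv.2 -> inside (Z.of_nat m) (conf0 qv T).
  by move=> h; split; [exact: box_inbox|apply: box_tape_supp].
have head_join (qv : mode * Z2) : box m qv.2 ->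
    join (restr (box m) (head_at qv.1 qv.2)) (fun=> None) = head_at qv.1 qv.2.
  move=> h; apply: funext => v; have [hv|n] := pselect (box m v).
    by rewrite join_in.
  rewrite (join_out _ (fun=> None) n) /head_at.
  by case: eqP => // e; case: n; rewrite e.
have conf_join A (c : pattern mode bool (box m)) qv : vanish (Z.of_nat m) A ->
    box m qv.2 -> c.1 = restr (box m) (head_at qv.1 qv.2) ->
    cjoin c (headless mode (fun u => A (zi (sval u).1) (zi (sval u).2)))
      = config (HConf qv.1 (zi qv.2.1) (zi qv.2.2) (tor (box_tape c.2) A)).
  move=> vA h e; rewrite /cjoin /config /= e head_join // !Z_of_intK.
  rewrite -surjective_pairing; congr pair; apply: funext => v.
  by rewrite join_box_tape.
have start j : cjoin (P j) (headless mode (fun=> false))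
    = config (conf0 (p j) (P j).2).
  have [b e] := hp j; rewrite (@conf_join (fun _ _ => false) _ (p j)) //.
  congr config; congr HConf; apply: tape_ext => x y.
  by rewrite /tor orbF.
have [||A [t [vA h]]] := @universal k (Z.of_nat m) (fun j => conf0 (r j) (R j).2)
  (fun j => in0 _ _ (hr j).1) (Z.of_nat m) (fun j => conf0 (p j) (P j).2) _
  (fun j => in0 _ _ (hp j).1).
- by lia.
- move=> i j ne n l e.
  have := dP i j ltac:(exact/eqP) => /seteqP [/(_ (config
    (iter n step (conf0 (p i) (P i).2))))]; case; split.
  + by exists n; left; rewrite -iter_head -start.
  + by exists l; left; rewrite e -iter_head -start.
pose x := headless mode
  (fun u : {v | outside v} => A (zi (sval u).1) (zi (sval u).2)).
exists t, x; split.
  exists (fun=> None, fun v => A (zi v.1) (zi v.2)) => //.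
move=> j; have {}h := h j; set c := iter t step _ in h.
have [b e] := hp j; rewrite /x (conf_join A _ _ vA b e).
split; first exact: confs_head_at.
rewrite iter_head -/c; case: h => h1 h2 h3 h4.
have [b' e'] := hr j; rewrite [RHS]surjective_pairing; congr pair.
  by rewrite /= h1 h2 h3 e' /= !Z_of_intK -surjective_pairing.
apply: funext => -[v hv]; rewrite /restr /= -(box_tape_restr _ hv).
by have := h4 _ _ (box_inbox hv) => /= <-.
Qed.

End Universality.

Theorem theorem7 :
  exists M : turing_machine,
    [/\ reversible M, classical M,
        head_physically_universal M & tape_physically_universal M].
Proof.
exists pusher; split.
- exact: reversible_pusher.
- exact: classical_pusher.
- by move=> k m P R; apply: head_universal.
- by move=> k m P R; apply: tape_universal.
Qed.
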